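(* Let $M>0$, $\delta\in(0,1)$, let $\mathcal{J}=\{J:\|J\|_\infty\le M\}$ be the set of all $n\times n$ interaction matrices of infinity norm at most $M$, and assume that $\ell\ge1$ independent samples from $\Pr_{J^*}$, where $J^*\in\mathcal{J}$, are obtained. Then there is a polynomial time algorithm that finds $\hat J\in\mathcal{J}$ such that, with probability at least $1-\delta$, $$\|\hat J-J^*\|_F\le C(M)\sqrt{\frac{n^2\log(n\ell)+\log(1/\delta)}{\ell}},$$ where $C(M)$ is a (singly) exponential function of $M$.
   Context: An interaction matrix is a real symmetric $n\times n$ matrix $J$ with zero diagonal. The Ising model $\Pr_J$ is the distribution on $\{\pm1\}^n$ with $\Pr_J[x]\propto\exp(x^\top Jx/2)$. $\|J\|_\infty=\max_i\sum_j|J_{ij}|$ and $\|\cdot\|_F$ is the Frobenius norm. ''Singly exponential'' means bounded by $ae^{bM}$ for universal constants $a,b>0$. *)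

(* Defs.v *)
From HB Require Import structures.
From mathcomp Require Import all_boot all_order all_algebra.
From mathcomp Require Import all_classical all_reals all_analysis.

Set Implicit Arguments.
Unset Strict Implicit.
Unset Printing Implicit Defensive.

Import Order.TTheory GRing.Theory Num.Theory.

Local Open Scope ring_scope.

(** * Ising models *)

(* A configuration in {-1,+1}^n is stored as booleans; [spin] decodes it. *)
Definition config (n : nat) := {ffun 'I_n -> bool}.

Definition spin (A : pzRingType) (b : bool) : A := if b then 1 else -1.

Definition spin_vec (R : realType) (n : nat) (x : config n) : 'cV[R]_n :=
  \col_i spin R (x i).

Definition interaction_matrix (R : realType) (n : nat) (J : 'M[R]_n) : Prop :=
  J^T = J /\ forall i, J i i = 0.

Definition infty_norm (R : realType) (n : nat) (J : 'M[R]_n) : R :=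
  \big[Num.max/0]_i \sum_j `|J i j|.

Definition frobenius_norm (R : realType) (n : nat) (A : 'M[R]_n) : R :=
  Num.sqrt (\sum_i \sum_j A i j ^+ 2).

Definition in_class (R : realType) (n : nat) (M : R) (J : 'M[R]_n) : Prop :=
  interaction_matrix J /\ infty_norm J <= M.

Definition ising_weight (R : realType) (n : nat) (J : 'M[R]_n) (x : config n)
    : R :=
  expR (((spin_vec R x)^T *m J *m spin_vec R x) 0 0 / 2).

Definition ising_pmf (R : realType) (n : nat) (J : 'M[R]_n) (x : config n)
    : R :=
  ising_weight J x / \sum_(y : config n) ising_weight J y.

(* [X s] is the [s]-th sample. *)
Definition samples (n l : nat) := {ffun 'I_l -> config n}.

(* Probability of [E] when the [l] samples are independent with law Pr_J. *)
Definition iid_prob (R : realType) (n l : nat) (J : 'M[R]_n)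
    (E : pred (samples n l)) : R :=
  \sum_(X | E X) \prod_(s < l) ising_pmf J (X s).

Definition singly_exponential (R : realType) (C : R -> R) : Prop :=
  exists a b : R, [/\ 0 < a, 0 < b & forall M, 0 < M -> C M <= a * expR (b * M)].

(** * Algorithms

   A random access machine with integer cells and logarithmic cost (Aho,
   Hopcroft and Ullman), with structured control flow in place of jumps.  Up to
   a polynomial its running time is that of a Turing machine.

   The machine also has read-only input tracks.  A real parameter [r] is given
   by a track whose [k]-th cell is the floor of [2^k r].  Reading cell [k] of a
   track costs at least [k], as in the oracle-machine model of real computation,
   where the precision of a query is written in unary. *)

Inductive expr :=
| Const of int
| Input of nat & expr     (* track, position *)
| Cell of expr            (* address *)
| Add of expr & expr
| Sub of expr & expr
| Mul of expr & expr
| Div of expr & expr.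

Inductive prog :=
| Skip
| Store of expr & expr    (* address, value *)
| Seq of prog & prog
| If of expr & prog & prog
| While of expr & prog.

Definition tracks := nat -> nat -> int.

Definition memory := nat -> int.

(* The value of an expression used as an address or a position is replaced by
   its absolute value. *)
Fixpoint eval (inp : tracks) (m : memory) (e : expr) : int :=
  match e with
  | Const z => z
  | Input t e1 => inp t `|eval inp m e1|%N
  | Cell e1 => m `|eval inp m e1|%N
  | Add e1 e2 => eval inp m e1 + eval inp m e2
  | Sub e1 e2 => eval inp m e1 - eval inp m e2
  | Mul e1 e2 => eval inp m e1 * eval inp m e2
  | Div e1 e2 => (eval inp m e1 %/ eval inp m e2)%Z
  end.

(* Number of binary digits of the absolute value, and 1 for 0. *)
Definition bitlen (z : int) : nat := (trunc_log 2 `|z|%N).+1.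

Fixpoint eval_cost (inp : tracks) (m : memory) (e : expr) : nat :=
  (bitlen (eval inp m e) +
   match e with
   | Const _ => 0
   | Input _ e1 => eval_cost inp m e1 + `|eval inp m e1|
   | Cell e1 => eval_cost inp m e1
   | Add e1 e2 | Sub e1 e2 | Mul e1 e2 | Div e1 e2 =>
       eval_cost inp m e1 + eval_cost inp m e2
   end)%N.

Definition update (m : memory) (a : nat) (v : int) : memory :=
  fun k => if k == a then v else m k.

(* [exec inp c m m' t]: started in memory [m], [c] halts in memory [m'] at
   total cost [t].  Tests succeed on positive values. *)
Inductive exec (inp : tracks) : prog -> memory -> memory -> nat -> Prop :=
| ExecSkip m : exec inp Skip m m 1
| ExecStore a e m :
    exec inp (Store a e) m (update m `|eval inp m a|%N (eval inp m e))
      (eval_cost inp m a + eval_cost inp m e).+1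
| ExecSeq c1 c2 m m1 m2 t1 t2 :
    exec inp c1 m m1 t1 -> exec inp c2 m1 m2 t2 ->
    exec inp (Seq c1 c2) m m2 (t1 + t2).+1
| ExecIfTrue e c1 c2 m m1 t :
    0 < eval inp m e -> exec inp c1 m m1 t ->
    exec inp (If e c1 c2) m m1 (eval_cost inp m e + t).+1
| ExecIfFalse e c1 c2 m m1 t :
    eval inp m e <= 0 -> exec inp c2 m m1 t ->
    exec inp (If e c1 c2) m m1 (eval_cost inp m e + t).+1
| ExecWhileTrue e c m m1 m2 t1 t2 :
    0 < eval inp m e -> exec inp c m m1 t1 -> exec inp (While e c) m1 m2 t2 ->
    exec inp (While e c) m m2 (eval_cost inp m e + t1 + t2).+1
| ExecWhileFalse e c m :
    eval inp m e <= 0 -> exec inp (While e c) m m (eval_cost inp m e).+1.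

Lemma exec_det (inp : tracks) (c : prog) (m m1 m2 : memory) (t1 t2 : nat) :
  exec inp c m m1 t1 -> exec inp c m m2 t2 -> m1 = m2 /\ t1 = t2.
Proof.
move=> H; elim: H m2 t2 => {c m m1 t1}.
- by move=> m m2 t2 H; inversion H.
- by move=> a e m m2 t2 H; inversion H.
- move=> c1 c2 m m1 m2 t1 t2 _ IH1 _ IH2 m' t' H.
  inversion H as [| |? ? ? n1 ? s1 s2 E1 E2 | | | |]; subst.
  by have [? ?] := IH1 _ _ E1; subst; have [? ?] := IH2 _ _ E2; subst.
- move=> e c1 c2 m m1 t He _ IH m' t' H.
  inversion H as [| | |? ? ? ? ? s Hs E|? ? ? ? ? s Hs E| |]; subst.
    by have [? ?] := IH _ _ E; subst.
  by move: Hs; rewrite leNgt He.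
- move=> e c1 c2 m m1 t He _ IH m' t' H.
  inversion H as [| | |? ? ? ? ? s Hs E|? ? ? ? ? s Hs E| |]; subst.
    by move: Hs; rewrite ltNge He.
  by have [? ?] := IH _ _ E; subst.
- move=> e c m m1 m2 t1 t2 He _ IH1 _ IH2 m' t' H.
  inversion H as [| | | | |? ? ? n1 ? s1 s2 Hs E1 E2|? ? ? Hs]; subst.
    by have [? ?] := IH1 _ _ E1; subst; have [? ?] := IH2 _ _ E2; subst.
  by move: Hs; rewrite leNgt He.
- move=> e c m He m' t' H.
  inversion H as [| | | | |? ? ? n1 ? s1 s2 Hs E1 E2|]; subst => //.
  by move: Hs; rewrite ltNge He.
Qed.

(* Track 2 lists the entries of the samples, one sample after the other. *)
Definition learning_input (R : realType) (M delta : R) (n l : nat)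
    (X : samples n l) : tracks :=
  fun t k =>
    match t with
    | 0 => n%:Z
    | 1 => l%:Z
    | 2 => match (insub (k %/ n)%N : option 'I_l),
                 (insub (k %% n)%N : option 'I_n) with
           | Some s, Some i => spin int (X s i)
           | _, _ => 0
           end
    | 3 => Num.floor (2 ^+ k * M)
    | 4 => Num.floor (2 ^+ k * delta)
    | _ => 0
    end.

(* Polynomially equivalent to the bit size of the input: the samples take [n * l]
   bits, and [M] and [1/delta] are measured by the length of their integer
   parts. *)
Definition input_size (R : realType) (M delta : R) (n l : nat) : nat :=
  (n + l + bitlen (Num.floor M) + bitlen (Num.floor delta^-1))%N.

(* Cell 0 holds a common denominator, followed by the numerators of the entries
   in row-major order. *)
Definition output_matrix (R : realType) (n : nat) (m : memory) : 'M[R]_n :=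
  \matrix_(i, j) ((m (i * n + j).+1)%:~R / (m 0)%:~R).

Definition outputs_within (R : realType) (n : nat) (c : prog) (inp : tracks)
    (T : nat) (A : 'M[R]_n) : Prop :=
  exists (m : memory) (t : nat),
    [/\ exec inp c (fun=> 0) m t, (t <= T)%N & A = output_matrix R n m].

(* Main.v *)
Require Import Defs.
From HB Require Import structures.
From mathcomp Require Import all_boot all_order all_algebra.
From mathcomp Require Import all_classical all_reals all_analysis.
From mathcomp Require Import ring lra zify.

Set Implicit Arguments.
Unset Strict Implicit.
Unset Printing Implicit Defensive.

Import Order.TTheory GRing.Theory Num.Theory.
Import Defs.

Local Open Scope ring_scope.

(** The estimator minimises the interaction screening loss
[S A x = \sum_i exp(- x_i (A x)_i)], summed over the samples, over the matrices
[A] of the class.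

Statistics.  Fix the true matrix [J], put [D = A - J], [b = D x] and
[y_i = x_i exp(- x_i (J x)_i)].  Strong convexity of the exponential gives
[S J x - S A x <= <y, b> - a |b|^2] with [a] of order [e^(-3M)].  Everything rests on
a moment bound in which the dimension does not appear ([screening_mgf]):
[E exp(th (S J - S A)) <= exp(- th c |D|_F^2)], with [th] and [c] singly exponentially
small in [M].  Treating the rows separately would lose a factor [n] in front of
[log(1/delta)]; it is the sum over the rows, which share the same samples, that has
to be controlled.  By Jensen's inequality the moment bound follows from an upper
bound on the mean of [<y, b> - a |b|^2] under the law tilted by
[exp(th (<y, b> - a |b|^2))] ([tilted_mean]).  Such means are accessible because
flipping one spin shows [E (y_j h) = E (y_j (h - h o flip_j)) / 2] for every [h]
([stein]): no mixing of the model is needed.  This identity, used three times,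
shows that [<y, b>] has a mean of order [th], that [|D y|^2] has a mean of order
[|D|_F^2], and that [<b, D y>] has a mean of at least [e^(-M) |D|_F^2]; the last two and
the Cauchy-Schwarz inequality force the mean of [|b|^2] above a multiple of [|D|_F^2].
Chernoff's inequality and a union bound over the finitely many matrices that the
algorithm can output conclude ([screening_risk]); their number has a logarithm of
order [n^2 log(n l)], which is where that term of the rate comes from.

Optimisation.  Replacing [exp(-v)] by [(1 - v/N)^N] with [N = 2l] changes the loss by a
constant per entry and makes its gradient computable in integers.  Linear
minimisation over symmetric matrices with bounded rows is a genuine linear
program, but over matrices with bounded rows it is a maximum in each row.  So the
Frank-Wolfe method is run on the latter set, with a penalty on [A - A^T], and at the
end each pair of entries [A_ij], [A_ji] is replaced by the one of smaller absolute
value.  This restores symmetry, cannot increase a row norm, and costs no more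
than the penalty already paid ([rounded_loss]).  With the step sizes [2/(t+3)] the
iterates are integer matrices divided by known integers, so no rounding occurs.
When [M >= l] the zero matrix is accurate enough ([large_norm_regime]); otherwise
[M] enters through its first [l] binary digits only.

Computation.  A calculus of triples that count elementary steps ([wp]) shows that
the program performs such a run ([wp_main]); every number that it meets has
polynomially many digits, so that an elementary step has polynomial cost. *)

(** * Elementary inequalities *)

Section Elementary.
Variable R : realType.
Implicit Types x y a b t : R.

Lemma expR_dist x y t : x <= t -> y <= t -> `|expR x - expR y| <= `|x - y| * expR t.
Proof.
wlog le_yx : x y / y <= x => [hw|xt yt].
  case/orP: (le_total x y) => h xt yt; last exact: hw.
  by rewrite distrC (distrC x); apply: hw.
rewrite !ger0_norm ?subr_ge0 ?ler_expR //.
have h1 : 1 + (y - x) <= expR (y - x) by exact: expR_ge1Dx.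
have h2 : expR x * expR (y - x) = expR y by rewrite -expRD addrC subrK.
have h3 : expR x <= expR t by rewrite ler_expR.
have h4 := expR_gt0 x.
nra.
Qed.

(** Cauchy-Schwarz for the weights [a]; both sides are double sums, compared term
by term after symmetrizing the right-hand one. *)
Lemma weighted_sq (I : finType) (a z : I -> R) :
  (forall i, 0 <= a i) ->
  (\sum_i a i * z i) ^+ 2 <= (\sum_i a i) * \sum_i a i * z i ^+ 2.
Proof.
move=> a0; rewrite expr2 big_distrlr /= big_distrlr /=.
have e : \sum_i \sum_j a i * (a j * z j ^+ 2) =
   \sum_i \sum_j a i * a j * ((z i ^+ 2 + z j ^+ 2) / 2).
  transitivity (2^-1 * (\sum_i \sum_j a i * (a j * z j ^+ 2) + \sum_i \sum_j a j * (a i * z i ^+ 2))).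
    rewrite [in X in _ * (_ + X)]exchange_big /=.
    set u := \sum_i _; lra.
  rewrite -big_split mulr_sumr; apply: eq_bigr => i _ /=.
  rewrite -big_split mulr_sumr; apply: eq_bigr => j _ /=.
  by lra.
rewrite e; apply: ler_sum => i _; apply: ler_sum => j _.
rewrite mulrACA; apply: ler_wpM2l; first exact: mulr_ge0.
have := sqr_ge0 (z i - z j); rewrite sqrrB; lra.
Qed.

(** Schur's test: bounded row and column sums bound the operator norm.  For the
symmetric matrices below this is what makes every estimate free of the
dimension. *)
Lemma schur_test (I : finType) (A : I -> I -> R) (c : R) (z : I -> R) :
  0 <= c ->
  (forall i, \sum_j `|A i j| <= c) -> (forall j, \sum_i `|A i j| <= c) ->
  \sum_i (\sum_j `|A i j| * `|z j|) ^+ 2 <= c ^+ 2 * \sum_j z j ^+ 2.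
Proof.
move=> c0 hr hc.
apply: (@le_trans _ _ (\sum_i c * \sum_j `|A i j| * z j ^+ 2)).
  apply: ler_sum => i _.
  apply: le_trans (weighted_sq _ _) _ => //.
  under [in X in _ * X <= _]eq_bigr do rewrite real_normK ?num_real //.
  apply: ler_wpM2r => //; apply: sumr_ge0 => j _.
  by rewrite mulr_ge0 ?sqr_ge0.
rewrite -mulr_sumr expr2 -mulrA; apply: ler_wpM2l => //.
rewrite exchange_big /= mulr_sumr; apply: ler_sum => j _.
by rewrite -mulr_suml; apply: ler_wpM2r; rewrite ?sqr_ge0.
Qed.

Lemma schur_test_sum (I : finType) (A : I -> I -> R) (c : R) (z : I -> R) :
  0 <= c ->
  (forall i, \sum_j `|A i j| <= c) -> (forall j, \sum_i `|A i j| <= c) ->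
  \sum_i (\sum_j A i j * z j) ^+ 2 <= c ^+ 2 * \sum_j z j ^+ 2.
Proof.
move=> c0 hr hc; apply: le_trans (schur_test z c0 hr hc).
apply: ler_sum => i _; rewrite -real_normK ?num_real //.
rewrite ler_sqr ?nnegrE //; last by apply: sumr_ge0 => j _; rewrite mulr_ge0.
by apply: le_trans (ler_norm_sum _ _ _) _; apply: ler_sum => j _; rewrite normrM.
Qed.

End Elementary.

(** * Spins and local fields *)

Section Fields.
Variables (R : realType) (n : nat).
Implicit Types (A J : 'M[R]_n) (x : config n) (i j k : 'I_n).

Definition spin_at x i : R := spin R (x i).
Definition flip j x : config n := [ffun i => if i == j then ~~ x i else x i].
Definition local_field A x i : R := \sum_j A i j * spin_at x j.

Lemma flipK j : involutive (flip j).
Proof. by move=> x; apply/ffunP => i; rewrite !ffunE; case: eqP => // _; rewrite negbK. Qed.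

Lemma spin_at_flip j x i : spin_at (flip j x) i = if i == j then - spin_at x i else spin_at x i.
Proof.
rewrite /spin_at ffunE; case: eqP => // _; rewrite /spin.
by case: (x i) => /=; rewrite ?opprK.
Qed.

Lemma spin_at_sqr x i : spin_at x i * spin_at x i = 1.
Proof. by rewrite /spin_at /spin; case: (x i); rewrite ?mulrNN mulr1. Qed.

Lemma norm_spin_at x i : `|spin_at x i| = 1.
Proof. by rewrite /spin_at /spin; case: (x i); rewrite ?normrN normr1. Qed.

Lemma field_flip A j x i : local_field A (flip j x) i = local_field A x i - 2 * A i j * spin_at x j.
Proof.
rewrite /local_field (bigD1 j) //= [in RHS](bigD1 j) //= spin_at_flip eqxx.
rewrite (eq_bigr (fun k => A i k * spin_at x k)); last first.
  by move=> k /negbTE kj; rewrite spin_at_flip kj.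
by lra.
Qed.

Lemma norm_field A x i c : \sum_j `|A i j| <= c -> `|local_field A x i| <= c.
Proof.
apply: le_trans; rewrite /local_field; apply: le_trans (ler_norm_sum _ _ _) _.
by apply: ler_sum => j _; rewrite normrM norm_spin_at mulr1.
Qed.

Lemma ising_weightE J x : ising_weight J x = expR ((\sum_i spin_at x i * local_field J x i) / 2).
Proof.
rewrite /ising_weight -mulmxA mxE; congr (expR (_ / 2)).
apply: eq_bigr => i _; rewrite !mxE; congr (_ * _).
by apply: eq_bigr => j _; rewrite !mxE.
Qed.

Lemma ising_weight_gt0 J x : 0 < ising_weight J x.
Proof. exact: expR_gt0. Qed.

(** The quadratic form counts the pair [(i, j)] twice, so half of its change under a
flip of [j] is twice the local field at [j]; the zero diagonal removes the
self-interaction. *)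
Lemma ising_weight_flip J j x : J^T = J -> J j j = 0 ->
  ising_weight J (flip j x) = ising_weight J x * expR (- (2 * (spin_at x j * local_field J x j))).
Proof.
move=> Jsym Jjj; rewrite !ising_weightE -expRD; congr expR.
have Je i : J i j = J j i by rewrite -[in LHS]Jsym mxE.
have -> : \sum_i spin_at (flip j x) i * local_field J (flip j x) i =
  \sum_i (spin_at x i * local_field J x i - 2 * spin_at x j * (J j i * spin_at x i))
    - 2 * (spin_at x j * local_field J x j).
  rewrite (bigD1 j) //= [in RHS](bigD1 j) //= spin_at_flip eqxx field_flip Jjj.
  rewrite (eq_bigr (fun i => spin_at x i * local_field J x i - 2 * spin_at x j * (J j i * spin_at x i))).
    by lra.
  by move=> i /negbTE ij; rewrite spin_at_flip ij field_flip Je; lra.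
rewrite sumrB -mulr_sumr -/(local_field J x j); lra.
Qed.

End Fields.

(** * The flip identity for tilted Ising laws *)

Section Stein.
Variables (R : realType) (n : nat) (J : 'M[R]_n) (M : R).
Hypothesis Jsym : J^T = J.
Hypothesis Jdiag : forall i, J i i = 0.
Hypothesis Jrow : forall i, \sum_j `|J i j| <= M.
Implicit Types (x : config n) (i j k : 'I_n) (h g : config n -> R).

Let E : R := expR M.
Let wt x := ising_weight J x.

(** The gradient of the screening loss at [J] is, up to sign, [score x i * x_k]; the
factor [exp(- x_i u_i)] undoes the bias that the local field [u_i] gives to the
spin at [i]. *)
Definition score x i : R := spin_at R x i * expR (- (spin_at R x i * local_field J x i)).

Let r j x := wt x * expR (- (spin_at R x j * local_field J x j)).

(** The law reweighted by [exp(- x_j u_j)] does not see the spin at [j] any more. *)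
Lemma r_flip j x : r j (flip j x) = r j x.
Proof.
rewrite /r /wt ising_weight_flip // field_flip Jdiag spin_at_flip eqxx -mulrA -expRD.
by congr (_ * expR _); ring.
Qed.

Lemma norm_sgfield x j : `|spin_at R x j * local_field J x j| <= M.
Proof. by rewrite normrM norm_spin_at mul1r; exact: norm_field. Qed.

Lemma score_exp_le x j : expR (- (spin_at R x j * local_field J x j)) <= E.
Proof. by rewrite ler_expR; have := norm_sgfield x j; rewrite ler_norml => /andP[]; lra. Qed.

Lemma score_exp_ge x j : E^-1 <= expR (- (spin_at R x j * local_field J x j)).
Proof. by rewrite -expRN ler_expR; have := norm_sgfield x j; rewrite ler_norml => /andP[]; lra. Qed.

Lemma norm_score x i : `|score x i| <= E.
Proof. by rewrite normrM norm_spin_at mul1r ger0_norm ?expR_ge0 // score_exp_le. Qed.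

(** The score at [j] may change sign, but another score depends on the spin at [j]
only through its local field, hence the interaction strength on the right. *)
Lemma score_diff j x i :
  `|score x i - score (flip j x) i| <= 2 * E * ((i == j)%:R + `|J i j|).
Proof.
have E0 : 0 < E := expR_gt0 _.
have J0 : 0 <= `|J i j| := normr_ge0 _.
case: (eqVneq i j) => [->|ij].
  apply: le_trans (ler_normB _ _) _.
  by have := norm_score x j; have := norm_score (flip j x) j; rewrite Jdiag normr0 addr0 mulr1; lra.
rewrite /score spin_at_flip (negbTE ij) -mulrBr normrM norm_spin_at mul1r add0r.
apply: le_trans (expR_dist (t := M) _ _) _.
- by have := norm_sgfield x i; rewrite ler_norml => /andP[]; lra.
- by have := norm_sgfield (flip j x) i; rewrite ler_norml spin_at_flip (negbTE ij) => /andP[]; lra.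
rewrite field_flip mulrBr -/E.
set a := spin_at R x i * local_field J x i.
rewrite (_ : - a - _ = - (2 * (spin_at R x i * spin_at R x j * J i j))); last by ring.
by rewrite normrN !normrM !norm_spin_at !mul1r ger0_norm //; lra.
Qed.

Lemma sum_flip j (F : config n -> R) : \sum_x F x = \sum_x F (flip j x).
Proof. exact: (reindex_inj (inv_inj (@flipK n j))). Qed.

(** Under the reweighted law [r j], the spin at [j] is a fair coin independent of the
other spins; pairing [x] with its flip antisymmetrizes [h]. *)
Lemma stein j h :
  \sum_x wt x * (score x j * h x) =
  2^-1 * \sum_x wt x * (score x j * (h x - h (flip j x))).
Proof.
have e : \sum_x wt x * (score x j * h x) = - \sum_x wt x * (score x j * h (flip j x)).
  transitivity (\sum_x r j x * (spin_at R x j * h x)).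
    by apply: eq_bigr => x _; rewrite /r /score; ring.
  rewrite (sum_flip j) -sumrN; apply: eq_bigr => x _.
  by rewrite r_flip spin_at_flip eqxx /r /score; ring.
have -> : \sum_x wt x * (score x j * (h x - h (flip j x))) =
  \sum_x wt x * (score x j * h x) - \sum_x wt x * (score x j * h (flip j x)).
  by rewrite -sumrB; apply: eq_bigr => x _; ring.
lra.
Qed.

Section Tilt.
Variable g : config n -> R.

(** Not normalized: the means below are compared with [tilt (fun=> 1)]. *)
Definition tilt h := \sum_x ising_weight J x * expR (g x) * h x.

Lemma tilt_le h1 h2 : (forall x, h1 x <= h2 x) -> tilt h1 <= tilt h2.
Proof.
move=> h; apply: ler_sum => x _; apply: ler_wpM2l => //.
by rewrite mulr_ge0 // ?expR_ge0 // ltW // ising_weight_gt0.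
Qed.

Lemma tiltD h1 h2 : tilt (fun x => h1 x + h2 x) = tilt h1 + tilt h2.
Proof. by rewrite /tilt -big_split; apply: eq_bigr => x _; rewrite mulrDr. Qed.

Lemma tiltZ c h : tilt (fun x => c * h x) = c * tilt h.
Proof. by rewrite /tilt mulr_sumr; apply: eq_bigr => x _; ring. Qed.

Lemma tilt_sum (F : 'I_n -> config n -> R) :
  tilt (fun x => \sum_j F j x) = \sum_j tilt (F j).
Proof. by rewrite /tilt exchange_big /=; apply: eq_bigr => x _; rewrite mulr_sumr. Qed.

Lemma tilt_ge0 h : (forall x, 0 <= h x) -> 0 <= tilt h.
Proof.
move=> h0; by apply: sumr_ge0 => x _; rewrite !mulr_ge0 ?expR_ge0.
Qed.

Lemma tilt1_gt0 : 0 < tilt (fun=> 1).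
Proof.
rewrite /tilt (bigD1 [ffun=> true]) //=; apply: ltr_pwDl.
  by rewrite mulr1 mulr_gt0 ?expR_gt0 ?ising_weight_gt0.
by apply: sumr_ge0 => x _; rewrite !mulr_ge0 ?expR_ge0.
Qed.

Lemma exp_diff_sum (a b : R) : `|expR a - expR b| <= `|a - b| * (expR a + expR b).
Proof.
have [ab|ba] := leP a b.
  apply: le_trans (expR_dist (t := b) _ _) _ => //.
  by apply: ler_wpM2l => //; rewrite lerDr expR_ge0.
apply: le_trans (expR_dist (t := a) _ _) _ => //; first exact: ltW.
by apply: ler_wpM2l => //; rewrite lerDl expR_ge0.
Qed.

(** The flip identity applied to [h e^g], with the increment of [e^g] treated as an
error.  A flip maps the terms that carry [e^(g o flip)] to terms that carry [e^g],
so that the error is again a mean under the same tilt. *)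
Lemma stein_tilt j h :
  `|tilt (fun x => score x j * h x) -
    2^-1 * tilt (fun x => score x j * (h x - h (flip j x)))| <=
  E * tilt (fun x => `|g x - g (flip j x)| * (`|h x| + `|h x - h (flip j x)|)).
Proof.
pose G x := `|g x - g (flip j x)|.
have G_flip x : G (flip j x) = G x by rewrite /G flipK distrC.
have G0 x : 0 <= G x by exact: normr_ge0.
have r0 x : 0 <= r j x by rewrite mulr_ge0 ?expR_ge0 // ltW // ising_weight_gt0.
have -> : tilt (fun x => score x j * h x) -
    2^-1 * tilt (fun x => score x j * (h x - h (flip j x))) =
  2^-1 * \sum_x wt x * (score x j * (h (flip j x) * (expR (g x) - expR (g (flip j x))))).
  have -> : tilt (fun x => score x j * h x) = 2^-1 * \sum_x wt x *
       (score x j * (h x * expR (g x) - h (flip j x) * expR (g (flip j x)))).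
    rewrite -stein; apply: eq_bigr => x _; rewrite /wt; ring.
  rewrite -mulrBr -sumrB; congr (_ * _); apply: eq_bigr => x _; rewrite /wt; ring.
rewrite normrM ger0_norm ?invr_ge0 //.
apply: (@le_trans _ _ (2^-1 * \sum_x (r j x * G x * (`|h (flip j x)| * expR (g x))
       + r j x * G x * (`|h (flip j x)| * expR (g (flip j x)))))).
  apply: ler_wpM2l; rewrite ?invr_ge0 //.
  apply: le_trans (ler_norm_sum _ _ _) _; apply: ler_sum => x _.
  rewrite !normrM norm_spin_at mul1r (ger0_norm (ltW (ising_weight_gt0 J x))) (ger0_norm (expR_ge0 _)).
  have h1 := exp_diff_sum (g x) (g (flip j x)).
  rewrite -mulrDr -mulrDr /r.
  rewrite -[X in _ <= X](_ : wt x * (expR (- (spin_at R x j * local_field J x j)) *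
    (`|h (flip j x)| * (G x * (expR (g x) + expR (g (flip j x))))))  = _); last by ring.
  apply: ler_wpM2l; first exact/ltW/ising_weight_gt0.
  apply: ler_wpM2l; first exact/expR_ge0.
  exact: ler_wpM2l.
rewrite big_split /= [X in _ + X](sum_flip j).
under [X in _ + X]eq_bigr do rewrite r_flip G_flip flipK.
rewrite -big_split mulr_sumr /tilt mulr_sumr; apply: ler_sum => x _ /=.
have rE : r j x <= wt x * E.
  by apply: ler_wpM2l; [exact/ltW/ising_weight_gt0|exact: score_exp_le].
have h1 : `|h (flip j x)| <= `|h x| + `|h x - h (flip j x)|.
  by rewrite -{1}(subKr (h x) (h (flip j x))); exact: ler_normB.
rewrite -/wt -/(G x).
have [e0 n0 n1] : [/\ 0 <= expR (g x), 0 <= `|h x| & 0 <= `|h x - h (flip j x)|].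
  by rewrite expR_ge0.
have h2 : r j x * G x * expR (g x) * (2^-1 * (`|h (flip j x)| + `|h x|)) <=
   wt x * E * G x * expR (g x) * (`|h x| + `|h x - h (flip j x)|).
  apply: ler_pM; last lra.
  - by apply: mulr_ge0 => //; apply: mulr_ge0; [exact: r0|exact: G0].
  - by have := normr_ge0 (h (flip j x)); lra.
  - apply: ler_wpM2r => //; apply: ler_wpM2r; [exact: G0|exact: rE].
by apply: le_trans (le_trans _ h2) _; rewrite /wt le_eqVlt; apply/orP; left; apply/eqP; ring.
Qed.

End Tilt.
End Stein.

(** * Increments of the exponent under a flip *)

Section Increments.
Variables (R : realType) (n : nat) (J D : 'M[R]_n) (M : R).
Hypothesis Jsym : J^T = J.
Hypothesis Jdiag : forall i, J i i = 0.
Hypothesis Jrow : forall i, \sum_j `|J i j| <= M.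
Hypothesis Dsym : D^T = D.
Hypothesis Ddiag : forall i, D i i = 0.
Hypothesis Drow : forall i, \sum_j `|D i j| <= 2 * M.
Hypothesis M_ge0 : 0 <= M.
Implicit Types (x : config n) (i j k : 'I_n).

Local Notation E := (expR M).
Local Notation y := (score J).
Local Notation b := (local_field D).

(** In matrix notation [dscore] is [D y], [dfield2] is [D b = D^2 x] and [dscore2] is
[D^2 y]; they appear when the derivative of a quadratic form is taken. *)
Definition dscore x i : R := \sum_j D i j * y x j.
Definition dfield2 x j : R := \sum_i D j i * b x i.
Definition dscore2 x j : R := \sum_i D j i * dscore x i.
Definition rowsq j : R := \sum_i D j i ^+ 2.
Definition sqfield x : R := \sum_i b x i ^+ 2.
Definition sqscore x : R := \sum_i dscore x i ^+ 2.
Definition sq_frobenius : R := \sum_j rowsq j.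
(** The first-order term of the excess loss. *)
Definition corr x : R := \sum_j y x j * b x j.

Let JC i j : J i j = J j i. Proof. by rewrite -[in LHS]Jsym mxE. Qed.
Let DC i j : D i j = D j i. Proof. by rewrite -[in LHS]Dsym mxE. Qed.
Let E_ge1 : 1 <= E. Proof. by have := expR_ge1Dx M; have := M_ge0; lra. Qed.
Let ME : M <= E. Proof. by have := expR_ge1Dx M; have := M_ge0; lra. Qed.

Local Ltac slra := have ? := M_ge0; have ? := E_ge1; have ? := ME; lra.
Local Ltac snra := have ? := M_ge0; have ? := E_ge1; have ? := ME; nra.

Let Jcol j : \sum_i `|J i j| <= M.
Proof. by under eq_bigr do rewrite JC. Qed.
Let Dcol j : \sum_i `|D i j| <= 2 * M.
Proof. by under eq_bigr do rewrite DC. Qed.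

Lemma rowsq_ge0 j : 0 <= rowsq j.
Proof. by apply: sumr_ge0 => i _; exact: sqr_ge0. Qed.
Lemma sq_frobenius_ge0 : 0 <= sq_frobenius.
Proof. by apply: sumr_ge0 => i _; exact: rowsq_ge0. Qed.
Lemma sqfield_ge0 x : 0 <= sqfield x.
Proof. by apply: sumr_ge0 => i _; exact: sqr_ge0. Qed.
Lemma sqscore_ge0 x : 0 <= sqscore x.
Proof. by apply: sumr_ge0 => i _; exact: sqr_ge0. Qed.

Lemma norm_entry (A : 'M[R]_n) c i j : \sum_k `|A i k| <= c -> `|A i j| <= c.
Proof.
by apply: le_trans; rewrite (bigD1 j) //= lerDl; apply: sumr_ge0.
Qed.

Lemma row_dot_le (z : 'I_n -> R) (A : 'M[R]_n) c t i : 0 <= t ->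
  \sum_k `|A i k| <= c -> (forall k, `|z k| <= t) -> `|\sum_k A i k * z k| <= c * t.
Proof.
move=> t0 hA hz; apply: le_trans (ler_norm_sum _ _ _) _.
apply: (@le_trans _ _ (\sum_k `|A i k| * t)).
  by apply: ler_sum => k _; rewrite normrM ler_wpM2l.
by rewrite -mulr_suml ler_wpM2r.
Qed.

Lemma rowsq_le j : rowsq j <= 4 * M ^+ 2.
Proof.
apply: (@le_trans _ _ (\sum_i 2 * M * `|D j i|)).
  apply: ler_sum => i _; rewrite -real_normK ?num_real // expr2.
  by rewrite ler_wpM2r // norm_entry.
rewrite -mulr_sumr; have := Drow j; snra.
Qed.

Lemma field_le x i : `|b x i| <= 2 * M.
Proof. exact: norm_field. Qed.

Lemma dscore_le x i : `|dscore x i| <= 2 * M * E.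
Proof. by apply: row_dot_le => // k; exact: norm_score. Qed.

Lemma dfield2_le x i : `|dfield2 x i| <= 4 * M ^+ 2.
Proof.
have -> : 4 * M ^+ 2 = 2 * M * (2 * M) by ring.
by apply: row_dot_le; [slra|exact: Drow|move=> k; exact: field_le].
Qed.

Lemma sum_dfield2 x : \sum_j dfield2 x j ^+ 2 <= 4 * M ^+ 2 * sqfield x.
Proof.
have -> : 4 * M ^+ 2 = (2 * M) ^+ 2 by ring.
by apply: schur_test_sum => //; slra.
Qed.

Lemma sum_dscore2 x : \sum_j dscore2 x j ^+ 2 <= 4 * M ^+ 2 * sqscore x.
Proof.
have -> : 4 * M ^+ 2 = (2 * M) ^+ 2 by ring.
by apply: schur_test_sum => //; slra.
Qed.

(** The term at [j] itself gives [|b_j|]; a change of [b_i] gives [D y] by symmetry of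
[D]; a change of the other scores gives the two sums weighted by [J]. *)
Lemma corr_flip j x :
  `|corr x - corr (flip j x)| <=
  2 * E * `|b x j| + 2 * `|dscore x j| +
  2 * E * (\sum_i `|J j i| * `|b x i|) + 4 * E * (\sum_i `|J j i| * `|D j i|).
Proof.
have E0 : 0 < E := expR_gt0 _.
have -> : corr x - corr (flip j x) =
   \sum_i (y x i - y (flip j x) i) * b (flip j x) i + 2 * spin_at R x j * dscore x j.
  rewrite /dscore mulr_sumr -big_split -sumrB; apply: eq_bigr => i _ /=.
  by rewrite field_flip (DC j i); ring.
apply: le_trans (ler_normD _ _) _.
have -> : `|2 * spin_at R x j * dscore x j| = 2 * `|dscore x j|.
  by rewrite !normrM norm_spin_at mulr1 ger0_norm.
suff : `|\sum_i (y x i - y (flip j x) i) * b (flip j x) i| <=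
  2 * E * `|b x j| +
  2 * E * (\sum_i `|J j i| * `|b x i|) + 4 * E * (\sum_i `|J j i| * `|D j i|) by slra.
apply: le_trans (ler_norm_sum _ _ _) _.
have -> : 2 * E * `|b x j| + 2 * E * (\sum_i `|J j i| * `|b x i|) +
   4 * E * (\sum_i `|J j i| * `|D j i|) =
   \sum_i 2 * E * ((i == j)%:R + `|J j i|) * (`|b x i| + 2 * `|D j i|).
  transitivity (\sum_i (2 * E * ((i == j)%:R * `|b x i|) + 2 * E * (`|J j i| * `|b x i|) +
      4 * E * (`|J j i| * `|D j i|))).
    rewrite 2!big_split /= -!mulr_sumr; congr (2 * E * _ + _ + _).
    by rewrite (bigD1 j) //= eqxx mul1r big1 ?addr0 // => i /negbTE ->; rewrite mul0r.
  apply: eq_bigr => i _; case: eqVneq => [->|_] /=; rewrite ?Ddiag ?normr0; ring.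
apply: ler_sum => i _; rewrite normrM.
apply: ler_pM => //.
  by rewrite (JC j i); exact: score_diff.
rewrite field_flip (DC i j); apply: le_trans (ler_normB _ _) _.
by rewrite !normrM norm_spin_at mulr1 ger0_norm.
Qed.

Lemma sqfield_flip j x :
  `|sqfield x - sqfield (flip j x)| <= 4 * `|dfield2 x j| + 4 * rowsq j.
Proof.
have -> : sqfield x - sqfield (flip j x) = 4 * spin_at R x j * dfield2 x j - 4 * rowsq j.
  rewrite /dfield2 /rowsq !mulr_sumr -!sumrB; apply: eq_bigr => i _.
  rewrite field_flip (DC j i).
  have -> : D i j ^+ 2 = spin_at R x j * spin_at R x j * D i j ^+ 2 by rewrite spin_at_sqr mul1r.
  ring.
apply: le_trans (ler_normB _ _) _.
rewrite !normrM norm_spin_at mulr1 (ger0_norm (rowsq_ge0 _)).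
by rewrite ger0_norm.
Qed.

(** The matrix [D^2]; [gramvar] bounds what a flip can change in [D^2 y]. *)
Definition gram j k : R := \sum_i D j i * D i k.
Definition gramvar j : R := \sum_k `|gram j k| * (2 * E * ((k == j)%:R + `|J k j|)).

Lemma dscore2E x j : dscore2 x j = \sum_k gram j k * y x k.
Proof.
rewrite /dscore2 /gram; under eq_bigr do rewrite mulr_sumr.
rewrite exchange_big; apply: eq_bigr => k _ /=; rewrite mulr_suml.
by apply: eq_bigr => i _; rewrite mulrA.
Qed.

Lemma dscore2_diff j x : `|dscore2 x j - dscore2 (flip j x) j| <= gramvar j.
Proof.
rewrite !dscore2E -sumrB; apply: le_trans (ler_norm_sum _ _ _) _.
apply: ler_sum => k _; rewrite -mulrBr normrM ler_wpM2l //.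
exact: score_diff.
Qed.

Lemma gram_le j k : `|gram j k| <= (rowsq j + rowsq k) / 2.
Proof.
apply: le_trans (ler_norm_sum _ _ _) _.
rewrite -big_split mulr_suml; apply: ler_sum => i _ /=.
rewrite normrM (DC i k) -(real_normK (num_real (D j i))) -(real_normK (num_real (D k i))).
have := sqr_ge0 (`|D j i| - `|D k i|); rewrite sqrrB; slra.
Qed.

Lemma sum_gramvar : \sum_j gramvar j <= 2 * E * (1 + M) * sq_frobenius.
Proof.
have E0 : 0 < E := expR_gt0 _.
apply: (@le_trans _ _ (\sum_j \sum_k 2 * E *
   ((k == j)%:R * rowsq j + (rowsq j * `|J k j| + rowsq k * `|J k j|) / 2))).
  apply: ler_sum => j _; apply: ler_sum => k _.
  rewrite (_ : `|_| * _ = 2 * E * (`|gram j k| * ((k == j)%:R + `|J k j|))); last by ring.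
  apply: ler_wpM2l; first slra.
  have := gram_le j k.
  case: eqVneq => [->|_] /=.
    by rewrite Jdiag normr0; have := normr_ge0 (gram j j); slra.
  by have := normr_ge0 (J k j); snra.
under eq_bigr do rewrite -mulr_sumr.
rewrite -mulr_sumr -[X in _ <= X]mulrA; apply: ler_wpM2l; first slra.
under eq_bigr do rewrite big_split /=.
rewrite big_split /= mulrDl mul1r; apply: lerD.
  apply: ler_sum => j _; rewrite (bigD1 j) //= eqxx mul1r big1 ?addr0 // => k /negbTE ->.
  by rewrite mul0r.
under eq_bigr do rewrite -mulr_suml big_split /=.
rewrite -mulr_suml big_split /= ler_pdivrMr //.
have h1 : \sum_j \sum_k rowsq j * `|J k j| <= M * sq_frobenius.
  rewrite mulr_sumr; apply: ler_sum => j _.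
  by rewrite -mulr_sumr mulrC ler_wpM2r ?rowsq_ge0.
have h2 : \sum_j \sum_k rowsq k * `|J k j| <= M * sq_frobenius.
  rewrite exchange_big mulr_sumr; apply: ler_sum => j _ /=.
  by rewrite -mulr_sumr mulrC ler_wpM2r ?rowsq_ge0.
slra.
Qed.

Section Exponent.
Variables th a : R.
Hypothesis th_ge0 : 0 <= th.
Hypothesis a_ge0 : 0 <= a.
Hypothesis a_le1 : a <= 1.

Definition exponent x : R := th * (corr x - a * sqfield x).
Definition increment j x : R := `|exponent x - exponent (flip j x)|.

Lemma increment_le j x : increment j x <= th *
  (2 * E * `|b x j| + 2 * `|dscore x j| +
  2 * E * (\sum_i `|J j i| * `|b x i|) + 4 * E * (\sum_i `|J j i| * `|D j i|)
  + 4 * `|dfield2 x j| + 4 * rowsq j).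
Proof.
rewrite /increment /exponent -mulrBr normrM (ger0_norm th_ge0); apply: ler_wpM2l => //.
have -> : corr x - a * sqfield x - (corr (flip j x) - a * sqfield (flip j x)) =
  (corr x - corr (flip j x)) - a * (sqfield x - sqfield (flip j x)) by ring.
apply: le_trans (ler_normB _ _) _; rewrite normrM (ger0_norm a_ge0).
have h1 := corr_flip j x.
have h2 := sqfield_flip j x.
have h3 := ler_piMl (normr_ge0 (sqfield x - sqfield (flip j x))) a_le1.
slra.
Qed.

Lemma increment_le1 j x : 52 * th * E ^+ 3 <= 1 -> increment j x <= 1.
Proof.
apply: le_trans; apply: le_trans (increment_le j x) _.
rewrite (_ : 52 * th * E ^+ 3 = th * (52 * E ^+ 3)); last by ring.
apply: ler_wpM2l => //.
have h1 := field_le x j.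
have h2 := dscore_le x j.
have h3 : \sum_i `|J j i| * `|b x i| <= M * (2 * M).
  apply: (@le_trans _ _ (\sum_i `|J j i| * (2 * M))).
    by apply: ler_sum => i _; rewrite ler_wpM2l // field_le.
  by rewrite -mulr_suml ler_wpM2r //; slra.
have h4 : \sum_i `|J j i| * `|D j i| <= M * (2 * M).
  apply: (@le_trans _ _ (\sum_i `|J j i| * (2 * M))).
    by apply: ler_sum => i _; rewrite ler_wpM2l // norm_entry.
  by rewrite -mulr_suml ler_wpM2r //; slra.
have h5 := dfield2_le x j.
have h6 := rowsq_le j.
have m1 : M * E <= E ^+ 3 by rewrite !exprS expr0; snra.
have m2 : M ^+ 2 * E <= E ^+ 3 by rewrite (exprSr E 2) ler_wpM2r ?expR_ge0 // ler_sqr ?nnegrE //; slra.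
have m3 : M ^+ 2 <= M ^+ 2 * E by have := sqr_ge0 M; snra.
have m4 : E * (\sum_i `|J j i| * `|b x i|) <= E * (M * (2 * M)) by apply: ler_wpM2l h3; slra.
have m5 : E * (\sum_i `|J j i| * `|D j i|) <= E * (M * (2 * M)) by apply: ler_wpM2l h4; slra.
have m6 : E * `|b x j| <= E * (2 * M) by apply: ler_wpM2l h1; slra.
rewrite !expr2 in m2 m3 h5 h6 *; slra.
Qed.

Lemma sum_sqr6 (z1 z2 z3 z4 z5 z6 : R) :
  (z1 + z2 + z3 + z4 + z5 + z6) ^+ 2 <=
  6 * (z1 ^+ 2 + z2 ^+ 2 + z3 ^+ 2 + z4 ^+ 2 + z5 ^+ 2 + z6 ^+ 2).
Proof.
have h (u v : R) : 2 * u * v <= u ^+ 2 + v ^+ 2.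
  by have := sqr_ge0 (u - v); rewrite sqrrB; slra.
have := h z1 z2; have := h z1 z3; have := h z1 z4; have := h z1 z5; have := h z1 z6.
have := h z2 z3; have := h z2 z4; have := h z2 z5; have := h z2 z6.
have := h z3 z4; have := h z3 z5; have := h z3 z6.
have := h z4 z5; have := h z4 z6; have := h z5 z6.
rewrite !expr2; slra.
Qed.

(** Six terms, each of which is bounded by a Schur test or by [rowsq_le].  The point is
that the sum over all sites is bounded by the energy, without a factor [n]. *)
Lemma sum_increment x : \sum_j increment j x ^+ 2 <=
  th ^+ 2 * (480 * E ^+ 4) * (sqfield x + sqscore x + sq_frobenius).
Proof.
have E0 : 0 < E := expR_gt0 _.
apply: (@le_trans _ _ (th ^+ 2 * (6 * \sum_j
  ((2 * E * `|b x j|) ^+ 2 + (2 * `|dscore x j|) ^+ 2 +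
  (2 * E * (\sum_i `|J j i| * `|b x i|)) ^+ 2 + (4 * E * (\sum_i `|J j i| * `|D j i|)) ^+ 2
  + (4 * `|dfield2 x j|) ^+ 2 + (4 * rowsq j) ^+ 2)))).
  rewrite !mulr_sumr; apply: ler_sum => j _.
  apply: (@le_trans _ _ ((th *
    (2 * E * `|b x j| + 2 * `|dscore x j| +
     2 * E * (\sum_i `|J j i| * `|b x i|) + 4 * E * (\sum_i `|J j i| * `|D j i|)
     + 4 * `|dfield2 x j| + 4 * rowsq j)) ^+ 2)).
    rewrite ler_sqr ?nnegrE ?normr_ge0 ?increment_le //.
    exact: le_trans (normr_ge0 _) (increment_le j x).
  by rewrite exprMn; apply: ler_wpM2l; rewrite ?sqr_ge0 ?sum_sqr6.
rewrite -mulrA; apply: ler_wpM2l; first exact: sqr_ge0.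
rewrite !big_split /=.
have e1 : \sum_j (2 * E * `|b x j|) ^+ 2 = 4 * E ^+ 2 * sqfield x.
  rewrite mulr_sumr; apply: eq_bigr => j _.
  by rewrite -(real_normK (num_real (b x j))); ring.
have e2 : \sum_j (2 * `|dscore x j|) ^+ 2 = 4 * sqscore x.
  rewrite mulr_sumr; apply: eq_bigr => j _.
  by rewrite -(real_normK (num_real (dscore x j))); ring.
have e3 : \sum_j (2 * E * (\sum_i `|J j i| * `|b x i|)) ^+ 2 <= 4 * E ^+ 2 * (M ^+ 2 * sqfield x).
  rewrite (eq_bigr (fun j => 4 * E ^+ 2 * (\sum_i `|J j i| * `|b x i|) ^+ 2)); last first.
    by move=> j _; ring.
  rewrite -mulr_sumr; apply: ler_wpM2l; last exact: schur_test.
  by rewrite mulr_ge0 ?sqr_ge0.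
have e4 : \sum_j (4 * E * (\sum_i `|J j i| * `|D j i|)) ^+ 2 <= 16 * E ^+ 2 * (M ^+ 2 * sq_frobenius).
  rewrite /sq_frobenius !mulr_sumr; apply: ler_sum => j _.
  rewrite (_ : (4 * E * _) ^+ 2 = 16 * E ^+ 2 * (\sum_i `|J j i| * `|D j i|) ^+ 2); last by ring.
  apply: ler_wpM2l; first by rewrite mulr_ge0 ?sqr_ge0.
  apply: le_trans (weighted_sq _ _) _ => //.
  rewrite expr2 -mulrA; apply: ler_pM => //.
  - exact: sumr_ge0.
  - by apply: sumr_ge0 => i _; rewrite mulr_ge0 // sqr_ge0.
  - rewrite mulr_sumr; apply: ler_sum => i _; rewrite real_normK ?num_real //.
    by rewrite ler_wpM2r ?sqr_ge0 // norm_entry.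
have e5 : \sum_j (4 * `|dfield2 x j|) ^+ 2 <= 16 * (4 * M ^+ 2 * sqfield x).
  rewrite (eq_bigr (fun j => 16 * dfield2 x j ^+ 2)); last first.
    by move=> j _; rewrite -(real_normK (num_real (dfield2 x j))); ring.
  by rewrite -mulr_sumr; apply: ler_wpM2l => //; exact: sum_dfield2.
have e6 : \sum_j (4 * rowsq j) ^+ 2 <= 16 * (4 * M ^+ 2 * sq_frobenius).
  rewrite /sq_frobenius !mulr_sumr; apply: ler_sum => j _.
  have := ler_wpM2r (rowsq_ge0 j) (rowsq_le j).
  rewrite !expr2; lra.
have nb := sqfield_ge0 x; have nd := sqscore_ge0 x; have nf := sq_frobenius_ge0.
have EE : 1 <= E ^+ 2 by rewrite expr2; snra.
have MM : M ^+ 2 <= E ^+ 2 by rewrite ler_sqr ?nnegrE //; slra.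
have -> : E ^+ 4 = E ^+ 2 * E ^+ 2 by rewrite -exprD.
rewrite e1 e2.
have M0 := sqr_ge0 M.
move: EE MM M0 e3 e4 e5 e6; set e := E ^+ 2; set m := M ^+ 2 => EE MM M0 e3 e4 e5 e6.
have t1 (z : R) : 0 <= z -> e * z <= e * e * z by move=> z0; rewrite -mulrA ler_peMl // mulr_ge0 //; slra.
have t2 (z : R) : 0 <= z -> e * (m * z) <= e * e * z.
  by move=> z0; rewrite -mulrA ler_wpM2l ?ler_wpM2r //; slra.
have t3 (z : R) : 0 <= z -> m * z <= e * e * z.
  by move=> z0; apply: le_trans (t1 z z0); rewrite ler_wpM2r.
have t4 (z : R) : 0 <= z -> z <= e * e * z.
  by move=> z0; apply: le_trans (t1 z z0); rewrite ler_peMl.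
have := t1 _ nb; have := t2 _ nb; have := t3 _ nb; have := t4 _ nb.
have := t1 _ nd; have := t2 _ nd; have := t3 _ nd; have := t4 _ nd.
have := t1 _ nf; have := t2 _ nf; have := t3 _ nf; have := t4 _ nf.
slra.
Qed.

(** * Means under the tilted law *)

Hypothesis th_gt0 : 0 < th.
Hypothesis th_small : th * E ^+ 16 <= (1000 * 1000)^-1.

Local Notation mean := (tilt J exponent).

(** The yardstick: all error terms are [th * energy] up to powers of [E]. *)
Definition energy x : R := sqfield x + sqscore x + sq_frobenius.

Lemma energy_ge0 x : 0 <= energy x.
Proof. by rewrite /energy !addr_ge0 ?sqfield_ge0 ?sqscore_ge0 ?sq_frobenius_ge0. Qed.

(** The weight [th] in [2uv <= u^2/th + th v^2] balances the two squares, because an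
increment is of order [th]. *)
Lemma young_increment x (z : 'I_n -> R) :
  \sum_j increment j x * `|z j| <= th / 2 * (480 * E ^+ 4 * energy x + \sum_j z j ^+ 2).
Proof.
have h := sum_increment x; rewrite -/(energy x) in h.
apply: (@le_trans _ _ (\sum_j (increment j x ^+ 2 / th + th * z j ^+ 2) / 2)).
  apply: ler_sum => j _; rewrite -(real_normK (num_real (z j))).
  rewrite ler_pdivlMr // -subr_ge0.
  have -> : increment j x ^+ 2 / th + th * `|z j| ^+ 2 - increment j x * `|z j| * 2 =
    (increment j x - th * `|z j|) ^+ 2 / th by field; rewrite gt_eqF.
  by rewrite divr_ge0 ?sqr_ge0.
rewrite -mulr_suml big_split /= -mulr_suml -mulr_sumr.
have : (\sum_j increment j x ^+ 2) / th <= th * (480 * E ^+ 4) * energy x.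
  by rewrite ler_pdivrMr //; apply: le_trans h _; rewrite le_eqVlt; apply/orP; left; apply/eqP; ring.
slra.
Qed.

Lemma mean_score (h : 'I_n -> config n -> R) :
  `|mean (fun x => \sum_j y x j * h j x) -
    mean (fun x => \sum_j y x j * (h j x - h j (flip j x))) / 2| <=
  E * mean (fun x => \sum_j increment j x * (`|h j x| + `|h j x - h j (flip j x)|)).
Proof.
rewrite !tilt_sum mulr_suml -sumrB mulr_sumr.
apply: le_trans (ler_norm_sum _ _ _) _; apply: ler_sum => j _.
by rewrite [_ / 2]mulrC; apply: stein_tilt.
Qed.

(** [b_j] does not depend on the spin at [j], so the main term of the flip identity
vanishes and only the error of order [th] is left. *)
Lemma mean_corr : mean corr <= 480 * th * E ^+ 5 * mean energy.
Proof.
have := mean_score (fun j x => b x j).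
have -> : mean (fun x => \sum_j y x j * (b x j - b (flip j x) j)) = 0.
  rewrite /tilt big1 // => x _; rewrite big1 ?mulr0 // => j _.
  by rewrite field_flip Ddiag; ring.
rewrite mul0r subr0 => h; apply: le_trans (ler_norm _) (le_trans h _).
rewrite (_ : 480 * th * E ^+ 5 * _ = E * (480 * th * E ^+ 4 * mean energy)); last by ring.
apply: ler_wpM2l; rewrite ?expR_ge0 // -tiltZ; apply: tilt_le => x.
rewrite (eq_bigr (fun j => increment j x * `|b x j|)); last first.
  by move=> j _; rewrite field_flip Ddiag mulr0 mul0r subr0 subrr normr0 addr0.
apply: le_trans (young_increment _ _) _; rewrite -/(sqfield x).
have e0 := energy_ge0 x.
have : sqfield x <= E ^+ 4 * energy x.
  apply: (@le_trans _ _ (energy x)).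
    by rewrite /energy -addrA lerDl addr_ge0 ?sqscore_ge0 ?sq_frobenius_ge0.
  by rewrite ler_peMl // exprn_ege1.
have := ltW th_gt0; set z := sqfield x; set w := E ^+ 4 * energy x => t0 zw.
have := ler_wpM2l t0 zw; have : 0 <= w by rewrite mulr_ge0 ?exprn_ge0 ?expR_ge0.
by move=> w0; have := mulr_ge0 t0 w0; rewrite /w; slra.
Qed.

Let MM : M ^+ 2 <= E ^+ 4.
Proof.
have ? := ME; have ? := M_ge0; have h : M ^+ 2 <= E ^+ 2 by rewrite ler_sqr ?nnegrE //; slra.
by apply: le_trans h _; rewrite ler_weXn2l.
Qed.

(** [|D y|^2 = <y, D^2 y>]; flipping [j] changes [(D^2 y)_j] by [gramvar j] at most, and
these sum to a multiple of [|D|_F^2]: the scores are nearly uncorrelated. *)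
Lemma mean_sqscore : mean sqscore <=
  6 * E ^+ 3 * (sq_frobenius * mean (fun=> 1)) + 242 * th * E ^+ 5 * mean energy.
Proof.
have E0 : 0 < E := expR_gt0 _.
have := mean_score (fun j x => dscore2 x j).
have -> : mean (fun x => \sum_j y x j * dscore2 x j) = mean sqscore.
  apply: eq_bigr => x _; congr (_ * _); rewrite /sqscore /dscore2.
  under eq_bigr do rewrite mulr_sumr.
  rewrite exchange_big; apply: eq_bigr => i _ /=.
  rewrite expr2 [X in _ = _ * X]/dscore mulr_sumr; apply: eq_bigr => j _.
  by rewrite (DC j i); ring.
rewrite ler_distl => /andP[_ h]; apply: le_trans h _.
have h1 : mean (fun x => \sum_j y x j * (dscore2 x j - dscore2 (flip j x) j)) <=
   E * (\sum_j gramvar j) * mean (fun=> 1).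
  rewrite -tiltZ; apply: tilt_le => x; rewrite mulr1 mulr_sumr; apply: ler_sum => j _.
  apply: le_trans (ler_norm _) _; rewrite normrM.
  by apply: ler_pM => //; [exact: norm_score|exact: dscore2_diff].
have h2 : mean (fun x => \sum_j increment j x *
     (`|dscore2 x j| + `|dscore2 x j - dscore2 (flip j x) j|)) <=
   (\sum_j gramvar j) * mean (fun=> 1) + 242 * th * E ^+ 4 * mean energy.
  rewrite -!tiltZ -tiltD; apply: tilt_le => x; rewrite mulr1.
  under eq_bigr do rewrite mulrDr.
  rewrite big_split /= addrC; apply: lerD.
    apply: ler_sum => j _; rewrite -[X in _ <= X]mul1r; apply: ler_pM => //.
    - exact: normr_ge0.
    - apply: increment_le1; rewrite -mulrA.
      have : th * E ^+ 3 <= th * E ^+ 16 by rewrite ler_wpM2l // ler_weXn2l.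
      have := th_small; slra.
    - exact: dscore2_diff.
  apply: le_trans (young_increment _ _) _.
  have hs := sum_dscore2 x.
  have e0 := energy_ge0 x.
  have : M ^+ 2 * sqscore x <= E ^+ 4 * energy x.
    apply: ler_pM => //; rewrite ?sqr_ge0 ?sqscore_ge0 //.
    by rewrite /energy addrAC lerDr addr_ge0 ?sqfield_ge0 ?sq_frobenius_ge0.
  set w := E ^+ 4 * energy x => hw.
  have h3 : 480 * w + \sum_j dscore2 x j ^+ 2 <= 484 * w by slra.
  have := ler_wpM2l (ltW th_gt0) h3; rewrite /w; slra.
have hg := sum_gramvar.
have m1 := tilt1_gt0 J exponent.
have hg' : (\sum_j gramvar j) * mean (fun=> 1) <= 4 * E ^+ 2 * (sq_frobenius * mean (fun=> 1)).
  rewrite mulrA; apply: ler_wpM2r; first exact: ltW.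
  apply: le_trans hg _; apply: ler_wpM2r; first exact: sq_frobenius_ge0.
  by rewrite expr2; have ? := ME; have ? := E_ge1; snra.
have h1' : mean (fun x => \sum_j y x j * (dscore2 x j - dscore2 (flip j x) j)) <=
   4 * E ^+ 3 * (sq_frobenius * mean (fun=> 1)).
  apply: le_trans h1 _; rewrite -mulrA.
  rewrite (_ : 4 * E ^+ 3 * _ = E * (4 * E ^+ 2 * (sq_frobenius * mean (fun=> 1)))); last by ring.
  by apply: ler_wpM2l hg'; slra.
have h2' := ler_wpM2l (ltW E0) h2.
have := ler_wpM2l (ltW E0) hg'.
rewrite (_ : E ^+ 5 = E * E ^+ 4); last by rewrite -exprS.
move: h1'; rewrite (_ : E ^+ 3 = E * E ^+ 2); last by rewrite -exprS.
slra.
Qed.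

(** [<b, D y> = <y, D b>], and flipping [j] changes [(D b)_j] by exactly
[2 x_j (D^2)_jj].  This is the anti-concentration of the local fields. *)
Lemma mean_dot : E^-1 * (sq_frobenius * mean (fun=> 1)) <=
  mean (fun x => \sum_i b x i * dscore x i) + 490 * th * E ^+ 5 * mean energy.
Proof.
have E0 : 0 < E := expR_gt0 _.
have := mean_score (fun j x => dfield2 x j).
have -> : mean (fun x => \sum_j y x j * dfield2 x j) = mean (fun x => \sum_i b x i * dscore x i).
  apply: eq_bigr => x _; congr (_ * _); rewrite /dfield2.
  under eq_bigr do rewrite mulr_sumr.
  rewrite exchange_big; apply: eq_bigr => i _ /=.
  rewrite /dscore mulr_sumr; apply: eq_bigr => j _.
  by rewrite (DC j i); ring.
have dE j x : dfield2 x j - dfield2 (flip j x) j = 2 * spin_at R x j * rowsq j.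
  rewrite /dfield2 /rowsq mulr_sumr -sumrB; apply: eq_bigr => i _.
  by rewrite field_flip (DC i j); ring.
have h1 : 2 * (E^-1 * (sq_frobenius * mean (fun=> 1))) <=
    mean (fun x => \sum_j y x j * (dfield2 x j - dfield2 (flip j x) j)).
  rewrite mulrA mulrA -tiltZ; apply: tilt_le => x; rewrite mulr1 /sq_frobenius mulr_sumr.
  apply: ler_sum => j _; rewrite dE /score.
  rewrite (_ : _ * (2 * _ * _) = spin_at R x j * spin_at R x j * expR (- (spin_at R x j * local_field J x j)) * (2 * rowsq j)); last by ring.
  rewrite spin_at_sqr mul1r [2 * _]mulrC -mulrA; apply: ler_wpM2r.
    by rewrite mulr_ge0 ?rowsq_ge0.
  exact: score_exp_ge.
have h2 : mean (fun x => \sum_j increment j x *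
     (`|dfield2 x j| + `|dfield2 x j - dfield2 (flip j x) j|)) <=
   490 * th * E ^+ 4 * mean energy.
  rewrite -!tiltZ; apply: tilt_le => x.
  rewrite (eq_bigr (fun j => increment j x * `|dfield2 x j| + increment j x * `|2 * rowsq j|)); last first.
    by move=> j _; rewrite mulrDr dE mulrAC normrM norm_spin_at mulr1.
  rewrite big_split /=.
  have y1 := young_increment x (fun j => dfield2 x j).
  have y2 := young_increment x (fun j => 2 * rowsq j).
  have hs := sum_dfield2 x.
  have e0 := energy_ge0 x.
  have b1 : M ^+ 2 * sqfield x + M ^+ 2 * sq_frobenius <= E ^+ 4 * energy x.
    rewrite -mulrDr; apply: ler_pM => //; rewrite ?sqr_ge0 ?addr_ge0 ?sqfield_ge0 ?sq_frobenius_ge0 //.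
    by rewrite /energy addrAC lerDl ?sqscore_ge0.
  have b2 : \sum_j (2 * rowsq j) ^+ 2 <= 16 * (M ^+ 2 * sq_frobenius).
    rewrite /sq_frobenius !mulr_sumr; apply: ler_sum => j _.
    have := ler_wpM2r (rowsq_ge0 j) (rowsq_le j).
    rewrite !expr2; slra.
  have b3 : 0 <= M ^+ 2 * sq_frobenius by rewrite mulr_ge0 ?sqr_ge0 ?sq_frobenius_ge0.
  have b4 : 0 <= M ^+ 2 * sqfield x by rewrite mulr_ge0 ?sqr_ge0 ?sqfield_ge0.
  move: b1 y1 y2; set w := E ^+ 4 * energy x.
  rewrite -mulrA -/w => b1 y1 y2.
  have h3 : (480 * w + \sum_j dfield2 x j ^+ 2) + (480 * w + \sum_j (2 * rowsq j) ^+ 2)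
     <= 980 * w by slra.
  have := ler_wpM2l (ltW th_gt0) h3; rewrite /w; slra.
rewrite ler_distl => /andP[h _].
have := ler_wpM2l (ltW E0) h2.
rewrite (_ : E ^+ 5 = E * E ^+ 4); last by rewrite -exprS.
slra.
Qed.

(** Young's inequality for [<b, D y>] with the weight [12 E^4] leaves a fraction of
[|D y|^2] that [mean_sqscore] pays from the left-hand side of [mean_dot]; what
remains must come from [|b|^2]. *)
Lemma energy_le : [/\ E ^+ 3 * (sq_frobenius * mean (fun=> 1)) <= 9 * (E ^+ 8 * mean sqfield) &
  mean energy <= 128 * (E ^+ 8 * mean sqfield)].
Proof.
have E0 : 0 < E := expR_gt0 _.
have h1 := mean_sqscore; have h2 := mean_dot.
set N1 := sq_frobenius * _ in h1 h2 *.
set Nd := mean sqscore in h1.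
set Nb := mean sqfield.
set V := mean energy in h1 h2 *.
have VE : V = Nb + Nd + N1.
  rewrite /V /energy !tiltD; congr (_ + _ + _).
  by rewrite /N1 -tiltZ; apply: eq_bigr => x _; rewrite mulr1.
have V0 : 0 <= V by apply: tilt_ge0 => x; exact: energy_ge0.
have Nb0 : 0 <= Nb by apply: tilt_ge0 => x; exact: sqfield_ge0.
have Nd0 : 0 <= Nd by apply: tilt_ge0 => x; exact: sqscore_ge0.
have N10 : 0 <= N1 by rewrite mulr_ge0 ?sq_frobenius_ge0 // ltW // tilt1_gt0.
have h3 : 24 * E ^+ 4 * mean (fun x => \sum_i b x i * dscore x i) <= 144 * E ^+ 8 * Nb + Nd.
  rewrite /Nb /Nd -!tiltZ -tiltD; apply: tilt_le => x.
  rewrite !mulr_sumr -big_split; apply: ler_sum => i _ /=.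
  have := sqr_ge0 (12 * E ^+ 4 * b x i - dscore x i).
  have -> : E ^+ 8 = E ^+ 4 * E ^+ 4 by rewrite -exprD.
  rewrite !expr2; slra.
have k1 : th * E ^+ 9 * V <= (1000 * 1000)^-1 * V.
  apply: ler_wpM2r => //; apply: le_trans th_small.
  by rewrite ler_wpM2l // ler_weXn2l.
have k2 : th * E ^+ 5 * V <= th * E ^+ 9 * V.
  apply: ler_wpM2r => //; apply: ler_wpM2l; first exact: ltW.
  by rewrite ler_weXn2l.
have k3 : N1 <= E ^+ 3 * N1 by rewrite ler_peMl // exprn_ege1.
have k4 : Nb <= E ^+ 8 * Nb by rewrite ler_peMl // exprn_ege1.
have k5 : 24 * (E ^+ 3 * N1) <= 24 * E ^+ 4 * mean (fun x => \sum_i b x i * dscore x i)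
     + 24 * 490 * (th * E ^+ 9 * V).
  have := ler_wpM2l (exprn_ge0 4 (ltW E0)) h2.
  rewrite (_ : E ^+ 4 * (E^-1 * N1) = E ^+ 3 * N1); last first.
    by field; rewrite gt_eqF.
  rewrite (_ : E ^+ 9 = E ^+ 4 * E ^+ 5); last by rewrite -exprD.
  slra.
move: k1 k2 h3 k5 k4 k3 h1.
set n3 := E ^+ 3 * N1; set b8 := E ^+ 8 * Nb; set k9 := th * E ^+ 9 * V.
set k5 := th * E ^+ 5 * V; set bd := mean _.
rewrite -/n3 -/b8 -/k5 => k1 k2 h3 k5' k4 k3 h1.
have h1' : Nd <= 6 * n3 + 242 * k5 by move: h1; rewrite /n3 /k5; slra.
have h3' : 24 * E ^+ 4 * bd <= 144 * b8 + Nd by move: h3; rewrite /b8; slra.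
by split; slra.
Qed.

End Exponent.

Lemma tilted_mean (th : R) : 0 < th -> th * E ^+ 16 <= (1000 * 1000)^-1 ->
  tilt J (exponent th (4 * E ^+ 3)^-1) (fun x => corr x - (4 * E ^+ 3)^-1 * sqfield x) <=
  - ((80 * E ^+ 8)^-1 * sq_frobenius) * tilt J (exponent th (4 * E ^+ 3)^-1) (fun=> 1).
Proof.
move=> th0 ths; set a := (4 * E ^+ 3)^-1.
have E0 : 0 < E := expR_gt0 _.
have a0 : 0 <= a by rewrite invr_ge0 mulr_ge0 ?exprn_ge0 ?expR_ge0.
have a1 : a <= 1.
  rewrite invf_le1; last by rewrite mulr_gt0 ?exprn_gt0.
  by have : 1 <= E ^+ 3 by [rewrite exprn_ege1]; slra.
have [k1 k2] := energy_le (ltW th0) a0 a1 th0 ths.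
have k3 := mean_corr (ltW th0) a0 a1 th0.
set N1 := sq_frobenius * _ in k1.
rewrite (_ : tilt _ _ (fun x => _ - _) = tilt J (exponent th a) corr - a * tilt J (exponent th a) sqfield); last first.
  rewrite -[a * _]opprK -[- (a * _)]mulNr -tiltZ opprK -tiltD.
  by apply: eq_bigr => x _; rewrite mulNr.
rewrite mulNr -mulrA -/N1.
set Nb := tilt _ _ sqfield in k1 k2 *.
have Nb0 : 0 <= Nb by apply: tilt_ge0 => x; exact: sqfield_ge0.
have k4 : tilt J (exponent th a) corr <= a * Nb / 2.
  apply: le_trans k3 _.
  have t5 : 0 <= 480 * th * E ^+ 5.
    apply: mulr_ge0; last exact: exprn_ge0 (ltW E0).
    by apply: mulr_ge0; [exact: ler0n|exact: ltW].
  apply: le_trans (ler_wpM2l t5 k2) _.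
  rewrite (_ : a * Nb / 2 = Nb * (8 * E ^+ 3)^-1); last by rewrite /a; field; rewrite gt_eqF.
  rewrite ler_pdivlMr; last by rewrite mulr_gt0 ?exprn_gt0.
  rewrite (_ : 480 * th * E ^+ 5 * _ * _ = 480 * 128 * 8 * (th * E ^+ 16) * Nb); last by ring.
  rewrite -[X in _ <= X]mul1r; apply: ler_wpM2r; first exact: Nb0.
  move: ths; set u := th * E ^+ 16; slra.
have k5 : (80 * E ^+ 8)^-1 * N1 <= a * Nb / 2.
  rewrite /a (_ : (80 * E ^+ 8)^-1 * N1 = (E ^+ 3 * N1) / (80 * E ^+ 11)); last first.
    by field; rewrite gt_eqF.
  rewrite ler_pdivrMr; last by rewrite mulr_gt0 ?exprn_gt0.
  rewrite (_ : _ * _ / _ * _ = 10 * (E ^+ 8 * Nb)); last first.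
    by field; rewrite gt_eqF.
  have := mulr_ge0 (exprn_ge0 8 (ltW E0)) Nb0.
  slra.
slra.
Qed.

(** Jensen's inequality: the total mass is the tilted mean of [exp(- g)], which is at
least the tilted mass times the exponential of minus the tilted mean of [g]. *)
Lemma exponent_mgf (th : R) : 0 < th -> th * E ^+ 16 <= (1000 * 1000)^-1 ->
  \sum_x ising_weight J x * expR (exponent th (4 * E ^+ 3)^-1 x) <=
  expR (- (th * ((80 * E ^+ 8)^-1 * sq_frobenius))) * \sum_x ising_weight J x.
Proof.
move=> th0 ths; set a := (_)^-1.
have := tilted_mean th0 ths; rewrite -/a /=.
set c := _^-1 * sq_frobenius; set g := exponent th a => hm.
have m1 := tilt1_gt0 J g.
have -> : \sum_x ising_weight J x * expR (g x) = tilt J g (fun=> 1).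
  by apply: eq_bigr => x _; rewrite mulr1.
have -> : \sum_x ising_weight J x = tilt J g (fun x => expR (- g x)).
  by apply: eq_bigr => x _; rewrite -mulrA -expRD subrr expR0 mulr1.
rewrite -tiltZ.
apply: (@le_trans _ _ (tilt J g (fun x => 1 + (- (th * c) - g x)))); last first.
  by apply: tilt_le => x; rewrite -expRD; exact: expR_ge1Dx.
rewrite tiltD lerDl.
have -> : tilt J g (fun x => - (th * c) - g x) =
   - (th * c) * tilt J g (fun=> 1) - th * tilt J g (fun x => corr x - a * sqfield x).
  rewrite -!tiltZ -[- tilt _ _ _]mulN1r -tiltZ -tiltD.
  by apply: eq_bigr => x _; rewrite /g /exponent; ring.
have := ler_wpM2l (ltW th0) hm; slra.
Qed.

End Increments.

(** * The screening loss *)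

Section Screening.
Variables (R : realType) (n : nat).
Implicit Types (A J : 'M[R]_n) (M : R).

Lemma infty_normP M A : 0 <= M ->
  reflect (forall i, \sum_j `|A i j| <= M) (infty_norm A <= M).
Proof.
move=> M0; apply: (iffP idP) => [h i|h].
  by apply: le_trans h; apply: (le_bigmax_cond 0 (fun i => \sum_j `|A i j|)).
by apply: bigmax_le.
Qed.

Definition screening A (x : config n) : R := \sum_i expR (- (spin_at R x i * local_field A x i)).

Definition total_screening l A (X : samples n l) : R := \sum_s screening A (X s).

(** [e^(-z) - 1 + z >= (e^(-z/2) - 1)^2], because [e^(-z/2) >= 1 - z/2]; the square is at
least [z^2/4] times [e^(-|z|)]. *)
Lemma exp_quadratic_lower (M p q : R) : 0 <= M -> `|p| <= M -> `|q| <= M ->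
  expR (- p) - expR (- q) <= expR (- p) * (q - p) - (4 * expR M ^+ 3)^-1 * (q - p) ^+ 2.
Proof.
move=> M0 pM qM; set z := q - p.
have zM : `|z| <= 2 * M by apply: le_trans (ler_normB _ _) _; lra.
have -> : expR (- q) = expR (- p) * expR (- z) by rewrite -expRD; congr expR; rewrite /z; ring.
pose s := expR (- (z / 2)).
have -> : expR (- z) = s ^+ 2 by rewrite expr2 -expRD; congr expR; field.
have h1 : 1 - z / 2 <= s by exact: expR_ge1Dx.
have h2 : expR (- M) * (`|z| / 2) <= `|s - 1|.
  have [z0|z0] := leP 0 z.
    rewrite ger0_norm // distrC ger0_norm; last by rewrite subr_ge0 -expR0 ler_expR; lra.
    have e1 : s * expR (z / 2) = 1 by rewrite -expRD addNr expR0.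
    have e2 : 1 + z / 2 <= expR (z / 2) by exact: expR_ge1Dx.
    have e3 : expR (- M) <= s by rewrite ler_expR; rewrite ger0_norm // in zM; lra.
    have e4 := expR_gt0 (- M); nra.
  rewrite ltr0_norm // ger0_norm; last by rewrite subr_ge0 -expR0 ler_expR; lra.
  have e3 : expR (- M) <= 1 by rewrite -expR0 ler_expR; lra.
  by have e4 := expR_gt0 (- M); nra.
have h3 : expR (- M) ^+ 2 * (z ^+ 2 / 4) <= (s - 1) ^+ 2.
  rewrite -[(s - 1) ^+ 2]real_normK ?num_real //.
  rewrite (_ : _ * _ = (expR (- M) * (`|z| / 2)) ^+ 2); last first.
    by rewrite -[z ^+ 2]real_normK ?num_real //; field.
  by rewrite ler_sqr ?nnegrE // mulr_ge0 ?expR_ge0 // divr_ge0.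
have h4 : expR (- M) <= expR (- p).
  by rewrite ler_expR; move: pM; rewrite ler_norml => /andP[]; lra.
have -> : (4 * expR M ^+ 3)^-1 * z ^+ 2 = expR (- M) * (expR (- M) ^+ 2 * (z ^+ 2 / 4)).
  by rewrite expRN; field; rewrite gt_eqF ?expR_gt0.
have h5 : expR (- M) * (expR (- M) ^+ 2 * (z ^+ 2 / 4)) <= expR (- p) * (s ^+ 2 - 1 + z).
  apply: ler_pM => //; rewrite ?expR_ge0 //.
    by rewrite mulr_ge0 ?sqr_ge0 // divr_ge0 ?sqr_ge0.
  apply: le_trans h3 _; rewrite sqrrB; lra.
lra.
Qed.

Variables (M : R) (J A : 'M[R]_n).
Hypothesis M_ge0 : 0 <= M.
Hypothesis J_class : in_class M J.
Hypothesis A_class : in_class M A.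

Let Jrow i : \sum_j `|J i j| <= M.
Proof. by case: J_class => _ /(infty_normP _ M_ge0). Qed.
Let Arow i : \sum_j `|A i j| <= M.
Proof. by case: A_class => _ /(infty_normP _ M_ge0). Qed.

Lemma field_sub x i : local_field (A - J) x i = local_field A x i - local_field J x i.
Proof. by rewrite -sumrB; apply: eq_bigr => j _; rewrite !mxE mulrBl. Qed.

Lemma screening_excess x : screening J x - screening A x <=
  corr J (A - J) x - (4 * expR M ^+ 3)^-1 * sqfield (A - J) x.
Proof.
rewrite /screening /corr /sqfield mulr_sumr -!sumrB; apply: ler_sum => i _.
have h := @exp_quadratic_lower M (spin_at R x i * local_field J x i) (spin_at R x i * local_field A x i) M_ge0
  (norm_sgfield Jrow x i) (norm_sgfield Arow x i).
apply: le_trans h _; rewrite field_sub /score.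
rewrite -mulrBr exprMn (_ : spin_at R x i ^+ 2 = 1) ?mul1r; last by rewrite expr2 spin_at_sqr.
by rewrite -mulrA [spin_at R x i * (_ * _)]mulrCA [_ - _ <= _](_ : _ = true) // le_eqVlt eqxx.
Qed.

Let E := expR M.
Lemma screening_mgf th : 0 < th -> th * E ^+ 16 <= (1000 * 1000)^-1 ->
  \sum_x ising_pmf J x * expR (th * (screening J x - screening A x)) <=
  expR (- (th * ((80 * E ^+ 8)^-1 * sq_frobenius (A - J)))).
Proof.
move=> th0 ths.
have [[Jsym Jdiag] _] := J_class.
have [[Asym Adiag] _] := A_class.
have Zpos : 0 < \sum_x ising_weight J x.
  rewrite (bigD1 [ffun=> true]) //=; apply: ltr_pwDl; first exact: ising_weight_gt0.
  by apply: sumr_ge0 => x _; exact/ltW/ising_weight_gt0.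
have Dsym : (A - J)^T = A - J by rewrite linearB /= Asym Jsym.
have Ddiag i : (A - J) i i = 0 by rewrite !mxE Adiag Jdiag subrr.
have Drow i : \sum_j `|(A - J) i j| <= 2 * M.
  apply: (@le_trans _ _ (\sum_j (`|A i j| + `|J i j|))).
    by apply: ler_sum => j _; rewrite !mxE ler_normB.
  by rewrite big_split /=; have := Jrow i; have := Arow i; lra.
have h := exponent_mgf Jsym Jdiag Jrow Dsym Ddiag Drow M_ge0 th0 ths.
rewrite -(ler_pM2r Zpos); apply: le_trans h.
rewrite mulr_suml; apply: ler_sum => x _.
rewrite /ising_pmf mulrAC divfK ?gt_eqF //.
apply: ler_wpM2l; first exact/ltW/ising_weight_gt0.
rewrite ler_expR /exponent; apply: ler_wpM2l; first exact: ltW.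
exact: screening_excess.
Qed.

End Screening.

(** * Deviation of the empirical screening loss *)

Section Deviation.
Variables (R : realType) (n l : nat) (M : R) (J : 'M[R]_n).
Hypothesis M_ge0 : 0 <= M.
Hypothesis J_class : in_class M J.
Let E := expR M.

Lemma pmf_ge0 x : 0 <= ising_pmf J x.
Proof.
apply: divr_ge0; first exact/ltW/ising_weight_gt0.
by apply: sumr_ge0 => y _; exact/ltW/ising_weight_gt0.
Qed.

Lemma sum_pmf : \sum_x ising_pmf J x = 1.
Proof.
rewrite -mulr_suml divff // gt_eqF // (bigD1 [ffun=> true]) //=.
apply: ltr_pwDl; first exact: ising_weight_gt0.
by apply: sumr_ge0 => x _; exact/ltW/ising_weight_gt0.
Qed.

Lemma prod_pmf_ge0 (X : samples n l) : 0 <= \prod_(s < l) ising_pmf J (X s).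
Proof. by apply: prodr_ge0 => s _; exact: pmf_ge0. Qed.

Lemma iid_prod (F : config n -> R) :
  \sum_(X : samples n l) \prod_(s < l) (ising_pmf J (X s) * F (X s)) =
  (\sum_x ising_pmf J x * F x) ^+ l.
Proof.
rewrite -[in RHS](card_ord l) -prodr_const.
by rewrite (bigA_distr_bigA (fun=> fun x => ising_pmf J x * F x)).
Qed.

Lemma sum_prod_pmf : \sum_(X : samples n l) \prod_(s < l) ising_pmf J (X s) = 1.
Proof.
have := iid_prod (fun=> 1); under eq_bigr do under eq_bigr do rewrite mulr1.
move=> ->; under eq_bigr do rewrite mulr1.
by rewrite sum_pmf expr1n.
Qed.

Lemma iid_probC (P : pred (samples n l)) : iid_prob J P = 1 - iid_prob J (predC P).
Proof. by rewrite -sum_prod_pmf (bigID P) /= addrK. Qed.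

Lemma iid_prob_le (P Q : pred (samples n l)) :
  {subset P <= Q} -> iid_prob J P <= iid_prob J Q.
Proof.
move=> PQ; rewrite /iid_prob big_mkcond [leRHS]big_mkcond; apply: ler_sum => X _.
have := PQ X; rewrite !unfold_in; case: ifP => [_ ->//|_ _].
by case: ifP => // _; exact: prod_pmf_ge0.
Qed.

(** Chernoff's inequality; the samples are independent, so the moment is a power. *)
Lemma screening_deviation (A : 'M[R]_n) th slack :
  in_class M A -> 0 < th -> th * E ^+ 16 <= (1000 * 1000)^-1 ->
  iid_prob J [pred X : samples n l |
    total_screening A X <= total_screening J X + slack] <=
  expR (th * slack - l%:R * (th * ((80 * E ^+ 8)^-1 * sq_frobenius (A - J)))).
Proof.
move=> A_class th0 ths.
pose F x := expR (th * (screening J x - screening A x)).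
apply: (@le_trans _ _ (\sum_(X : samples n l) expR (th * slack) * \prod_(s < l) (ising_pmf J (X s) * F (X s)))).
  rewrite /iid_prob big_mkcond; apply: ler_sum => X _; rewrite [X in _ <= _ * X]big_split /=.
  have F0 : 0 <= expR (th * slack) * \prod_(s < l) F (X s).
    by rewrite mulr_ge0 ?expR_ge0 // prodr_ge0 // => s _; exact: expR_ge0.
  case: ifP => [h|_]; last by rewrite mulrCA mulr_ge0 // prod_pmf_ge0.
  rewrite mulrCA ler_peMr ?prod_pmf_ge0 //.
  rewrite -expR_sum -expRD -expR0 ler_expR -mulr_sumr -mulrDr.
  apply: mulr_ge0; first exact: ltW.
  by rewrite sumrB; move: h; rewrite /total_screening; lra.
rewrite -mulr_sumr iid_prod expRD; apply: ler_wpM2l; first exact: expR_ge0.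
rewrite -mulrN expRM_natl; apply: lerXn2r.
- rewrite nnegrE; apply: sumr_ge0 => x _; rewrite mulr_ge0 ?expR_ge0 ?pmf_ge0 //.
- by rewrite nnegrE expR_ge0.
- exact: screening_mgf.
Qed.

(** Only the possible outputs that lie in the class and are far from [J] enter the
union bound; an output has a small empirical loss whatever the sample is. *)
Lemma screening_risk (I : finType) (N : I -> 'M[R]_n) (Jhat : samples n l -> 'M[R]_n)
    (th slack delta r : R) :
  0 < th -> th * E ^+ 16 <= (1000 * 1000)^-1 ->
  (forall X, exists i, Jhat X = N i) ->
  (forall X, in_class M (Jhat X)) ->
  (forall X, total_screening (Jhat X) X <= total_screening J X + slack) ->
  #|I|%:R * expR (th * slack - l%:R * (th * ((80 * E ^+ 8)^-1 * r))) <= delta ->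
  1 - delta <= iid_prob J [pred X | frobenius_norm (Jhat X - J) <= Num.sqrt r].
Proof.
move=> th0 ths hN hc hs hd; rewrite iid_probC lerD2l lerN2; apply: le_trans hd.
set B := expR _.
pose bad i : bool := `[< in_class M (N i) >] && (r < sq_frobenius (N i - J)).
pose ev i : pred (samples n l) :=
  [pred X | bad i && (total_screening (N i) X <= total_screening J X + slack)].
apply: (@le_trans _ _ (\sum_i iid_prob J (ev i))).
  rewrite /iid_prob; under [leRHS]eq_bigr do rewrite big_mkcond.
  rewrite exchange_big big_mkcond; apply: ler_sum => X _ /=.
  have ge0 i : 0 <= (if ev i X then \prod_(s < l) ising_pmf J (X s) else 0).
    by case: ifP => // _; exact: prod_pmf_ge0.
  case: ifP => [h|_]; last exact: sumr_ge0.
  have [i Ni] := hN X.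
  have evi : ev i X; last first.
    rewrite (bigD1 i) //= evi lerDl; apply: sumr_ge0 => k _; exact: ge0.
  rewrite /ev /= /bad -Ni hs andbT; apply/andP; split; first by apply/asboolP; exact: hc.
  rewrite ltNge; apply: contra h => h; rewrite /frobenius_norm.
  by apply: ler_wsqrtr.
rewrite -sum1_card natr_sum mulr_suml; apply: ler_sum => i _; rewrite mul1r.
have [/andP[/asboolP ci ri]|nb] := boolP (bad i); last first.
  rewrite /iid_prob big1 ?expR_ge0 // => X.
  by rewrite /ev /= (negbTE nb).
apply: (@le_trans _ _ (iid_prob J [pred X : samples n l |
    total_screening (N i) X <= total_screening J X + slack])).
  by apply: iid_prob_le => X; rewrite !inE => /andP[].
apply: le_trans (screening_deviation _ ci th0 ths) _.
rewrite ler_expR lerD2l lerN2; apply: ler_wpM2l => //.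
apply: ler_wpM2l; first exact: ltW.
apply: ler_wpM2l; last exact: ltW.
by rewrite invr_ge0 mulr_ge0 // exprn_ge0 // expR_ge0.
Qed.

End Deviation.

(** * Compound powers in place of the exponential *)

Section Powers.
Variable R : realType.
Implicit Types (a c U v w M : R) (k N : nat).

Lemma pow_convex k a c : 0 <= a -> 0 <= c ->
  a ^+ k + k%:R * a ^+ k.-1 * (c - a) <= c ^+ k.
Proof.
move=> a0 c0; elim: k => [|k IH]; first by rewrite !expr0 mul0r mul0r addr0.
have := ler_wpM2l c0 IH; rewrite -exprS; apply: le_trans.
case: k {IH} => [|k]; first by rewrite !expr0 expr1; lra.
rewrite /= -subr_ge0.
have -> : c * (a ^+ k.+1 + k.+1%:R * a ^+ k * (c - a)) -
  (a ^+ k.+2 + k.+2%:R * a ^+ k.+1 * (c - a)) = k.+1%:R * a ^+ k * (c - a) ^+ 2.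
  by rewrite !exprS (natrD _ 1 k.+1) (natrD _ 1 k) ; ring.
by apply: mulr_ge0; [apply: mulr_ge0; [exact: ler0n|exact: exprn_ge0]|exact: sqr_ge0].
Qed.

Lemma pow_smooth k a c U : 0 <= a <= U -> 0 <= c <= U -> 1 <= U ->
  c ^+ k <= a ^+ k + k%:R * a ^+ k.-1 * (c - a) + k%:R ^+ 2 * U ^+ k * (c - a) ^+ 2.
Proof.
move=> /andP[a0 aU] /andP[c0 cU] U1.
elim: k => [|k IH]; first by rewrite !expr0 !mul0r expr0n mul0r mul0r !addr0.
rewrite exprS; apply: le_trans (ler_wpM2l c0 IH) _.
case: k {IH} => [|k]; first by rewrite !expr0 !expr1 expr0n /=; have := sqr_ge0 (c - a); nra.
rewrite /= -subr_ge0.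
have -> : a ^+ k.+2 + k.+2%:R * a ^+ k.+1 * (c - a) + k.+2%:R ^+ 2 * U ^+ k.+2 * (c - a) ^+ 2 -
   c * (a ^+ k.+1 + k.+1%:R * a ^+ k * (c - a) + k.+1%:R ^+ 2 * U ^+ k.+1 * (c - a) ^+ 2) =
   (k.+2%:R ^+ 2 * U ^+ k.+2 - c * (k.+1%:R ^+ 2 * U ^+ k.+1) - k.+1%:R * a ^+ k) * (c - a) ^+ 2.
  by rewrite !exprS (natrD _ 1 k.+1) (natrD _ 1 k) ; ring.
apply: mulr_ge0; last exact: sqr_ge0.
have Up : 0 <= U ^+ k.+1 by rewrite exprn_ge0 //; lra.
have h1 : c * U ^+ k.+1 <= U ^+ k.+2 by rewrite [X in _ <= X]exprS; apply: ler_wpM2r.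
have h2 : a ^+ k <= U ^+ k.+2.
  apply: (@le_trans _ _ (U ^+ k)); first by apply: lerXn2r; rewrite ?nnegrE //; lra.
  by rewrite ler_weXn2l // leqW.
have U2 : 0 <= U ^+ k.+2 by rewrite exprn_ge0 //; lra.
have kp : 0 <= k.+1%:R :> R by [].
rewrite (natrD _ 1 k.+1); move: kp h1 h2 U2.
set K := k.+1%:R; set u2 := U ^+ k.+2; set u1 := U ^+ k.+1; set ak := a ^+ k => kp h1 h2 U2.
have := ler_wpM2l (mulr_ge0 kp kp) h1; have := ler_wpM2l kp h2.
by rewrite !expr2; have := mulr_ge0 kp U2; lra.
Qed.

Section Compound.
Variables (N : nat) (M : R).
Hypothesis N_gt0 : (0 < N)%N.
Hypothesis MN : 2 * M <= N%:R.
Hypothesis M_ge0 : 0 <= M.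

(** [cpow] has derivative [- cslope]. *)
Definition cpow v : R := (1 - v / N%:R) ^+ N.
Definition cslope v : R := (1 - v / N%:R) ^+ N.-1.

Let N0 : 0 < N%:R :> R. Proof. by rewrite ltr0n. Qed.

Lemma expR_div v : expR (v / N%:R) ^+ N = expR v.
Proof. by rewrite -expRM_natl mulrC divfK ?gt_eqF. Qed.

Lemma compound_base v : `|v| <= M -> 0 <= 1 - v / N%:R <= 1 + M / N%:R.
Proof.
rewrite ler_norml => /andP[h1 h2]; apply/andP; split.
  by rewrite subr_ge0 ler_pdivrMr //; have := M_ge0; have := MN; lra.
by rewrite lerD2l -mulNr ler_pM2r ?invr_gt0 //; lra.
Qed.

Lemma cpow_le_exp v : `|v| <= M -> cpow v <= expR (- v).
Proof.
move=> vM; have /andP[v0 _] := compound_base vM.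
rewrite -(expR_div (- v)) /cpow; apply: lerXn2r; rewrite ?nnegrE ?expR_ge0 //.
by rewrite mulNr; exact: expR_ge1Dx.
Qed.

(** Each factor satisfies [e^(-x) <= 1 - x + 2 x^2] for [|x| <= 1/2], and [pow_convex]
turns this into a bound for the [N]-th powers. *)
Lemma exp_le_cpow v : `|v| <= M -> expR (- v) <= cpow v + 2 * expR M * M ^+ 2 / N%:R.
Proof.
move=> vM; have /andP[v0 vU] := compound_base vM.
rewrite -(expR_div (- v)) /cpow; set x := v / N%:R.
have e0 := expR_ge0 (- v / N%:R).
have := pow_convex N e0 v0; rewrite -/x mulNr -/x.
set a := expR (- x) => h.
have xh : `|x| <= 1 / 2.
  rewrite normrM normfV (ger0_norm (ltW N0)) ler_pdivrMr //.
  by have := MN; lra.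
have ac : a - (1 - x) <= 2 * x ^+ 2.
  have h1 : (1 + x) * a <= 1.
    rewrite [X in _ <= X](_ : 1 = expR x * a); last by rewrite -expRD subrr expR0.
    by apply: ler_wpM2r; [exact: expR_ge0|exact: expR_ge1Dx].
  move: xh; rewrite ler_norml => /andP[x1 x2].
  have ap : 0 <= a := expR_ge0 _.
  have h2 : (1 + x) * (a - (1 - x)) <= x ^+ 2 by rewrite expr2; lra.
  have s := sqr_ge0 x; have [h3|h3] := leP 0 (a - (1 - x)); nra.
have ap : a ^+ N.-1 <= expR M.
  rewrite -(expR_div M); apply: (@le_trans _ _ (expR (M / N%:R) ^+ N.-1)).
    apply: lerXn2r; rewrite ?nnegrE ?expR_ge0 // ler_expR -mulNr ler_pM2r ?invr_gt0 //.
    by move: vM; rewrite ler_norml => /andP[]; lra.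
  rewrite ler_weXn2l ?leq_pred //; apply: (@le_trans _ _ (expR 0)); first by rewrite expR0.
  rewrite ler_expR.
  by apply: divr_ge0; [exact: M_ge0|exact: (ltW N0)].
have ap0 : 0 <= a ^+ N.-1 := exprn_ge0 _ (expR_ge0 _).
have t1 : N%:R * a ^+ N.-1 * (a - (1 - x)) <= N%:R * expR M * (2 * (M / N%:R) ^+ 2).
  have x2M : x ^+ 2 <= (M / N%:R) ^+ 2.
    rewrite -(real_normK (num_real x)) ler_sqr ?nnegrE ?(divr_ge0 M_ge0 (ltW N0)) //.
    by rewrite normrM normfV (ger0_norm (ltW N0)) ler_pM2r ?invr_gt0.
  apply: (@le_trans _ _ (N%:R * a ^+ N.-1 * (2 * (M / N%:R) ^+ 2))).
    by apply: ler_wpM2l; [exact: mulr_ge0 (ltW N0) ap0|lra].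
  apply: ler_wpM2r; first by apply: mulr_ge0; [exact: ler0n|exact: sqr_ge0].
  by apply: ler_wpM2l => //; exact: ltW.
have e : N%:R * expR M * (2 * (M / N%:R) ^+ 2) = 2 * expR M * M ^+ 2 / N%:R.
  by field; rewrite gt_eqF.
rewrite -e; lra.
Qed.

Lemma cpow_convex v w : `|v| <= M -> `|w| <= M ->
  cpow v - cslope v * (w - v) <= cpow w.
Proof.
move=> vM wM; have /andP[v0 _] := compound_base vM; have /andP[w0 _] := compound_base wM.
have := pow_convex N v0 w0; rewrite -/(cpow w) -/(cpow v) -/(cslope v).
congr (_ <= _); field; rewrite gt_eqF //.
Qed.

Lemma cpow_smooth v w : `|v| <= M -> `|w| <= M ->
  cpow w <= cpow v - cslope v * (w - v) + expR M * (w - v) ^+ 2.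
Proof.
move=> vM wM.
have U1 : 1 <= 1 + M / N%:R by rewrite lerDl (divr_ge0 M_ge0 (ltW N0)).
have h := pow_smooth N (compound_base vM) (compound_base wM) U1.
apply: le_trans h _; rewrite -/(cpow v) -/(cslope v).
have -> : N%:R * cslope v * (1 - w / N%:R - (1 - v / N%:R)) = - (cslope v * (w - v)).
  by field; rewrite gt_eqF.
rewrite lerD2l.
have -> : N%:R ^+ 2 * (1 + M / N%:R) ^+ N * (1 - w / N%:R - (1 - v / N%:R)) ^+ 2 =
   (1 + M / N%:R) ^+ N * (w - v) ^+ 2 by field; rewrite gt_eqF.
apply: ler_wpM2r; first exact: sqr_ge0.
rewrite -(expR_div M); apply: lerXn2r; rewrite ?nnegrE ?expR_ge0 //; last exact: expR_ge1Dx.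
by lra.
Qed.

End Compound.
End Powers.

(** * One step of the Frank-Wolfe method *)

Section FrankWolfe.
Variables (R : realType) (n l N : nat) (M rho : R) (X : samples n l).
Hypothesis N_gt0 : (0 < N)%N.
Hypothesis MN : 2 * M <= N%:R.
Hypothesis M_ge0 : 0 <= M.
Hypothesis rho_ge0 : 0 <= rho.
Implicit Types A V H : 'M[R]_n.

Local Notation E := (expR M).

Definition margin A s i : R := spin_at R (X s) i * local_field A (X s) i.
Definition penalty A : R := rho / 2 * \sum_i \sum_j (A i j - A j i) ^+ 2.
Definition surrogate A : R := \sum_s \sum_i cpow N (margin A s i) + penalty A.
Definition gradient A i j : R :=
  - (\sum_s cslope N (margin A s i) * (spin_at R (X s) i * spin_at R (X s) j)) + 2 * rho * (A i j - A j i).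
Definition pairing (G : 'I_n -> 'I_n -> R) A : R := \sum_i \sum_j G i j * A i j.
(** Columns are not constrained: this is the set over which linear minimisation is a
maximum in each row. *)
Definition rows_le c A := forall i, \sum_j `|A i j| <= c.

Lemma marginD A H s i : margin (A + H) s i = margin A s i + margin H s i.
Proof.
rewrite /margin /local_field -mulrDr -big_split /=; congr (_ * _).
by apply: eq_bigr => j _; rewrite mxE mulrDl.
Qed.

Lemma norm_margin A s i c : rows_le c A -> `|margin A s i| <= c.
Proof. by move=> h; rewrite normrM norm_spin_at mul1r; exact: norm_field. Qed.

Lemma penaltyD A H : penalty (A + H) =
  penalty A + 2 * rho * (\sum_i \sum_j (A i j - A j i) * H i j) + penalty H.
Proof.
have e : \sum_i \sum_j (A i j - A j i) * H j i = - \sum_i \sum_j (A i j - A j i) * H i j.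
  rewrite exchange_big -sumrN /=; apply: eq_bigr => i _; rewrite -sumrN.
  by apply: eq_bigr => j _; ring.
rewrite /penalty.
have -> : \sum_i \sum_j ((A + H) i j - (A + H) j i) ^+ 2 =
  \sum_i \sum_j (A i j - A j i) ^+ 2 + \sum_i \sum_j (H i j - H j i) ^+ 2 +
   2 * (\sum_i \sum_j (A i j - A j i) * H i j) - 2 * (\sum_i \sum_j (A i j - A j i) * H j i).
  rewrite !mulr_sumr -!big_split -sumrB; apply: eq_bigr => i _ /=.
  rewrite !mulr_sumr -!big_split -sumrB; apply: eq_bigr => j _ /=.
  rewrite !mxE; ring.
rewrite e; lra.
Qed.

Lemma pairing_gradient A H : pairing (gradient A) H =
  - (\sum_s \sum_i cslope N (margin A s i) * margin H s i) +
  2 * rho * (\sum_i \sum_j (A i j - A j i) * H i j).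
Proof.
rewrite /pairing /gradient.
under eq_bigr do under eq_bigr do rewrite mulrDl mulNr -mulrA.
under eq_bigr do rewrite big_split /= sumrN -mulr_sumr.
rewrite big_split /= sumrN -mulr_sumr; congr (- _ + _).
rewrite [RHS]exchange_big; apply: eq_bigr => i _ /=.
under eq_bigr do rewrite mulr_suml.
rewrite exchange_big; apply: eq_bigr => s _ /=.
rewrite /margin /local_field !mulr_sumr; apply: eq_bigr => j _; ring.
Qed.

Lemma surrogate_convex A B : rows_le M A -> rows_le M B ->
  surrogate A + pairing (gradient A) (B - A) <= surrogate B.
Proof.
move=> rA rB; pose H := B - A; have BE : B = A + H by rewrite addrC subrK.
rewrite -/H pairing_gradient /surrogate [in penalty B]BE penaltyD.
have pH : 0 <= penalty H.
  rewrite /penalty mulr_ge0 ?divr_ge0 //; apply: sumr_ge0 => i _; apply: sumr_ge0 => j _.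
  exact: sqr_ge0.
suff : \sum_s \sum_i cpow N (margin A s i) - \sum_s \sum_i cslope N (margin A s i) * margin H s i
   <= \sum_s \sum_i cpow N (margin B s i) by lra.
rewrite -sumrB; apply: ler_sum => s _; rewrite -sumrB; apply: ler_sum => i _.
have -> : margin H s i = margin B s i - margin A s i by rewrite BE marginD addrC addKr.
by apply: (cpow_convex N_gt0 MN M_ge0); exact: norm_margin.
Qed.

Lemma surrogate_smooth A B : rows_le M A -> rows_le M B ->
  surrogate B <= surrogate A + pairing (gradient A) (B - A) +
    (E * (\sum_s \sum_i margin (B - A) s i ^+ 2) + penalty (B - A)).
Proof.
move=> rA rB; pose H := B - A; have BE : B = A + H by rewrite addrC subrK.
rewrite -/H pairing_gradient /surrogate [in penalty B]BE penaltyD.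
suff : \sum_s \sum_i cpow N (margin B s i) <=
   \sum_s \sum_i cpow N (margin A s i) - \sum_s \sum_i cslope N (margin A s i) * margin H s i
    + E * (\sum_s \sum_i margin H s i ^+ 2) by lra.
rewrite mulr_sumr -sumrB -big_split; apply: ler_sum => s _ /=.
rewrite mulr_sumr -sumrB -big_split; apply: ler_sum => i _ /=.
have -> : margin H s i = margin B s i - margin A s i by rewrite BE marginD addrC addKr.
by apply: (cpow_smooth N_gt0 MN M_ge0); exact: norm_margin.
Qed.

Lemma rows_le_convex A V c g : 0 <= g <= 1 -> rows_le c A -> rows_le c V ->
  rows_le c (A + g *: (V - A)).
Proof.
move=> /andP[g0 g1] rA rV i.
apply: (@le_trans _ _ (\sum_j ((1 - g) * `|A i j| + g * `|V i j|))).
  apply: ler_sum => j _; rewrite !mxE.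
  rewrite (_ : A i j + g * (V i j - A i j) = (1 - g) * A i j + g * V i j); last by ring.
  apply: le_trans (ler_normD _ _) _; rewrite !normrM (ger0_norm g0) ger0_norm //.
  by rewrite subr_ge0.
rewrite big_split -!mulr_sumr /=.
have := ler_wpM2l g0 (rV i).
have := ler_wpM2l (_ : 0 <= 1 - g) (rA i); rewrite subr_ge0 => /(_ g1); lra.
Qed.

(** The constant of the quadratic upper bound along a segment between two matrices
with bounded rows. *)
Definition curvature : R := 4 * E * M ^+ 2 * (l * n)%:R + 8 * rho * M ^+ 2 * n%:R.

Lemma curvature_bound A V g : rows_le M A -> rows_le M V ->
  E * (\sum_s \sum_i margin (g *: (V - A)) s i ^+ 2) + penalty (g *: (V - A)) <=
  g ^+ 2 * curvature.
Proof.
move=> rA rV; set H := V - A.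
have rH : rows_le (2 * M) H.
  move=> i; apply: (@le_trans _ _ (\sum_j (`|V i j| + `|A i j|))).
    by apply: ler_sum => j _; rewrite !mxE ler_normB.
  by rewrite big_split /=; have := rA i; have := rV i; lra.
have mZ s i : margin (g *: H) s i = g * margin H s i.
  rewrite /margin /local_field mulrCA; congr (_ * _); rewrite mulr_sumr.
  by apply: eq_bigr => j _; rewrite mxE mulrA.
have e1 : \sum_s \sum_i margin (g *: H) s i ^+ 2 <= g ^+ 2 * (4 * M ^+ 2 * (l * n)%:R).
  apply: (@le_trans _ _ (\sum_(s < l) \sum_(i < n) g ^+ 2 * (4 * M ^+ 2))).
    apply: ler_sum => s _; apply: ler_sum => i _; rewrite mZ exprMn.
    apply: ler_wpM2l; first exact: sqr_ge0.
    rewrite (_ : 4 * M ^+ 2 = (2 * M) ^+ 2); last by ring.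
    rewrite -real_normK ?num_real // ler_sqr ?nnegrE ?norm_margin ?mulr_ge0 //.
  by rewrite !sumr_const !card_ord -mulrnA (mulnC n l) -[X in X <= _]mulr_natr -mulrA.
have e2 : penalty (g *: H) <= g ^+ 2 * (8 * rho * M ^+ 2 * n%:R).
  rewrite /penalty.
  have f1 : \sum_i \sum_j H i j ^+ 2 <= 4 * M ^+ 2 * n%:R.
    apply: (@le_trans _ _ (\sum_(i < n) 4 * M ^+ 2)); last first.
      by rewrite sumr_const card_ord mulr_natr.
    apply: ler_sum => i _.
    apply: (@le_trans _ _ (\sum_j 2 * M * `|H i j|)).
      apply: ler_sum => j _; rewrite -real_normK ?num_real // expr2.
      by apply: ler_wpM2r => //; exact: norm_entry (rH i).
    rewrite -mulr_sumr; have := rH i; have := M_ge0; nra.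
  have f2 : \sum_i \sum_j (H i j - H j i) ^+ 2 <= 4 * \sum_i \sum_j H i j ^+ 2.
    apply: (@le_trans _ _ (\sum_i \sum_j (2 * H i j ^+ 2 + 2 * H j i ^+ 2))).
      apply: ler_sum => i _; apply: ler_sum => j _.
      have := sqr_ge0 (H i j + H j i); rewrite !expr2; lra.
    under eq_bigr do rewrite big_split /= -!mulr_sumr.
    rewrite big_split /= -!mulr_sumr [X in 2 * _ + 2 * X]exchange_big /=; lra.
  have -> : \sum_i \sum_j ((g *: H) i j - (g *: H) j i) ^+ 2 =
     g ^+ 2 * \sum_i \sum_j (H i j - H j i) ^+ 2.
    rewrite mulr_sumr; apply: eq_bigr => i _; rewrite mulr_sumr; apply: eq_bigr => j _.
    rewrite [(g *: H) i j]mxE [(g *: H) j i]mxE; ring.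
  rewrite mulrCA; apply: ler_wpM2l; first exact: sqr_ge0.
  have f3 : \sum_i \sum_j (H i j - H j i) ^+ 2 <= 16 * (M ^+ 2 * n%:R) by lra.
  have := ler_wpM2l (divr_ge0 rho_ge0 (ler0n _ 2)) f3; lra.
have := ler_wpM2l (expR_ge0 M) e1.
rewrite /curvature; lra.
Qed.

(** Convexity bounds the decrease that the linear model promises by the distance to
the value at [C]; smoothness bounds the loss of the linear model. *)
Lemma frank_wolfe_step A V C g : 0 <= g <= 1 ->
  rows_le M A -> rows_le M V -> rows_le M C ->
  pairing (gradient A) V <= pairing (gradient A) C ->
  surrogate (A + g *: (V - A)) - surrogate C <=
    (1 - g) * (surrogate A - surrogate C) + g ^+ 2 * curvature.
Proof.
move=> g01 rA rV rC hV; have /andP[g0 g1] := g01.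
have h1 := surrogate_smooth rA (rows_le_convex g01 rA rV).
have h2 := surrogate_convex rA rC.
have h3 := curvature_bound g rA rV.
have eH : A + g *: (V - A) - A = g *: (V - A) by rewrite addrC addKr.
rewrite eH in h1.
have pE : pairing (gradient A) (g *: (V - A)) =
   g * (pairing (gradient A) V - pairing (gradient A) A).
  rewrite /pairing -sumrB mulr_sumr; apply: eq_bigr => i _.
  rewrite -sumrB mulr_sumr; apply: eq_bigr => j _; rewrite !mxE; ring.
have pB : pairing (gradient A) (C - A) = pairing (gradient A) C - pairing (gradient A) A.
  rewrite /pairing -sumrB; apply: eq_bigr => i _.
  rewrite -sumrB; apply: eq_bigr => j _; rewrite !mxE; ring.
rewrite pE in h1; rewrite pB in h2.
have h4 := ler_wpM2l g0 hV; have h5 := ler_wpM2l g0 h2.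
lra.
Qed.

End FrankWolfe.

(** * The Frank-Wolfe run on integer matrices *)

(** [(t+1)(t+2)/2], the common denominator of the [t]-th iterate: the step size
[2/(t+3)] is [(t+2) / fw_weight (t+1)], which makes the iterate an average of the
directions with weights [2, 3, 4, ...] (and the initial [0] with weight [1]). *)
Fixpoint fw_weight (t : nat) : nat := if t is t'.+1 then (fw_weight t' + t'.+2)%N else 1%N.

Lemma fw_weightE t : (fw_weight t * 2 = t.+1 * t.+2)%N.
Proof. by elim: t => //= t IH; lia. Qed.

Lemma fw_weight_gt0 t : (0 < fw_weight t)%N.
Proof. by case: t => //= t; rewrite addnS. Qed.

Definition int_margin (n : nat) (xs : nat -> nat -> int) (B : nat -> nat -> int) (s i : nat) : int :=
  xs s i * \sum_(k < n) xs s k * B i k.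

(** The gradient of the surrogate multiplied by [scale^(N-1)], with [N = 2l], penalty
[l^2] and [m / 2^l] for the norm bound; see [gradient_A]. *)
Definition int_gradient (n l : nat) (xs : nat -> nat -> int) (m scale : int)
    (B : nat -> nat -> int) (i j : nat) : int :=
  - (\sum_(s < l) (scale - m * int_margin n xs B s i) ^+ (2 * l).-1 * (xs s i * xs s j))
  + 2 * l%:Z ^+ 2 * m * (2 * l)%:Z * (B i j - B j i) * scale ^+ (2 * l).-2.

Definition int_scale (l t : nat) : int := (2 * l)%:Z * 2 ^+ l * (fw_weight t)%:Z.

(** [V] minimises the linear form [G] over the matrices with zero diagonal and rows of
norm at most one; its rows are compared with 0 and with the signed unit vectors, the
extreme points. *)
Definition steepest (n : nat) (G V : nat -> nat -> int) :=
  forall i, (i < n)%N -> [/\ V i i = 0, \sum_(j < n) `|V i j| <= 1,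
    \sum_(j < n) G i j * V i j <= 0 &
    forall k, (k < n)%N -> k != i -> \sum_(j < n) G i j * V i j <= - `|G i k|].

Definition fw_run (n l : nat) (xs : nat -> nat -> int) (m : int) (T : nat)
    (B : nat -> nat -> nat -> int) :=
  (forall i j, (i < n)%N -> (j < n)%N -> B 0%N i j = 0) /\
  forall t, (t < T)%N -> exists V,
    steepest n (int_gradient n l xs m (int_scale l t) (B t)) V /\
    forall i j, (i < n)%N -> (j < n)%N -> B t.+1 i j = B t i j + t.+2%:Z * V i j.

Section Trace.
Variables (n l : nat) (xs : nat -> nat -> int) (m : int) (T : nat) (B : nat -> nat -> nat -> int).
Hypothesis run : fw_run n l xs m T B.

Lemma fw_rows t i : (t <= T)%N -> (i < n)%N -> \sum_(j < n) `|B t i j| <= (fw_weight t)%:Z.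
Proof.
have [B0 BS] := run.
elim: t i => [|t IH] i tT hi; first by rewrite big1 // => j _; rewrite B0.
have [V [Vs VB]] := BS t tT.
have [_ V1 _ _] := Vs i hi.
apply: (@le_trans _ _ (\sum_(j < n) (`|B t i j| + t.+2%:Z * `|V i j|))).
  apply: ler_sum => j _; rewrite VB //; apply: le_trans (ler_normD _ _) _.
  by rewrite normrM.
rewrite big_split -mulr_sumr /= PoszD; apply: lerD; first by apply: IH => //; exact: ltnW.
by rewrite -[X in _ <= X]mulr1; apply: ler_wpM2l.
Qed.

Lemma fw_entry t i j : (t <= T)%N -> (i < n)%N -> (j < n)%N -> `|B t i j| <= (fw_weight t)%:Z.
Proof.
move=> tT hi hj; apply: le_trans (fw_rows tT hi).
by rewrite (bigD1 (Ordinal hj)) //= lerDl; exact: sumr_ge0.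
Qed.

Lemma fw_diag t i : (t <= T)%N -> (i < n)%N -> B t i i = 0.
Proof.
have [B0 BS] := run.
elim: t i => [|t IH] i tT hi; first by rewrite B0.
have [V [Vs VB]] := BS t tT.
have [Vi _ _ _] := Vs i hi.
by rewrite VB // IH ?Vi ?mulr0 // ltnW.
Qed.

Lemma fw_run_snoc V B' :
  steepest n (int_gradient n l xs m (int_scale l T) (B T)) V ->
  (forall i j, (i < n)%N -> (j < n)%N -> B' i j = B T i j + T.+2%:Z * V i j) ->
  fw_run n l xs m T.+1 (fun t => if (t <= T)%N then B t else B').
Proof.
have [B0 BS] := run => hV hB'; split=> // t tT1.
have [tT|tT|->] := ltngtP t T; last by exists V; rewrite ?leqnn ?ltnn.
  have [V1 [h1 h2]] := BS t tT; exists V1; split; [exact: h1|exact: h2].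
by move: tT1; rewrite ltnS leqNgt tT.
Qed.

End Trace.

(** When the absolute values agree, the first argument is taken, so the arguments have
to come in the same order for both entries of a pair. *)
Definition min_abs (a b : int) : int := if b ^+ 2 < a ^+ 2 then b else a.

Definition symmetrized (B : nat -> nat -> int) (i j : nat) : int :=
  if (j < i)%N then min_abs (B i j) (B j i)
  else if (i < j)%N then min_abs (B j i) (B i j) else 0.

(** * The loss of the symmetrized output *)

Section Run.
Variables (R : realType) (n l : nat) (M : R) (X : samples n l) (J : 'M[R]_n).
Variables (xs : nat -> nat -> int) (m : int) (B : nat -> nat -> nat -> int).
Hypothesis n_gt0 : (0 < n)%N.
Hypothesis l_gt0 : (0 < l)%N.
Hypothesis M_gt0 : 0 < M.
Hypothesis M_le : M <= l%:R.
Hypothesis J_class : in_class M J.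
Hypothesis xsE : forall (s : 'I_l) (i : 'I_n), xs s i = spin int (X s i).
Let T := (l * l)%N.
Hypothesis run : fw_run n l xs m T B.
Let N := (2 * l)%N.
Let rho : R := l%:R ^+ 2.
Variable Mp : R.
Hypothesis MpE : Mp = m%:~R / 2 ^+ l.
Hypothesis Mp_ge0 : 0 <= Mp.
Hypothesis Mp_le : Mp <= M.
Hypothesis Mp_close : M - Mp <= l%:R^-1.
Local Notation E := (expR M).

Let A t : 'M[R]_n := \matrix_(i, j) (Mp * (B t i j)%:~R / (fw_weight t)%:R).
Let A0 : 'M[R]_n := (Mp / M) *: J.

Let N_gt0 : (0 < N)%N. Proof. by rewrite /N muln_gt0. Qed.
Let MN : 2 * M <= N%:R. Proof. by rewrite /N natrM; have := M_le; lra. Qed.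
Let M_ge0 : 0 <= M. Proof. exact: ltW. Qed.
Let rho_ge0 : 0 <= rho. Proof. exact: sqr_ge0. Qed.
Let w0 t : 0 < (fw_weight t)%:R :> R. Proof. by rewrite ltr0n fw_weight_gt0. Qed.
Let l0 : 0 < l%:R :> R. Proof. by rewrite ltr0n. Qed.
Let E0 : 0 < E. Proof. exact: expR_gt0. Qed.
Let E_ge1 : 1 <= E. Proof. by have := expR_ge1Dx M; have := M_ge0; lra. Qed.
Let ME : M <= E. Proof. by have := expR_ge1Dx M; lra. Qed.

Lemma scaled_rows (C : nat -> nat -> int) t :
  (forall i : 'I_n, \sum_(j < n) `|C i j| <= (fw_weight t)%:Z) ->
  rows_le Mp (\matrix_(i, j) (Mp * (C i j)%:~R / (fw_weight t)%:R) : 'M[R]_n).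
Proof.
move=> h i; have := h i; rewrite -(ler_int R) rmorph_sum /= => hi.
rewrite (eq_bigr (fun j : 'I_n => Mp / (fw_weight t)%:R * `|C i j|%:~R)); last first.
  move=> j _; rewrite mxE !normrM normfV (ger0_norm Mp_ge0) (ger0_norm (ltW (w0 t))).
  by rewrite intr_norm mulrAC.
rewrite -mulr_sumr mulrAC ler_pdivrMr //; apply: ler_wpM2l => //.
Qed.

Lemma A_rows t : (t <= T)%N -> rows_le Mp (A t).
Proof. by move=> tT; apply: scaled_rows => i; exact: (fw_rows run tT (ltn_ord i)). Qed.

Lemma rows_le_M (D : 'M[R]_n) : rows_le Mp D -> rows_le M D.
Proof. by move=> h i; apply: le_trans (h i) Mp_le. Qed.

Let J_rows : rows_le M J.
Proof. by case: J_class => _ /(infty_normP _ M_ge0). Qed.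

Lemma A0_rows : rows_le Mp A0.
Proof.
move=> i; rewrite (eq_bigr (fun j => Mp / M * `|J i j|)); last first.
  by move=> j _; rewrite mxE normrM ger0_norm // divr_ge0.
rewrite -mulr_sumr mulrAC ler_pdivrMr //; apply: ler_wpM2l => //.
Qed.

Lemma margin_A t (s : 'I_l) (i : 'I_n) :
  margin X (A t) s i = Mp / (fw_weight t)%:R * (int_margin n xs (B t) s i)%:~R.
Proof.
have sgE k : spin_at R (X s) k = (xs s k)%:~R by rewrite xsE /spin_at /spin; case: (X s k).
rewrite /margin /int_margin /local_field rmorphM /= -sgE mulrCA; congr (_ * _).
rewrite rmorph_sum mulr_sumr; apply: eq_bigr => k _ /=.
by rewrite mxE rmorphM /= -sgE; ring.
Qed.

Lemma gradient_A t (i j : 'I_n) :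
  (int_gradient n l xs m (int_scale l t) (B t) i j)%:~R =
  (int_scale l t)%:~R ^+ N.-1 * gradient N rho X (A t) i j :> R.
Proof.
have sgE s k : spin_at R (X s) k = (xs s k)%:~R by rewrite xsE /spin_at /spin; case: (X s k).
have p2 : 2 ^+ l != 0 :> R by rewrite expf_neq0.
have wn : (fw_weight t)%:R != 0 :> R by rewrite gt_eqF.
have ln : l%:R != 0 :> R by rewrite gt_eqF.
have [S Sdef] : exists S, S = int_scale l t by exists (int_scale l t).
rewrite -Sdef; set Sr : R := S%:~R.
have SE : Sr = N%:R * 2 ^+ l * (fw_weight t)%:R.
  by rewrite /Sr Sdef /int_scale !rmorphM rmorphXn /=.
have S0 : Sr != 0 by rewrite SE /N natrM !mulf_neq0.
rewrite /int_gradient rmorphD rmorphN /= rmorph_sum /gradient [RHS]mulrDr [X in _ = X + _]mulrN [X in _ = - X + _]mulr_sumr.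
congr (- _ + _).
  apply: eq_bigr => s _; rewrite rmorphM rmorphXn rmorphM /= mulrA -!sgE.
  rewrite mulrA [in RHS]mulrA [in RHS]mulrA; congr (_ * _ * _).
  rewrite /cslope -exprMn -/N; congr (_ ^+ _).
  rewrite margin_A rmorphB rmorphM /= -/Sr mulrBr mulr1; congr (_ - _).
  rewrite MpE SE; field.
  by rewrite p2 wn /N natrM mulf_neq0.
rewrite !rmorphM rmorphB !rmorphXn /= -/Sr !mxE.
have -> : N.-1 = N.-2.+1 by rewrite /N; case: (l) l_gt0 => // k _; rewrite mulnS.
rewrite [in RHS]exprSr -/N /rho.
have -> : Mp = m%:~R * N%:R * (fw_weight t)%:R / Sr.
  by rewrite SE MpE; field; rewrite p2 wn /N natrM mulf_neq0.
field.
by rewrite S0 wn.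
Qed.

(** In each row, no matrix with zero diagonal and norm [Mp] pairs with the gradient to
less than [- Mp] times the largest entry off the diagonal. *)
Lemma steepest_pairing t V : steepest n (int_gradient n l xs m (int_scale l t) (B t)) V ->
  pairing (gradient N rho X (A t)) (\matrix_(i, j) (Mp * (V i j)%:~R)) <=
  pairing (gradient N rho X (A t)) A0.
Proof.
move=> hV; set G := gradient _ _ _ _.
pose S : R := (int_scale l t)%:~R ^+ N.-1.
have S0 : 0 < S.
  by rewrite exprn_gt0 // ltr0z /int_scale !mulr_gt0 ?exprn_gt0 // ltz_nat ?fw_weight_gt0.
apply: ler_sum => i _; rewrite -(ler_pM2l S0) !mulr_sumr.
have [_ _ hV0 hVk] := hV i (ltn_ord i).
set g := int_gradient _ _ _ _ _ _ in hV0 hVk.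
pose q : R := - (\sum_(j < n) g i j * V i j)%:~R.
have -> : \sum_(j < n) S * (G i j * (\matrix_(i, j) (Mp * (V i j)%:~R) : 'M[R]_n) i j) = - (Mp * q).
  rewrite /q mulrN opprK rmorph_sum mulr_sumr; apply: eq_bigr => j _ /=.
  by rewrite mxE rmorphM /= gradient_A -/S -/G; ring.
have q0 : 0 <= q by rewrite oppr_ge0 lerz0.
rewrite lerNl -sumrN.
apply: (@le_trans _ _ (\sum_(j < n) q * `|A0 i j|)).
  apply: ler_sum => j _.
  case: (eqVneq j i) => [->|ji].
    have -> : A0 i i = 0 by case: J_class => [[_ Jd] _]; rewrite mxE Jd mulr0.
    by rewrite !mulr0 normr0 oppr0 mulr0.
  apply: le_trans (ler_norm _) _; rewrite normrN mulrA -gradient_A -/g normrM.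
  apply: ler_wpM2r => //; rewrite /q -intr_norm -rmorphN ler_int lerNr.
  exact: hVk.
by rewrite -mulr_sumr mulrC; apply: ler_wpM2r => //; exact: A0_rows.
Qed.

Let Phi := surrogate N rho X.
Let L := curvature n l M rho.

Lemma surrogate_ge0 (C : 'M[R]_n) : rows_le M C -> 0 <= Phi C.
Proof.
move=> rC; apply: addr_ge0.
  apply: sumr_ge0 => s _; apply: sumr_ge0 => i _; apply: exprn_ge0.
  by have /andP[] := compound_base N_gt0 MN M_ge0 (norm_margin X s i rC).
rewrite /penalty mulr_ge0 ?divr_ge0 //; apply: sumr_ge0 => i _; apply: sumr_ge0 => j _.
exact: sqr_ge0.
Qed.

(** Multiplied by its denominator, the gap grows by at most twice the curvature in a
step, since [fw_weight (t+1) * (2/(t+3))^2 <= 2]. *)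
Lemma surrogate_run t : (t <= T)%N ->
  (fw_weight t)%:R * (Phi (A t) - Phi A0) <= (l * n)%:R + 2 * t%:R * L.
Proof.
have [B0 BS] := run.
have L0 : 0 <= L.
  by rewrite /L /curvature addr_ge0 // !mulr_ge0 ?sqr_ge0 // ltW.
elim: t => [|t IH] tT.
  rewrite mul1r mulr0 mul0r addr0.
  have -> : Phi (A 0%N) = (l * n)%:R.
    have z : A 0%N = 0.
      by apply/matrixP => i j; rewrite !mxE B0 // mulr0 mul0r.
    rewrite z /Phi /surrogate /penalty [X in _ + _ * X]big1 ?mulr0 ?addr0; last first.
      by move=> i _; rewrite big1 // => j _; rewrite !mxE subrr expr0n.
    rewrite (eq_bigr (fun=> n%:R)).
      by rewrite sumr_const card_ord -mulrnA mulnC.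
    move=> s _; rewrite (eq_bigr (fun=> 1)); first by rewrite sumr_const card_ord.
    move=> i _; rewrite /cpow /margin /local_field big1 ?mulr0 ?mul0r ?subr0 ?expr1n //.
    by move=> k _; rewrite mxE mul0r.
  by rewrite gerBl; apply: surrogate_ge0; exact: rows_le_M A0_rows.
have [V [Vs VB]] := BS t tT.
pose Vr : 'M[R]_n := \matrix_(i, j) (Mp * (V i j)%:~R).
pose g : R := t.+2%:R / (fw_weight t.+1)%:R.
have wS : (fw_weight t.+1)%:R = (fw_weight t)%:R + t.+2%:R :> R by rewrite -natrD.
have AS : A t.+1 = A t + g *: (Vr - A t).
  apply/matrixP => i j; rewrite !mxE VB // /g wS rmorphD rmorphM /=.
  by field; rewrite !gt_eqF // -?wS //.
have g01 : 0 <= g <= 1.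
  apply/andP; split; first by apply: divr_ge0; exact: ler0n.
  by rewrite ler_pdivrMr; [rewrite mul1r ler_nat; exact: leq_addl|exact: w0].
have rV : rows_le Mp Vr.
  move=> i; have [_ V1 _ _] := Vs i (ltn_ord i).
  rewrite (eq_bigr (fun j : 'I_n => Mp * `|V i j|%:~R)).
    rewrite -mulr_sumr -[X in _ <= X]mulr1; apply: ler_wpM2l => //.
    by rewrite -rmorph_sum /= (_ : 1 = 1%:~R) // ler_int.
  by move=> j _; rewrite mxE normrM (ger0_norm Mp_ge0) intr_norm.
have := frank_wolfe_step N_gt0 MN M_ge0 rho_ge0 g01 (rows_le_M (A_rows (ltnW tT)))
  (rows_le_M rV) (rows_le_M A0_rows) (steepest_pairing Vs).
rewrite -AS -/Phi -/L => h.
have := ler_wpM2l (ltW (w0 t.+1)) h.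
have -> : (fw_weight t.+1)%:R * ((1 - g) * (Phi (A t) - Phi A0) + g ^+ 2 * L) =
  (fw_weight t)%:R * (Phi (A t) - Phi A0) + (fw_weight t.+1)%:R * g ^+ 2 * L.
  have -> : (fw_weight t)%:R = (fw_weight t.+1)%:R * (1 - g) :> R.
    rewrite mulrBr mulr1 /g mulrCA divff ?mulr1; last by rewrite gt_eqF ?w0.
    by rewrite wS addrK.
  by ring.
have h2 : (fw_weight t.+1)%:R * g ^+ 2 <= 2.
  have -> : (fw_weight t.+1)%:R * g ^+ 2 = t.+2%:R ^+ 2 / (fw_weight t.+1)%:R.
    rewrite /g; move: (w0 t.+1) (t.+2%:R : R); set W := (fw_weight _)%:R => W0 u.
    by field; rewrite gt_eqF.
  rewrite ler_pdivrMr // -natrX -natrM ler_nat mulnC fw_weightE.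
  by rewrite -mulnn; apply: leq_mul.
have := IH (ltnW tT); have := ler_wpM2r L0 h2.
rewrite -addn1 natrD; lra.
Qed.

Lemma screening_total_le (C D : 'M[R]_n) (c : 'I_n -> R) : rows_le M C -> rows_le M D ->
  (forall s i, `|margin X C s i - margin X D s i| <= c i) ->
  total_screening C X <= total_screening D X + l%:R * E * \sum_i c i.
Proof.
move=> rC rD h; rewrite /total_screening.
have -> : l%:R * E * \sum_i c i = \sum_(s < l) \sum_(i < n) E * c i.
  by rewrite sumr_const card_ord -mulr_sumr -mulrA mulr_natl.
rewrite -big_split; apply: ler_sum => s _ /=; rewrite -big_split; apply: ler_sum => i _ /=.
rewrite -lerBlDl; apply: le_trans (ler_norm _) _.
apply: le_trans (expR_dist (t := M) _ _) _.
- by have := norm_margin X s i rC; rewrite /margin ler_norml => /andP[]; lra.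
- by have := norm_margin X s i rD; rewrite /margin ler_norml => /andP[]; lra.
rewrite mulrC; apply: ler_wpM2l; first exact: ltW.
by apply: le_trans (h s i); rewrite /margin -[leLHS]normrN opprD opprK addrC opprK addrC.
Qed.

Lemma min_abs_le (a b : int) : (`|min_abs a b| <= `|a|) && (`|min_abs a b| <= `|b|).
Proof.
rewrite /min_abs; have [h|h] := ltP (b ^+ 2) (a ^+ 2); rewrite lexx ?andbT /=.
  by rewrite -ler_sqr ?nnegrE // !real_normK ?num_real ?ltW.
by rewrite -ler_sqr ?nnegrE // !real_normK ?num_real.
Qed.

Lemma min_abs_close (a b : int) :
  (`|min_abs a b - a| <= `|a - b|) && (`|min_abs a b - b| <= `|a - b|).
Proof.
by rewrite /min_abs; case: ifP => _; rewrite ?subrr ?normr0 ?normr_ge0 ?lexx ?andbT //= distrC.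
Qed.

Lemma symmetrized_sym (C : nat -> nat -> int) i j : symmetrized C i j = symmetrized C j i.
Proof. by rewrite /symmetrized; case: ltngtP. Qed.

Lemma symmetrized_le (C : nat -> nat -> int) i j : `|symmetrized C i j| <= `|C i j|.
Proof.
rewrite /symmetrized; case: ltngtP => _; last by rewrite normr0.
  by have /andP[] := min_abs_le (C i j) (C j i).
by have /andP[] := min_abs_le (C j i) (C i j).
Qed.

Lemma symmetrized_close (C : nat -> nat -> int) i j : C i i = 0 ->
  `|symmetrized C i j - C i j| <= `|C i j - C j i|.
Proof.
move=> Cii; rewrite /symmetrized; case: ltngtP => [_|_|->].
- by have /andP[] := min_abs_close (C i j) (C j i).
- by rewrite (distrC (C i j)); have /andP[] := min_abs_close (C j i) (C i j).
- by rewrite Cii !subrr.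
Qed.

Definition rounded : 'M[R]_n :=
  \matrix_(i, j) (Mp * (symmetrized (B T) i j)%:~R / (fw_weight T)%:R).

Lemma rounded_rows : rows_le Mp rounded.
Proof.
apply: scaled_rows => i; apply: le_trans (fw_rows run (leqnn T) (ltn_ord i)).
by apply: ler_sum => j _; exact: symmetrized_le.
Qed.

Lemma rounded_class : in_class M rounded.
Proof.
split; last by apply/(infty_normP _ M_ge0); exact: rows_le_M rounded_rows.
split=> [|i]; first by apply/matrixP => i j; rewrite !mxE symmetrized_sym.
by rewrite mxE /symmetrized ltnn mulr0 mul0r.
Qed.

(** The rounding moves an entry by at most [|A_ij - A_ji|], which changes the loss by
[l E |A_ij - A_ji|] at most; completing the square against the penalty [l^2/2 (A_ij -
A_ji)^2] leaves [E^2/2] for each entry. *)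
Lemma rounded_loss_penalty :
  total_screening rounded X <= total_screening (A T) X + penalty rho (A T) +
    n%:R ^+ 2 * (E ^+ 2 / 2).
Proof.
have rA := rows_le_M (A_rows (leqnn T)).
apply: le_trans (screening_total_le (D := A T)
   (c := fun i => \sum_j `|A T i j - A T j i|) (rows_le_M rounded_rows) rA _) _.
  move=> s i; rewrite /margin -mulrBr normrM norm_spin_at mul1r /local_field -sumrB.
  apply: le_trans (ler_norm_sum _ _ _) _; apply: ler_sum => j _.
  rewrite -mulrBl normrM norm_spin_at mulr1.
  have h := symmetrized_close j (fw_diag run (leqnn T) (ltn_ord i)).
  rewrite !mxE -!mulrBl -!mulrBr -!rmorphB /= !normrM -!intr_norm.
  apply: ler_wpM2r => //; apply: ler_wpM2l => //.
  by rewrite ler_int.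
rewrite -addrA lerD2l.
have -> : n%:R ^+ 2 * (E ^+ 2 / 2) = \sum_(i < n) \sum_(j < n) E ^+ 2 / 2.
  by rewrite !sumr_const !card_ord -mulrnA -[RHS]mulr_natl natrM expr2.
rewrite /penalty !mulr_sumr -big_split; apply: ler_sum => i _ /=.
rewrite !mulr_sumr -big_split; apply: ler_sum => j _ /=.
rewrite -(real_normK (num_real (A T i j - A T j i))) /rho.
have := sqr_ge0 (l%:R * `|A T i j - A T j i| - E); rewrite !expr2; lra.
Qed.

Lemma total_surrogate : total_screening (A T) X + penalty rho (A T) <=
  Phi (A T) + E * M ^+ 2 * n%:R.
Proof.
have rA := rows_le_M (A_rows (leqnn T)).
rewrite /Phi /surrogate addrAC; apply: lerD => //.
have -> : E * M ^+ 2 * n%:R = \sum_(s < l) \sum_(i < n) 2 * E * M ^+ 2 / N%:R.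
  rewrite !sumr_const !card_ord -mulrnA -[RHS]mulr_natl /N !natrM; field.
  by rewrite gt_eqF.
rewrite -big_split; apply: ler_sum => s _ /=; rewrite -big_split; apply: ler_sum => i _ /=.
exact: (exp_le_cpow N_gt0 MN M_ge0 (norm_margin X s i rA)).
Qed.

(** The comparison matrix is [J] shrunk to the truncated norm bound. *)
Lemma surrogate_start : Phi A0 <= total_screening J X + n%:R * E.
Proof.
have rA0 := rows_le_M A0_rows.
have -> : Phi A0 = \sum_s \sum_i cpow N (margin X A0 s i).
  rewrite /Phi /surrogate /penalty [X in _ + _ * X]big1 ?mulr0 ?addr0 // => i _.
  have [[Js _] _] := J_class.
  by rewrite big1 // => j _; rewrite !mxE -[in J j i]Js mxE subrr expr0n.
apply: (@le_trans _ _ (total_screening A0 X)).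
  apply: ler_sum => s _; apply: ler_sum => i _.
  exact: (cpow_le_exp N_gt0 MN M_ge0 (norm_margin X s i rA0)).
apply: le_trans (screening_total_le (c := fun=> l%:R^-1) rA0 J_rows _) _.
  move=> s i; apply: le_trans _ Mp_close.
  have -> : margin X A0 s i - margin X J s i = - ((M - Mp) / M * margin X J s i).
    have -> : margin X A0 s i = Mp / M * margin X J s i.
      rewrite /margin /local_field mulrCA; congr (_ * _); rewrite mulr_sumr.
      by apply: eq_bigr => j _; rewrite mxE mulrA.
    by field; rewrite gt_eqF.
  have d0 : 0 <= M - Mp by rewrite subr_ge0.
  rewrite normrN normrM (ger0_norm (divr_ge0 d0 M_ge0)) mulrAC ler_pdivrMr //.
  by apply: ler_wpM2l => //; exact: norm_margin.
rewrite lerD2l sumr_const card_ord le_eqVlt; apply/orP; left; apply/eqP.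
by rewrite -mulr_natr; field; rewrite gt_eqF.
Qed.

Lemma rounded_loss :
  total_screening rounded X <= total_screening J X + 53 * E ^+ 3 * n%:R ^+ 2.
Proof.
have h1 := rounded_loss_penalty; have h2 := total_surrogate; have h4 := surrogate_start.
have h3 : Phi (A T) - Phi A0 <= 50 * E ^+ 3 * n%:R.
  rewrite -(ler_pM2l (w0 T)); apply: le_trans (surrogate_run (leqnn T)) _.
  have T1 : 1 <= T%:R :> R by rewrite ler1n muln_gt0 l_gt0.
  have lT : l%:R <= T%:R :> R by rewrite ler_nat leq_pmulr.
  have rT : rho = T%:R by rewrite /rho /T natrM expr2.
  have wT : T%:R * T%:R <= (fw_weight T)%:R * 2 :> R.
    by rewrite -!natrM ler_nat fw_weightE; apply: leq_mul; rewrite // ltnW.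
  have n0 : 0 <= n%:R :> R by [].
  have M2 : M ^+ 2 <= E ^+ 2 by rewrite ler_sqr ?nnegrE ?(ltW E0).
  have E2 : 1 <= E ^+ 2 by rewrite exprn_ege1.
  have E3 : E ^+ 3 = E * E ^+ 2 by rewrite -exprS.
  have E31 : 1 <= E ^+ 3 by rewrite exprn_ege1.
  have EM : E * M ^+ 2 <= E ^+ 3 by rewrite E3 ler_wpM2l // ltW.
  have M3 : M ^+ 2 <= E ^+ 3 by apply: le_trans M2 _; rewrite E3; exact: ler_peMl (sqr_ge0 E) E_ge1.
  have TT : T%:R <= T%:R * T%:R :> R by rewrite -[X in X <= _]mulr1 ler_wpM2l.
  have L1 : L <= 12 * E ^+ 3 * T%:R * n%:R.
    have a1 : E * M ^+ 2 * (l * n)%:R <= E ^+ 3 * (T%:R * n%:R).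
      rewrite natrM; apply: ler_pM.
      - exact: mulr_ge0 (ltW E0) (sqr_ge0 M).
      - by apply: mulr_ge0.
      - exact: EM.
      - by apply: ler_wpM2r.
    have a2 : M ^+ 2 * (T%:R * n%:R) <= E ^+ 3 * (T%:R * n%:R).
      by rewrite ler_wpM2r // mulr_ge0.
    rewrite /L /curvature rT; lra.
  have b1 := ler_wpM2l (ler0n R T) L1.
  have b2 : (l * n)%:R <= E ^+ 3 * (T%:R * T%:R * n%:R).
    rewrite natrM; apply: (@le_trans _ _ (T%:R * n%:R)); first by rewrite ler_wpM2r.
    rewrite -[X in X <= _]mul1r; apply: ler_pM; rewrite ?mulr_ge0 //.
    by rewrite ler_wpM2r.
  have b3 := ler_wpM2r (mulr_ge0 (ltW (lt_le_trans ltr01 E31)) n0) wT.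
  lra.
have n1 : 1 <= n%:R :> R by rewrite ler1n.
have n2 : n%:R <= n%:R ^+ 2 :> R by rewrite expr2; nra.
have M2 : M ^+ 2 <= E ^+ 2 by rewrite ler_sqr ?nnegrE ?(ltW E0).
have E2 : E ^+ 2 <= E ^+ 3 by rewrite ler_weXn2l.
have E1 : E <= E ^+ 3 by rewrite -[X in X <= _]expr1 ler_weXn2l.
have EM : E * M ^+ 2 <= E ^+ 3 by rewrite (exprS _ 2) ler_wpM2l // ltW.
have E30 : 0 <= E ^+ 3 by rewrite exprn_ge0 // ltW.
have c1 : n%:R * E <= n%:R ^+ 2 * E ^+ 3 by apply: ler_pM => //; exact: ltW.
have c2 : E * M ^+ 2 * n%:R <= E ^+ 3 * n%:R ^+ 2.
  by apply: ler_pM => //; exact: mulr_ge0 (ltW E0) (sqr_ge0 M).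
have c3 : n%:R ^+ 2 * E ^+ 2 <= n%:R ^+ 2 * E ^+ 3 by apply: ler_wpM2l => //; exact: sqr_ge0.
have c4 : E ^+ 3 * n%:R <= E ^+ 3 * n%:R ^+ 2 by apply: ler_wpM2l.
have c5 : 0 <= E ^+ 3 * n%:R ^+ 2 by apply: mulr_ge0; rewrite ?sqr_ge0.
lra.
Qed.

End Run.

(** * The program *)

Fixpoint esize (e : expr) : nat :=
  match e with
  | Const _ => 1
  | Input _ e1 | Cell e1 => (esize e1).+1
  | Add e1 e2 | Sub e1 e2 | Mul e1 e2 | Div e1 e2 => (esize e1 + esize e2).+1
  end.

(** The scalar variables and a scratch array live above the [n^2 + 1] output cells, at
addresses computed from the dimension; the run is performed in the output cells
themselves. *)
Definition dim_ := Input 0 (Const 0).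
Definition len_ := Input 1 (Const 0).
Definition var_addr (c : nat) := Add (Mul dim_ dim_) (Const c.+1%:Z).
Definition Var c := Cell (var_addr c).
Definition out_addr i j := Add (Add (Mul i dim_) j) (Const 1).
Definition Out i j := Cell (out_addr i j).
Definition arr_addr k := Add (var_addr 24) k.
Definition Arr k := Cell (arr_addr k).
Definition Spin s i := Input 2 (Add (Mul s dim_) i).
Definition assign c e := Store (var_addr c) e.
Definition for_ c e body :=
  Seq (assign c (Const 0))
    (While (Sub e (Var c)) (Seq body (assign c (Add (Var c) (Const 1))))).

(* [vT] counts the steps; [vPw], [vM] and [vTau] hold [2^l], the scaled norm bound and
   the denominator; [vD] and [vE] the scale and its power in the penalty term; [vI],
   [vJ], [vS] and [vK] are loop counters; [vBJ] and [vBG] the column and the value of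
   the largest gradient entry met in a row; the others are temporary. *)
Local Notation vT := 0%N (only parsing).
Local Notation vPw := 1%N (only parsing).
Local Notation vM := 2%N (only parsing).
Local Notation vTau := 3%N (only parsing).
Local Notation vD := 4%N (only parsing).
Local Notation vE := 5%N (only parsing).
Local Notation vI := 6%N (only parsing).
Local Notation vJ := 7%N (only parsing).
Local Notation vS := 8%N (only parsing).
Local Notation vK := 9%N (only parsing).
Local Notation vWt := 10%N (only parsing).
Local Notation vP := 11%N (only parsing).
Local Notation vG := 12%N (only parsing).
Local Notation vBJ := 13%N (only parsing).
Local Notation vBG := 14%N (only parsing).
Local Notation vQ := 15%N (only parsing).

Definition pow_prog dst b cnt c :=
  Seq (assign dst (Const 1)) (for_ c cnt (assign dst (Mul (Var dst) b))).

Definition dot_prog :=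
  Seq (assign vWt (Const 0))
    (for_ vK dim_ (assign vWt
       (Add (Var vWt) (Mul (Spin (Var vS) (Var vK)) (Out (Var vI) (Var vK)))))).

Definition term_prog :=
  Seq dot_prog
  (Seq (assign vQ (Sub (Var vD) (Mul (Var vM) (Mul (Spin (Var vS) (Var vI)) (Var vWt)))))
  (Seq (pow_prog vP (Var vQ) (Sub (Mul (Const 2) len_) (Const 1)) vK)
     (assign vG (Sub (Var vG)
        (Mul (Var vP) (Mul (Spin (Var vS) (Var vI)) (Spin (Var vS) (Var vJ)))))))).

Definition grad_prog :=
  Seq (assign vG (Const 0))
  (Seq (for_ vS len_ term_prog)
     (assign vG (Add (Var vG)
       (Mul (Mul (Mul (Mul (Mul (Const 2) (Mul len_ len_)) (Var vM)) (Mul (Const 2) len_))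
          (Sub (Out (Var vI) (Var vJ)) (Out (Var vJ) (Var vI)))) (Var vE))))).

Definition row_prog :=
  Seq (assign vBJ (Const 0)) (Seq (assign vBG (Const 0))
  (for_ vJ dim_
    (If (Mul (Sub (Var vI) (Var vJ)) (Sub (Var vI) (Var vJ)))
       (Seq grad_prog
          (If (Sub (Mul (Var vG) (Var vG)) (Mul (Var vBG) (Var vBG)))
             (Seq (assign vBG (Var vG)) (assign vBJ (Var vJ))) Skip))
       Skip))).

(** The directions of all rows are stored before any row is updated, because the
gradient of a row also depends on the column of the same index. *)
Definition choose_prog :=
  let slot := arr_addr (Add (Mul (Const 2) (Var vI)) (Const 1)) in
  Seq row_prog
  (Seq (Store (arr_addr (Mul (Const 2) (Var vI))) (Var vBJ))
     (If (Var vBG) (Store slot (Sub (Const 0) (Add (Var vT) (Const 2))))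
        (If (Sub (Const 0) (Var vBG)) (Store slot (Add (Var vT) (Const 2)))
           (Store slot (Const 0))))).

Definition update_prog :=
  let col := Arr (Mul (Const 2) (Var vI)) in
  Store (out_addr (Var vI) col)
    (Add (Out (Var vI) col) (Arr (Add (Mul (Const 2) (Var vI)) (Const 1)))).

Definition step_prog :=
  Seq (assign vD (Mul (Mul (Mul (Const 2) len_) (Var vPw)) (Var vTau)))
  (Seq (pow_prog vE (Var vD) (Sub (Mul (Const 2) len_) (Const 2)) vK)
  (Seq (for_ vI dim_ choose_prog)
  (Seq (for_ vI dim_ update_prog)
     (assign vTau (Add (Var vTau) (Add (Var vT) (Const 2))))))).

Definition symm_prog :=
  let a := Out (Var vI) (Var vJ) in let b := Out (Var vJ) (Var vI) in
  for_ vI dim_ (for_ vJ (Var vI)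
    (Seq (If (Sub (Mul a a) (Mul b b))
            (Store (out_addr (Var vI) (Var vJ)) (Mul (Var vM) b))
            (Store (out_addr (Var vI) (Var vJ)) (Mul (Var vM) a)))
       (Store (out_addr (Var vJ) (Var vI)) a))).

Definition main_prog :=
  Seq (pow_prog vPw (Const 2) len_ vK)
  (Seq (assign vM (Input 3 len_))
  (Seq (assign vTau (Const 1))
  (Seq (for_ vT (Mul len_ len_) step_prog)
  (Seq symm_prog (Store (Const 0) (Mul (Var vPw) (Var vTau))))))).

(** If the integer part of the norm bound is at least [l], the memory is left empty; its
cell 0 then holds the denominator 0, and a quotient by 0 is 0. *)
Definition learner := If (Sub len_ (Input 3 (Const 0))) main_prog Skip.

Definition le_pow2 (z : int) (k : nat) := `|z| <= 2 ^+ k.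

Lemma le_pow2W z k k' : le_pow2 z k -> (k <= k')%N -> le_pow2 z k'.
Proof. by move=> h kk; apply: le_trans h _; rewrite ler_weXn2l. Qed.
Lemma le_pow2D a b k : le_pow2 a k -> le_pow2 b k -> le_pow2 (a + b) k.+1.
Proof. by rewrite /le_pow2 => ha hb; apply: le_trans (ler_normD _ _) _; rewrite exprS; lia. Qed.
Lemma le_pow2N a k : le_pow2 a k -> le_pow2 (- a) k.
Proof. by rewrite /le_pow2 normrN. Qed.
Lemma le_pow2B a b k : le_pow2 a k -> le_pow2 b k -> le_pow2 (a - b) k.+1.
Proof. by move=> ha hb; apply: le_pow2D => //; exact: le_pow2N. Qed.
Lemma le_pow2M a b k k' : le_pow2 a k -> le_pow2 b k' -> le_pow2 (a * b) (k + k').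
Proof. by rewrite /le_pow2 => ha hb; rewrite normrM exprD; apply: ler_pM. Qed.
Lemma le_pow2X a k j : le_pow2 a k -> le_pow2 (a ^+ j) (k * j).
Proof. by rewrite /le_pow2 => ha; rewrite normrX exprM; apply: lerXn2r; rewrite ?nnegrE. Qed.
Lemma pow2Z k : (2 : int) ^+ k = (2 ^ k)%N%:Z.
Proof. by rewrite -[RHS]natz natrX. Qed.
Lemma le_pow2_nat j k : (j <= 2 ^ k)%N -> le_pow2 j%:Z k.
Proof. by rewrite /le_pow2 ger0_norm // pow2Z. Qed.

Lemma index_lt n i j : (i < n)%N -> (j < n)%N -> (i * n + j < n * n)%N.
Proof.
move=> hi hj; apply: (@leq_trans (i.+1 * n)%N); first by rewrite mulSn addnC ltn_add2r.
by rewrite leq_mul2r hi orbT.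
Qed.

(** * Triples with step counts *)

Section Semantics.
Variables (inp : tracks) (n l W P : nat).
Hypothesis inp0 : forall k, inp 0 k = n%:Z.
Hypothesis inp1 : forall k, inp 1 k = l%:Z.
Hypothesis n_lt : (n < 2 ^ W)%N.
Hypothesis l_lt : (l < 2 ^ W)%N.
Hypothesis W_gt5 : (5 < W)%N.

Implicit Types (m : memory) (e : expr).

(** [W] bounds the number of digits of all values that are ever stored. *)
Definition small (z : int) : bool := (`|z| < 2 ^ W)%N.
Definition bounded m := forall a, small (m a).

(** The conditions under which an expression is cheap: the values read are small and
the positions read on the tracks are at most [P], since reading costs the
position. *)
Fixpoint ok m e : Prop :=
  match e with
  | Const z => small z
  | Input t e1 => [/\ ok m e1, (`|eval inp m e1| <= P)%N & small (inp t `|eval inp m e1|%N)]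
  | Cell e1 => ok m e1
  | Add e1 e2 | Sub e1 e2 | Mul e1 e2 => ok m e1 /\ ok m e2
  | Div _ _ => False
  end.

Lemma ok_val m e : bounded m -> ok m e -> (`|eval inp m e| < 2 ^ (esize e * W))%N.
Proof.
move=> bm.
have one a b : (`|a| < 2 ^ W)%N -> (`|a : int| < 2 ^ (b.+1 * W))%N.
  by move=> h; apply: leq_trans h _; rewrite leq_exp2l // leq_pmull.
have add (a b : int) p q : (`|a| < 2 ^ (p * W))%N -> (`|b| < 2 ^ (q * W))%N ->
   (`|a| + `|b| < 2 ^ ((p + q).+1 * W))%N.
  move=> ha hb.
  have h1 : (2 ^ (p * W) <= 2 ^ ((p + q) * W))%N by rewrite leq_exp2l // leq_mul2r leq_addr orbT.
  have h2 : (2 ^ (q * W) <= 2 ^ ((p + q) * W))%N by rewrite leq_exp2l // leq_mul2r leq_addl orbT.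
  have h3 : (2 * 2 ^ ((p + q) * W) <= 2 ^ ((p + q).+1 * W))%N.
    by rewrite -expnS leq_exp2l // mulSn; lia.
  lia.
elim: e => [z|t e IH|e IH|e1 IH1 e2 IH2|e1 IH1 e2 IH2|e1 IH1 e2 IH2|e1 IH1 e2 IH2] /=.
- by rewrite mul1n.
- by move=> [_ _ h]; apply: one.
- by move=> _; apply: one; exact: bm.
- by move=> [/IH1 h1 /IH2 h2]; apply: leq_ltn_trans (add _ _ _ _ h1 h2); lia.
- by move=> [/IH1 h1 /IH2 h2]; apply: leq_ltn_trans (add _ _ _ _ h1 h2); lia.
- move=> [/IH1 h1 /IH2 h2]; rewrite abszM.
  apply: (@leq_trans (2 ^ (esize e1 * W) * 2 ^ (esize e2 * W))%N); first exact: ltn_mul.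
  by rewrite -expnD leq_exp2l // mulSn mulnDl leq_addl.
- by [].
Qed.

Lemma bitlen_le (z : int) k : (`|z| < 2 ^ k)%N -> (0 < k)%N -> (bitlen z <= k)%N.
Proof.
rewrite /bitlen => h k0; case: (posnP `|z|%N) => [->|z0]; first by rewrite trunc_log0.
by rewrite -(ltn_exp2l _ _ (isT : 1 < 2)%N); apply: leq_ltn_trans (trunc_logP _ z0) h.
Qed.

Lemma ok_cost m e : bounded m -> ok m e ->
  (eval_cost inp m e <= esize e * (esize e * W + P))%N.
Proof.
move=> bm he; suff h S : (esize e <= S)%N -> (eval_cost inp m e <= esize e * (S * W + P))%N.
  exact: h.
move: he; have B e' : ok m e' -> (esize e' <= S)%N -> (bitlen (eval inp m e') <= S * W)%N.
  move=> o h; apply: leq_trans (bitlen_le (ok_val bm o) _) _.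
    by rewrite muln_gt0 (leq_trans _ W_gt5) // andbT; case: (e').
  by rewrite leq_mul2r h orbT.
elim: e => [z|t e IH|e IH|e1 IH1 e2 IH2|e1 IH1 e2 IH2|e1 IH1 e2 IH2|e1 IH1 e2 IH2] o h;
  move: (B _ o h) (o); rewrite /= => b.
- by lia.
- by move=> [ok1 p _]; have := IH ok1 (ltnW h); lia.
- by move=> ok1; have := IH ok1 (ltnW h); lia.
- move=> [ok1 ok2]; rewrite /= in h.
  by have := IH1 ok1 ltac:(lia); have := IH2 ok2 ltac:(lia); lia.
- move=> [ok1 ok2]; rewrite /= in h.
  by have := IH1 ok1 ltac:(lia); have := IH2 ok2 ltac:(lia); lia.
- move=> [ok1 ok2]; rewrite /= in h.
  by have := IH1 ok1 ltac:(lia); have := IH2 ok2 ltac:(lia); lia.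
- by [].
Qed.

(** The cost of a store with two expressions of size at most 128, with room for the
overhead of the control structures. *)
Definition unit_cost : nat := (256 * (128 * W + P)).+4.

Lemma cost_unit m e : bounded m -> ok m e -> (esize e <= 128)%N ->
  (eval_cost inp m e <= 128 * (128 * W + P))%N.
Proof.
move=> bm o h; apply: leq_trans (ok_cost bm o) _.
by apply: leq_mul => //; rewrite leq_add2r leq_mul2r h orbT.
Qed.

(** Time is counted in units; the bound on the memory is kept as an invariant here, so
that each store only has to show that its value is small. *)
Definition wp (c : prog) (S : nat) (Q : memory -> Prop) m : Prop :=
  bounded m -> exists m' t, [/\ exec inp c m m' t, (t <= S * unit_cost)%N, bounded m' & Q m'].

Lemma wp_weaken c S S' (Q : memory -> Prop) m : (S <= S')%N -> wp c S Q m -> wp c S' Q m.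
Proof.
move=> hS h bm; have [m' [t [e ht bm' q]]] := h bm.
by exists m', t; split=> //; apply: leq_trans ht _; rewrite leq_mul2r hS orbT.
Qed.

Lemma wp_skip (Q : memory -> Prop) m : Q m -> wp Skip 1 Q m.
Proof. by move=> q bm; exists m, 1%N; split=> //; exact: ExecSkip. Qed.

Lemma wp_store a e (Q : memory -> Prop) m :
  ok m a -> ok m e -> (esize a <= 128)%N -> (esize e <= 128)%N -> small (eval inp m e) ->
  Q (update m `|eval inp m a|%N (eval inp m e)) -> wp (Store a e) 1 Q m.
Proof.
move=> oa oe sa se sm q bm; exists (update m `|eval inp m a|%N (eval inp m e)), (eval_cost inp m a + eval_cost inp m e).+1.
split=> //; first exact: ExecStore.
  have := cost_unit bm oa sa; have := cost_unit bm oe se; rewrite /unit_cost.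
  set u := (128 * W + P)%N; lia.
by move=> b; rewrite /update; case: ifP.
Qed.

Lemma wp_seq c1 c2 S1 S2 (Q : memory -> Prop) m :
  wp c1 S1 (wp c2 S2 Q) m -> wp (Seq c1 c2) (S1 + S2).+1 Q m.
Proof.
move=> h bm; have [m1 [t1 [e1 h1 b1 q1]]] := h bm.
have [m2 [t2 [e2 h2 b2 q2]]] := q1 b1.
exists m2, (t1 + t2).+1; split=> //; first exact: ExecSeq e1 e2.
by rewrite mulSn mulnDl; have : (0 < unit_cost)%N by []; lia.
Qed.

Lemma wp_if e c1 c2 S (Q : memory -> Prop) m :
  ok m e -> (esize e <= 128)%N ->
  (0 < eval inp m e -> wp c1 S Q m) -> (eval inp m e <= 0 -> wp c2 S Q m) ->
  wp (If e c1 c2) S.+1 Q m.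
Proof.
move=> oe se h1 h2 bm; have cst := cost_unit bm oe se.
have [p|p] := ltP 0 (eval inp m e).
  have [m1 [t1 [e1 k1 b1 q1]]] := h1 p bm.
  exists m1, (eval_cost inp m e + t1).+1; split=> //; first exact: ExecIfTrue p e1.
  by rewrite mulSn /unit_cost in k1 *; lia.
have [m1 [t1 [e1 k1 b1 q1]]] := h2 p bm.
exists m1, (eval_cost inp m e + t1).+1; split=> //; first exact: ExecIfFalse p e1.
by rewrite mulSn /unit_cost in k1 *; lia.
Qed.

Definition addr c : nat := (n * n + c.+1)%N.
Definition var m c : int := m (addr c).
Definition upd c v m : memory := update m (addr c) v.
Definition out m i j : int := m (i * n + j).+1.
Definition arr m k : int := m (n * n + 25 + k)%N.

Lemma eval_sub m e1 e2 : eval inp m (Sub e1 e2) = eval inp m e1 - eval inp m e2.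
Proof. by []. Qed.
Lemma eval_add m e1 e2 : eval inp m (Add e1 e2) = eval inp m e1 + eval inp m e2.
Proof. by []. Qed.
Lemma eval_mul m e1 e2 : eval inp m (Mul e1 e2) = eval inp m e1 * eval inp m e2.
Proof. by []. Qed.
Lemma eval_const m z : eval inp m (Const z) = z.
Proof. by []. Qed.
Lemma eval_dim m : eval inp m dim_ = n%:Z.
Proof. exact: inp0. Qed.
Lemma eval_len m : eval inp m len_ = l%:Z.
Proof. exact: inp1. Qed.

Lemma eval_addr m c : `|eval inp m (var_addr c)|%N = addr c.
Proof. by rewrite /= !inp0 /addr; lia. Qed.

Lemma eval_var m c : eval inp m (Var c) = var m c.
Proof. by rewrite /Var [LHS]/= -/(eval inp m (var_addr c)) eval_addr. Qed.

Lemma var_upd m c c' v : var (upd c v m) c' = if c' == c then v else var m c'.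
Proof. by rewrite /var /upd /update /addr eqn_add2l eqSS. Qed.

Lemma out_upd m c v i j : (i < n)%N -> (j < n)%N -> out (upd c v m) i j = out m i j.
Proof.
move=> hi hj; rewrite /out /upd /update /addr; case: eqP => // h.
by have := index_lt hi hj; lia.
Qed.

Lemma arr_upd m c v k : (c < 24)%N -> arr (upd c v m) k = arr m k.
Proof. by move=> hc; rewrite /arr /upd /update /addr; case: eqP => // h; lia. Qed.

Lemma eval_out m e1 e2 (i j : nat) : eval inp m e1 = i%:Z -> eval inp m e2 = j%:Z ->
  `|eval inp m (out_addr e1 e2)|%N = (i * n + j).+1.
Proof. by move=> h1 h2; rewrite /= h1 h2 inp0; lia. Qed.

Lemma eval_Out m e1 e2 (i j : nat) : eval inp m e1 = i%:Z -> eval inp m e2 = j%:Z ->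
  eval inp m (Out e1 e2) = out m i j.
Proof. by move=> h1 h2; rewrite /Out [LHS]/= -/(eval inp m (out_addr e1 e2)) (eval_out h1 h2). Qed.

Lemma eval_arr m e1 (k : nat) : eval inp m e1 = k%:Z ->
  `|eval inp m (arr_addr e1)|%N = (n * n + 25 + k)%N.
Proof. by move=> h1; rewrite /= h1 !inp0; lia. Qed.

Lemma eval_Arr m e1 (k : nat) : eval inp m e1 = k%:Z -> eval inp m (Arr e1) = arr m k.
Proof. by move=> h1; rewrite /Arr [LHS]/= -/(eval inp m (arr_addr e1)) (eval_arr h1). Qed.

Lemma eval_Spin m e1 e2 (s i : nat) : eval inp m e1 = s%:Z -> eval inp m e2 = i%:Z ->
  eval inp m (Spin e1 e2) = inp 2 (s * n + i).
Proof. by move=> h1 h2; rewrite /= h1 h2 inp0; congr (inp 2 _); lia. Qed.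

Lemma small_le k : (k <= 32)%N -> small k%:Z.
Proof.
move=> h; apply: leq_ltn_trans h _.
by apply: (@leq_trans (2 ^ 6)%N) => //; rewrite leq_exp2l.
Qed.

Lemma ok_dim m : ok m dim_.
Proof. by split; rewrite ?inp0 //=; exact: (@small_le 0). Qed.
Lemma ok_len m : ok m len_.
Proof. by split; rewrite ?inp1 //=; exact: (@small_le 0). Qed.
Lemma ok_addr m c : (c <= 24)%N -> ok m (var_addr c).
Proof. by move=> h; split; [split; exact: ok_dim|apply: small_le; lia]. Qed.
Lemma ok_var m c : (c <= 24)%N -> ok m (Var c).
Proof. exact: ok_addr. Qed.
Lemma ok_out m e1 e2 : ok m e1 -> ok m e2 -> ok m (out_addr e1 e2).
Proof. by move=> h1 h2; do 3?split=> //; try exact: ok_dim; exact: (@small_le 1). Qed.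
Lemma ok_arr m e1 : ok m e1 -> ok m (arr_addr e1).
Proof. by move=> h1; split=> //; exact: ok_addr. Qed.
Lemma ok_Spin m e1 e2 (s i : nat) : ok m e1 -> ok m e2 ->
  eval inp m e1 = s%:Z -> eval inp m e2 = i%:Z -> (s * n + i <= P)%N ->
  small (inp 2 (s * n + i)) -> ok m (Spin e1 e2).
Proof.
move=> o1 o2 h1 h2 hP hs.
have h : `|eval inp m (Add (Mul e1 dim_) e2)|%N = (s * n + i)%N.
  by rewrite /= h1 h2 inp0; lia.
split; rewrite ?h //; split=> //; split=> //; exact: ok_dim.
Qed.

Lemma wp_assign c e (Q : memory -> Prop) m :
  (c < 24)%N -> ok m e -> (esize e <= 128)%N -> small (eval inp m e) ->
  Q (upd c (eval inp m e) m) -> wp (assign c e) 1 Q m.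
Proof.
move=> hc oe se sm q; apply: wp_store => //; first by apply: ok_addr; lia.
by rewrite eval_addr.
Qed.

(** The invariant is stated for the value of the counter before the test; the body
leaves the counter alone, and the increment is applied to its final memory. *)
Lemma wp_for c e body (cnt : nat) (I : nat -> memory -> Prop) S (Q : memory -> Prop) m :
  (c < 24)%N -> (esize e <= 100)%N -> (cnt < 2 ^ W)%N ->
  (forall k m', I k m' -> eval inp m' e = cnt%:Z /\ ok m' e) ->
  I 0%N (upd c 0 m) ->
  (forall k m', (k < cnt)%N -> I k m' -> var m' c = k%:Z ->
     wp body S (fun m'' => var m'' c = k%:Z /\ I k.+1 (upd c k.+1%:Z m'')) m') ->
  (forall m', I cnt m' -> var m' c = cnt%:Z -> Q m') ->
  wp (for_ c e body) (cnt * S.+3).+3 Q m.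
Proof.
move=> hc he hcnt hev h0 hS hQ bm.
rewrite /for_; set loop := While _ _.
have step k m' : (k <= cnt)%N -> I k m' -> var m' c = k%:Z -> bounded m' ->
   exists m'' t, [/\ exec inp loop m' m'' t,
     (t <= ((cnt - k) * S.+3).+1 * unit_cost)%N, bounded m'' & Q m''].
  move: {2}(cnt - k)%N (leqnn (cnt - k)%N) => d.
  elim: d k m' => [|d IH] k m' hd kc Ik vk bm'.
    have kE : k = cnt by lia.
    have [ev ok_e] := hev _ _ Ik.
    have oe : ok m' (Sub e (Var c)) by split=> //; apply: ok_var; lia.
    exists m', (eval_cost inp m' (Sub e (Var c))).+1; split.
    - apply: ExecWhileFalse; rewrite eval_sub eval_var ev vk kE; lia.
    - have := cost_unit bm' oe; rewrite kE subnn mul0n mul1n /unit_cost /= => /(_ ltac:(lia)); lia.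
    - by [].
    - by apply: hQ; rewrite -kE.
  case: (ltnP k cnt) => kc'; last by apply: IH => //; lia.
  have [ev ok_e] := hev _ _ Ik.
  have oe : ok m' (Sub e (Var c)) by split=> //; apply: ok_var; lia.
  have [m1 [t1 [e1 k1 b1 [v1 I1]]]] := hS k m' kc' Ik vk bm'.
  have oi : ok m1 (Add (Var c) (Const 1)).
    by split; [apply: ok_var; lia|exact: (@small_le 1)].
  have inc : wp (assign c (Add (Var c) (Const 1))) 1 (fun m2 => m2 = upd c k.+1%:Z m1) m1.
    have evi : eval inp m1 (Add (Var c) (Const 1)) = k.+1%:Z.
      by rewrite eval_add eval_var v1 eval_const; lia.
    apply: wp_assign => //; rewrite evi //.
    by rewrite /small /=; apply: leq_trans hcnt; lia.
  have [m2 [t2 [e2 k2 b2 m2E]]] := inc b1.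
  have [m3 [t3 [e3 k3 b3 q3]]] : exists m'' t, [/\ exec inp loop m2 m'' t,
     (t <= ((cnt - k.+1) * S.+3).+1 * unit_cost)%N, bounded m'' & Q m''].
    by apply: IH; rewrite ?m2E // ?var_upd ?eqxx //; [lia|rewrite -m2E].
  exists m3, (eval_cost inp m' (Sub e (Var c)) + (t1 + t2).+1 + t3).+1; split=> //.
    apply: (ExecWhileTrue _ (ExecSeq e1 e2) e3).
    rewrite eval_sub eval_var ev vk; lia.
  have sz : (esize (Sub e (Var c)) <= 128)%N by rewrite /=; lia.
  have k0 := cost_unit bm' oe sz.
  have -> : (cnt - k = (cnt - k.+1).+1)%N by lia.
  rewrite mul1n in k2; rewrite [((cnt - k.+1).+1 * _)%N]mulSn.
  have u4 : (eval_cost inp m' (Sub e (Var c)) + 2 <= unit_cost)%N by rewrite /unit_cost; lia.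
  move: k1 k3 u4; set r := ((cnt - k.+1) * S.+3)%N => k1 k3 u4.
  have -> : ((S.+3 + r).+1 * unit_cost = S * unit_cost + r.+1 * unit_cost + unit_cost + unit_cost + unit_cost)%N.
    by nia.
  change (eval_cost inp m' (Sub e (Var c)) + (t1 + t2).+1 + t3 < S * unit_cost + r.+1 * unit_cost + unit_cost + unit_cost + unit_cost)%N.
  lia.
have i0 : wp (assign c (Const 0)) 1 (fun m2 => m2 = upd c 0 m) m.
  by apply: wp_assign => //; exact: (@small_le 0).
have [m1 [t1 [e1 k1 b1 m1E]]] := i0 bm.
have [m2 [t2 [e2 k2 b2 q2]]] : exists m'' t, [/\ exec inp loop m1 m'' t,
     (t <= ((cnt - 0) * S.+3).+1 * unit_cost)%N, bounded m'' & Q m''].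
  by apply: step; rewrite ?m1E // ?var_upd ?eqxx // -m1E.
exists m2, (t1 + t2).+1; split=> //; first exact: ExecSeq e1 e2.
rewrite subn0 in k2; rewrite mul1n in k1.
move: k2; set r := (cnt * S.+3)%N; rewrite !mulSn => k2.
have : (0 < unit_cost)%N by [].
lia.
Qed.

(** * Correctness of the program *)

Let q := (n + 6 * l + 4)%N.
Hypothesis W_ge : (2 * l * q + 9 * l + n + 50 <= W)%N.
Hypothesis P_ge : (n * l + l <= P)%N.
Hypothesis n_gt0 : (0 < n)%N.
Hypothesis l_gt0 : (0 < l)%N.
Let xs s i := inp 2 (s * n + i)%N.
Hypothesis xs_le : forall s i, (s < l)%N -> (i < n)%N -> `|xs s i| <= 1.

Implicit Types (X : seq nat).

Lemma small_pow2 z k : le_pow2 z k -> (k < W)%N -> small z.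
Proof.
rewrite /le_pow2 /small => h kW.
have h2 : (`|z| <= 2 ^ k)%N by by rewrite -lez_nat abszE -pow2Z.
by apply: leq_ltn_trans h2 _; rewrite ltn_exp2l.
Qed.

(** A frame condition: only the scalar variables in [X] may have changed. *)
Definition agree X m m' := forall a, a \notin [seq addr c | c <- X] -> m' a = m a.

Lemma agree_upd X m m' c v : c \in X -> agree X m m' -> agree X m (upd c v m').
Proof.
move=> cX h a aX; rewrite /upd /update; case: eqP => [aE|_]; last exact: h.
by rewrite aE map_f in aX.
Qed.

Lemma agree_trans X m m1 m2 : agree X m m1 -> agree X m1 m2 -> agree X m m2.
Proof. by move=> h1 h2 a aX; rewrite h2 // h1. Qed.

Lemma agree_sub X Y m m' : {subset Y <= X} -> agree Y m m' -> agree X m m'.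
Proof.
move=> YX h a aX; apply: h; apply: contra aX => /mapP[c cY ->].
by apply: map_f; exact: YX.
Qed.

Lemma addr_inj : injective addr.
Proof. by move=> a b; rewrite /addr; lia. Qed.

Lemma agree_var X m m' c : agree X m m' -> c \notin X -> var m' c = var m c.
Proof. by move=> h cX; apply: h; rewrite mem_map //; exact: addr_inj. Qed.

Lemma agree_out X m m' i j : agree X m m' -> (i < n)%N -> (j < n)%N -> out m' i j = out m i j.
Proof.
move=> h hi hj; apply: h; apply/negP => /mapP[c _]; rewrite /addr => e.
by have := index_lt hi hj; lia.
Qed.

Lemma agree_arr X m m' k : all (fun c => c < 24)%N X -> agree X m m' -> arr m' k = arr m k.
Proof.
move=> hX h; apply: h; apply/negP => /mapP[c /(allP hX) c24]; rewrite /addr => e.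
lia.
Qed.

(** The factor [b] and the exponent may be any expressions that the loop does not
disturb. *)
Lemma wp_pow dst b cnt c (z : int) (k : nat) (Q : memory -> Prop) m :
  (dst < 24)%N -> (c < 24)%N -> dst != c -> (esize b <= 100)%N -> (esize cnt <= 100)%N ->
  (k < 2 ^ W)%N ->
  (forall m', agree [:: dst; c] m m' -> [/\ eval inp m' b = z, ok m' b, eval inp m' cnt = k%:Z & ok m' cnt]) ->
  (forall j, (j <= k)%N -> small (z ^+ j)) ->
  (forall m', agree [:: dst; c] m m' -> var m' dst = z ^+ k -> Q m') ->
  wp (pow_prog dst b cnt c) (k * 4 + 5) Q m.
Proof.
move=> hd hc dc sb sc kW hb hz hQ.
have -> : (k * 4 + 5 = (1 + (k * 4).+3).+1)%N by lia.
apply: wp_seq; apply: wp_assign => //; first exact: (@small_le 1).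
  exact: (@small_le 1).
apply: (wp_for (cnt := k) (I := fun j m' => agree [:: dst; c] m m' /\ var m' dst = z ^+ j)) => //.
- by move=> j m' [/hb[_ _ e o] _]; split.
- split; first by do 2![apply: agree_upd; rewrite ?inE ?eqxx ?orbT //].
  by rewrite !var_upd (negbTE dc) eqxx.
- move=> j m' jk [a v] vc; have [eb obb _ _] := hb _ a.
  have e : eval inp m' (Mul (Var dst) b) = z ^+ j.+1 by rewrite eval_mul eval_var v eb exprSr.
  apply: wp_assign => //.
  + by split=> //; apply: ok_var => //; lia.
  + by rewrite /=; lia.
  + by rewrite e; exact: hz.
  + rewrite e; split; first by rewrite var_upd eq_sym (negbTE dc).
    split; first by do 2![apply: agree_upd; rewrite ?inE ?eqxx ?orbT //].
    by rewrite !var_upd (negbTE dc) eqxx.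
- by move=> m' [a v] _; apply: hQ.
Qed.

Lemma ok_Out m e1 e2 : ok m e1 -> ok m e2 -> ok m (Out e1 e2).
Proof. exact: ok_out. Qed.
Lemma ok_Arr m e1 : ok m e1 -> ok m (Arr e1).
Proof. exact: ok_arr. Qed.

Lemma ok_sample m e1 e2 s i : ok m e1 -> ok m e2 -> eval inp m e1 = s%:Z -> eval inp m e2 = i%:Z ->
  (s < l)%N -> (i < n)%N -> ok m (Spin e1 e2).
Proof.
move=> o1 o2 h1 h2 hs hi; apply: (ok_Spin o1 o2 h1 h2).
  apply: leq_trans P_ge; apply: (@leq_trans (s.+1 * n)%N); first by rewrite mulSn addnC leq_add2r ltnW.
  by rewrite mulnC; apply: leq_trans (leq_addr _ _); rewrite leq_mul2l hs orbT.
apply: (@small_pow2 _ 0); last lia.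
by rewrite /le_pow2 expr0; exact: xs_le.
Qed.

Lemma fw_weight_le t : (t <= l * l)%N -> (fw_weight t <= 2 ^ (4 * l + 2))%N.
Proof.
move=> ht; have w := fw_weightE t.
have l2 : (l <= 2 ^ l)%N by apply: ltnW; exact: ltn_expl.
have h1 : (t.+1 * t.+2 <= (2 * (l * l)) * (3 * (l * l)))%N.
  by apply: leq_mul; have : (0 < l * l)%N by [rewrite muln_gt0 l_gt0]; lia.
have h2 : (l * l * (l * l) <= 2 ^ (4 * l))%N.
  have -> : (2 ^ (4 * l) = 2 ^ l * 2 ^ l * (2 ^ l * 2 ^ l))%N by rewrite -!expnD; congr (2 ^ _)%N; lia.
  by apply: leq_mul; apply: leq_mul.
rewrite expnD; move: h1 h2 w; set a := (l * l * (l * l))%N; set b := (2 ^ (4 * l))%N.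
rewrite (_ : (2 * (l * l) * (3 * (l * l)) = 6 * a)%N); last by rewrite /a; lia.
lia.
Qed.

Section Gradient.
Variables (t : nat) (B : nat -> nat -> int) (mm : int).
Hypothesis t_le : (t <= l * l)%N.
Hypothesis B_le : forall i j, (i < n)%N -> (j < n)%N -> `|B i j| <= (fw_weight t)%:Z.
Hypothesis mm_ge0 : 0 <= mm.
Hypothesis mm_le : mm <= l%:Z * 2 ^+ l.

Let D := int_scale l t.

Lemma le_pow2_entry i j : (i < n)%N -> (j < n)%N -> le_pow2 (B i j) (4 * l + 2).
Proof.
by move=> hi hj; apply: le_trans (B_le hi hj) _; rewrite pow2Z lez_nat fw_weight_le.
Qed.

Lemma le_pow2_mm : le_pow2 mm (2 * l).
Proof.
rewrite /le_pow2 ger0_norm //; apply: le_trans mm_le _.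
rewrite mul2n -addnn exprD ler_wpM2r ?exprn_ge0 // pow2Z lez_nat ltnW // ltn_expl //.
Qed.

Lemma le_pow2_scale : le_pow2 D (6 * l + 3).
Proof.
rewrite /D /int_scale; have -> : (6 * l + 3 = (1 + l) + l + (4 * l + 2))%N by lia.
apply: le_pow2M; last by apply: le_pow2_nat; exact: fw_weight_le.
apply: le_pow2M; last by rewrite /le_pow2 ger0_norm ?exprn_ge0.
by apply: le_pow2_nat; rewrite expnD expn1 leq_mul2l ltnW // ltn_expl.
Qed.

Lemma le_pow2_dot s i k : (s < l)%N -> (i < n)%N -> (k <= n)%N ->
  le_pow2 (\sum_(j < k) xs s j * B i j) (n + 4 * l + 2).
Proof.
move=> hs hi hk; apply: (@le_trans _ _ (\sum_(j < k) 2 ^+ (4 * l + 2))).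
  apply: le_trans (ler_norm_sum _ _ _) _; apply: ler_sum => j _.
  have hj : (j < n)%N by apply: leq_trans hk.
  rewrite normrM; apply: (@le_trans _ _ (1 * `|B i j|)).
    by apply: ler_wpM2r => //; exact: xs_le.
  by rewrite mul1r; exact: le_pow2_entry.
rewrite sumr_const card_ord -addnA [leRHS]exprD -[leLHS]mulr_natl; apply: ler_wpM2r; first exact: exprn_ge0.
rewrite natz pow2Z lez_nat; apply: (leq_trans hk); exact: ltnW (ltn_expl _ _).
Qed.

Let base s i := D - mm * int_margin n xs B s i.

Lemma le_pow2_margin s i : (s < l)%N -> (i < n)%N -> le_pow2 (int_margin n xs B s i) (n + 4 * l + 2).
Proof.
move=> hs hi; rewrite /int_margin /le_pow2 normrM -[leRHS]mul1r.
by apply: ler_pM => //; [exact: xs_le|exact: le_pow2_dot].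
Qed.

Lemma le_pow2_base s i : (s < l)%N -> (i < n)%N -> le_pow2 (base s i) q.
Proof.
move=> hs hi; have -> : q = (n + 6 * l + 3).+1 by rewrite /q; lia.
apply: le_pow2B; first by apply: le_pow2W le_pow2_scale _; lia.
by apply: le_pow2W (le_pow2M le_pow2_mm (le_pow2_margin hs hi)) _; lia.
Qed.

Definition grad_inputs m := [/\ var m vM = mm, var m vD = D, var m vE = D ^+ (2 * l).-2 &
  forall i j, (i < n)%N -> (j < n)%N -> out m i j = B i j].

Lemma grad_inputs_agree X m m' : agree X m m' -> all (fun c => c \notin [:: vM; vD; vE]) X ->
  grad_inputs m -> grad_inputs m'.
Proof.
move=> a hX [h1 h2 h3 h4].
have nX c : c \in [:: vM; vD; vE] -> c \notin X.
  by move=> hc; apply/negP => /(allP hX); rewrite hc.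
split; rewrite ?(agree_var a) ?nX //.
by move=> i j hi hj; rewrite (agree_out a) // h4.
Qed.

Lemma wp_dot s i (Q : memory -> Prop) m : (s < l)%N -> (i < n)%N -> grad_inputs m ->
  var m vS = s%:Z -> var m vI = i%:Z ->
  (forall m', agree [:: vWt; vK] m m' -> var m' vWt = \sum_(k < n) xs s k * B i k -> Q m') ->
  wp dot_prog (n * 4 + 5) Q m.
Proof.
move=> hs hi g vs vi hQ.
have -> : (n * 4 + 5 = (1 + (n * 4).+3).+1)%N by lia.
apply: wp_seq; apply: wp_assign => //; try exact: (@small_le 0).
apply: (wp_for (cnt := n) (I := fun k m' => agree [:: vWt; vK] m m' /\
   var m' vWt = \sum_(j < k) xs s j * B i j)) => //.
- by move=> k m' _; split; [exact: eval_dim|exact: ok_dim].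
- split; first by do 2![apply: agree_upd => //].
  by rewrite !var_upd /= big_ord0.
- move=> k m' hk [a v] vk.
  have gc : grad_inputs m' by apply: grad_inputs_agree a _ g.
  have vs' : eval inp m' (Var vS) = s%:Z by rewrite eval_var (agree_var a).
  have vi' : eval inp m' (Var vI) = i%:Z by rewrite eval_var (agree_var a).
  have vk' : eval inp m' (Var vK) = k%:Z by rewrite eval_var.
  have e : eval inp m' (Add (Var vWt) (Mul (Spin (Var vS) (Var vK)) (Out (Var vI) (Var vK)))) =
     \sum_(j < k.+1) xs s j * B i j.
    rewrite eval_add eval_mul eval_var v (eval_Spin vs' vk') (eval_Out vi' vk') big_ord_recr /=.
    by case: gc => _ _ _ ->.
  apply: wp_assign => //.
  + split; first exact: ok_var.
    by split; [apply: (ok_sample _ _ vs' vk') => //; exact: ok_var|apply: ok_Out; exact: ok_var].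
  + by rewrite e; apply: small_pow2 (le_pow2_dot hs hi hk) _; lia.
  + rewrite e; split; first by rewrite var_upd /= vk.
    split; first by do 2![apply: agree_upd => //].
    by rewrite !var_upd.
- by move=> m' [a v] _; apply: hQ.
Qed.

Lemma wp_term s i j g (Q : memory -> Prop) m :
  (s < l)%N -> (i < n)%N -> (j < n)%N -> grad_inputs m ->
  var m vS = s%:Z -> var m vI = i%:Z -> var m vJ = j%:Z -> var m vG = g ->
  small (g - base s i ^+ (2 * l).-1 * (xs s i * xs s j)) ->
  (forall m', agree [:: vWt; vK; vQ; vP; vG] m m' ->
     var m' vG = g - base s i ^+ (2 * l).-1 * (xs s i * xs s j) -> Q m') ->
  wp term_prog (n * 4 + l * 8 + 11) Q m.
Proof.
move=> hs hi hj g0 vs vi vj vg spin_at hQ.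
have -> : (n * 4 + l * 8 + 11 = ((n * 4 + 5) + (1 + (((2 * l).-1 * 4 + 5) + 1).+1).+1).+1)%N by lia.
apply: wp_seq; apply: (wp_dot hs hi g0 vs vi) => m1 a1 v1.
have a1' : agree [:: vWt; vK; vQ; vP; vG] m m1 by apply: agree_sub a1 => c; rewrite !inE => /orP[]->; rewrite ?orbT.
have e1 : eval inp m1 (Sub (Var vD) (Mul (Var vM) (Mul (Spin (Var vS) (Var vI)) (Var vWt)))) = base s i.
  have [h1 h2 _ _] := g0.
  rewrite eval_sub !eval_mul !eval_var v1 (eval_Spin (s := s) (i := i)) ?eval_var ?(agree_var a1) //.
  by rewrite h1 h2.
apply: wp_seq; apply: wp_assign => //.
- split; first exact: ok_var.
  split; first exact: ok_var.
  split; last exact: ok_var.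
  by apply: (@ok_sample _ _ _ s i); rewrite ?eval_var ?(agree_var a1) //; exact: ok_var.
- by rewrite e1; apply: small_pow2 (le_pow2_base hs hi) _; rewrite /q; lia.
rewrite e1; set m2 := upd vQ _ m1.
apply: wp_seq; apply: (@wp_pow _ _ _ _ (base s i) (2 * l).-1) => //.
- by apply: leq_ltn_trans (_ : 2 * l < _)%N; [lia|apply: leq_trans (ltn_expl _ (isT : 1 < 2)%N) _; rewrite leq_exp2l //; lia].
- move=> m3 a3; split.
  + by rewrite eval_var (agree_var a3) // /m2 var_upd.
  + exact: ok_var.
  + by rewrite eval_sub eval_mul eval_len !eval_const; lia.
  + by split; [split; [exact: (@small_le 2)|exact: ok_len]|exact: (@small_le 1)].
- move=> k hk; apply: (@small_pow2 _ (q * k)); first by apply: le_pow2X; exact: le_pow2_base.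
  apply: leq_ltn_trans (_ : q * (2 * l) < _)%N; first by rewrite leq_mul2l; lia.
  by rewrite mulnC; lia.
move=> m3 a3 v3.
have a3' : agree [:: vWt; vK; vQ; vP; vG] m m3.
  apply: agree_trans (agree_sub _ a3); first by apply: agree_upd.
  by move=> c; rewrite !inE => /orP[]->; rewrite ?orbT.
have e3 : eval inp m3 (Sub (Var vG) (Mul (Var vP) (Mul (Spin (Var vS) (Var vI)) (Spin (Var vS) (Var vJ))))) =
    g - base s i ^+ (2 * l).-1 * (xs s i * xs s j).
  have vg3 : var m3 vG = g by rewrite (agree_var a3) // /m2 var_upd /= (agree_var a1) // vg.
  rewrite eval_sub !eval_mul !eval_var v3 vg3 (eval_Spin (s := s) (i := i)) ?(eval_Spin (s := s) (i := j)) //.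
  - by rewrite eval_var (agree_var a3').
  - by rewrite eval_var (agree_var a3').
  - by rewrite eval_var (agree_var a3').
  - by rewrite eval_var (agree_var a3').
apply: wp_assign => //.
- split; first exact: ok_var.
  split; first exact: ok_var.
  by split; [apply: (@ok_sample _ _ _ s i)|apply: (@ok_sample _ _ _ s j)]; rewrite ?eval_var ?(agree_var a3') //; exact: ok_var.
- by rewrite e3.
- rewrite e3; apply: hQ; last by rewrite var_upd.
  by apply: agree_upd.
Qed.

Let grad := int_gradient n l xs mm D B.

Lemma le_pow2_partial i j k : (i < n)%N -> (j < n)%N -> (k <= l)%N ->
  le_pow2 (- (\sum_(s < k) base s i ^+ (2 * l).-1 * (xs s i * xs s j))) (l + 2 * l * q).
Proof.
move=> hi hj hk; apply: le_pow2N.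
apply: (@le_trans _ _ (\sum_(s < k) 2 ^+ (2 * l * q))).
  apply: le_trans (ler_norm_sum _ _ _) _; apply: ler_sum => s' _.
  have hs : (s' < l)%N by apply: leq_trans hk.
  rewrite normrM -[leRHS]mulr1; apply: ler_pM => //.
    apply: le_pow2W (le_pow2X _ (le_pow2_base hs hi)) _.
    by rewrite [(2 * l * q)%N]mulnC leq_mul2l; lia.
  by rewrite normrM -[leRHS]mulr1; apply: ler_pM => //; exact: xs_le.
rewrite sumr_const card_ord [leRHS]exprD -[leLHS]mulr_natl; apply: ler_wpM2r; first exact: exprn_ge0.
rewrite natz pow2Z lez_nat; apply: (leq_trans hk); exact: ltnW (ltn_expl _ _).
Qed.

Lemma le_pow2_grad i j : (i < n)%N -> (j < n)%N -> le_pow2 (grad i j) (9 * l + 6 + 2 * l * q).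
Proof.
move=> hi hj; rewrite /grad /int_gradient -/base.
have -> : (9 * l + 6 + 2 * l * q = (9 * l + 5 + 2 * l * q).+1)%N by lia.
apply: le_pow2D; first by apply: le_pow2W (le_pow2_partial hi hj (leqnn l)) _; lia.
have -> : (9 * l + 5 + 2 * l * q = 1 + 2 * l + 2 * l + (1 + l) + (4 * l + 3) + 2 * l * q)%N by lia.
have l2 : le_pow2 l%:Z l by apply: le_pow2_nat; exact: ltnW (ltn_expl _ _).
apply: le_pow2M; last first.
  apply: le_pow2W (le_pow2X _ le_pow2_scale) _; rewrite [(2 * l * q)%N]mulnC.
  by apply: leq_mul; rewrite /q; lia.
apply: le_pow2M; last by rewrite (_ : (4 * l + 3 = (4 * l + 2).+1)%N); [apply: le_pow2B; exact: le_pow2_entry|lia].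
apply: le_pow2M; last by apply: le_pow2_nat; rewrite expnD expn1 leq_mul2l ltnW // ltn_expl.
apply: le_pow2M; last exact: le_pow2_mm.
apply: le_pow2M; first exact: (@le_pow2_nat 2 1).
by rewrite [(2 * l)%N]mulnC; exact: le_pow2X.
Qed.

Lemma small_grad i j : (i < n)%N -> (j < n)%N -> small (grad i j).
Proof. by move=> hi hj; apply: small_pow2 (le_pow2_grad hi hj) _; lia. Qed.

Lemma wp_grad i j (Q : memory -> Prop) m :
  (i < n)%N -> (j < n)%N -> grad_inputs m ->
  var m vI = i%:Z -> var m vJ = j%:Z ->
  (forall m', agree [:: vWt; vK; vQ; vP; vG; vS] m m' -> var m' vG = grad i j -> Q m') ->
  wp grad_prog (l * (n * 4 + l * 8 + 14) + 7) Q m.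
Proof.
move=> hi hj g0 vi vj hQ.
have -> : (l * (n * 4 + l * 8 + 14) + 7 = (1 + ((l * (n * 4 + l * 8 + 11).+3).+3 + 1).+1).+1)%N.
  by rewrite (_ : (n * 4 + l * 8 + 11).+3 = n * 4 + l * 8 + 14)%N; lia.
apply: wp_seq; apply: wp_assign => //; try exact: (@small_le 0).
pose X := [:: vWt; vK; vQ; vP; vG; vS].
apply: wp_seq.
apply: (wp_for (cnt := l) (I := fun k m' => agree X m m' /\
   var m' vG = - (\sum_(s < k) base s i ^+ (2 * l).-1 * (xs s i * xs s j)))) => //.
- by move=> k m' _; split; [exact: eval_len|exact: ok_len].
- split; first by do 2![apply: agree_upd => //].
  by rewrite !var_upd /= big_ord0 oppr0.
- move=> k m' hk [a v] vk.
  have gc : grad_inputs m' by apply: grad_inputs_agree a _ g0.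
  have e : - (\sum_(s < k) base s i ^+ (2 * l).-1 * (xs s i * xs s j)) -
      base k i ^+ (2 * l).-1 * (xs k i * xs k j) =
      - (\sum_(s < k.+1) base s i ^+ (2 * l).-1 * (xs s i * xs s j)).
    by rewrite big_ord_recr /= opprD.
  apply: (wp_term hk hi hj gc vk _ _ v); rewrite ?(agree_var a) ?e //.
    by apply: small_pow2 (le_pow2_partial hi hj hk) _; lia.
  move=> m3 a3 v3; split; first by rewrite (agree_var a3).
  split; last by rewrite var_upd.
  apply: agree_upd => //; apply: agree_trans a _; apply: agree_sub a3 => c.
  by rewrite !inE => /orP[->|/orP[->|/orP[->|/orP[->|->]]]]; rewrite ?orbT.
move=> m' [a v] _.
have [gM gD gE gB] : grad_inputs m' by apply: grad_inputs_agree a _ g0.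
have vi' : eval inp m' (Var vI) = i%:Z by rewrite eval_var (agree_var a).
have vj' : eval inp m' (Var vJ) = j%:Z by rewrite eval_var (agree_var a).
match goal with |- wp (assign vG ?e) _ _ _ => have ee : eval inp m' e = grad i j end.
  rewrite eval_add !eval_mul eval_sub !eval_var (eval_Out vi' vj') (eval_Out vj' vi') !eval_const eval_len.
  rewrite v gM gE !gB // /grad /int_gradient -/base; congr (_ + _); rewrite PoszM; ring.
apply: wp_assign => //; rewrite ?ee.
- by do ?[exact: ok_len|exact: ok_var|apply: ok_Out|exact: (@small_le 2)|split].
- exact: small_grad.
- by apply: hQ; [apply: agree_upd|rewrite var_upd].
Qed.

(** The invariant of the search in row [i]: [bg] is a gradient entry off the diagonal,
or 0 if all entries met so far vanish. *)
Definition row_ok (i bj : nat) (bg : int) (k : nat) : Prop :=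
  [/\ (bj < n)%N, (bg != 0 -> bj != i /\ bg = grad i bj) &
    forall k', (k' < k)%N -> k' != i -> `|grad i k'| <= `|bg|].

Definition row_vars := [:: vBJ; vBG; vJ; vWt; vK; vQ; vP; vG; vS].

Lemma nat_small k : (k <= n)%N -> small k%:Z.
Proof. by move=> h; exact: leq_ltn_trans h n_lt. Qed.

Lemma wp_row i (Q : memory -> Prop) m : (i < n)%N -> grad_inputs m -> var m vI = i%:Z ->
  (forall m' bj bg, agree row_vars m m' -> var m' vBJ = bj%:Z -> var m' vBG = bg ->
     row_ok i bj bg n -> Q m') ->
  wp row_prog (n * (l * (n * 4 + l * 8 + 14) + 17) + 7) Q m.
Proof.
move=> hi g0 vi hQ; set Sg := (l * _ + _)%N.
have -> : (n * Sg + 7 = (1 + (1 + (n * (l * (n * 4 + l * 8 + 14) + 7 + 6).+1.+3).+3).+1).+1)%N.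
  by rewrite /Sg; lia.
apply: wp_seq; apply: wp_assign => //; try exact: (@small_le 0).
apply: wp_seq; apply: wp_assign => //; try exact: (@small_le 0).
apply: (wp_for (cnt := n) (I := fun k m' => agree row_vars m m' /\
   exists bj bg, [/\ var m' vBJ = bj%:Z, var m' vBG = bg & row_ok i bj bg k])) => //.
- by move=> k m' _; split; [exact: eval_dim|exact: ok_dim].
- split; first by do 3![apply: agree_upd => //].
  exists 0%N, 0; rewrite !var_upd /=; split=> //; split=> //.
- move=> j m' hj [a [bj [bg [vbj vbg [r1 r2 r3]]]]] vj.
  have gc : grad_inputs m' by apply: grad_inputs_agree a _ g0.
  have vi' : var m' vI = i%:Z by rewrite (agree_var a).
  have e0 : eval inp m' (Mul (Sub (Var vI) (Var vJ)) (Sub (Var vI) (Var vJ))) = (i%:Z - j%:Z) ^+ 2.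
    by rewrite eval_mul !eval_sub !eval_var vi' vj expr2.
  apply: wp_if => //.
  + by do ?[exact: ok_var|split].
  + rewrite e0 => ij.
    have {}ij : j != i by apply: contraTneq ij => ->; rewrite subrr.
    apply: (wp_weaken (S := (l * (n * 4 + l * 8 + 14) + 7 + 4).+1)); first lia.
    apply: wp_seq; apply: (wp_grad hi hj gc vi' vj) => m1 a1 vg1.
    have a1' : agree row_vars m m1.
      apply: agree_trans a _; apply: agree_sub a1 => c.
      by rewrite !inE => /orP[->|/orP[->|/orP[->|/orP[->|/orP[->|->]]]]]; rewrite ?orbT.
    have vj1 : var m1 vJ = j%:Z by rewrite (agree_var a1).
    have vbj1 : var m1 vBJ = bj%:Z by rewrite (agree_var a1).
    have vbg1 : var m1 vBG = bg by rewrite (agree_var a1).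
    have e1 : eval inp m1 (Sub (Mul (Var vG) (Var vG)) (Mul (Var vBG) (Var vBG))) = grad i j ^+ 2 - bg ^+ 2.
      by rewrite eval_sub !eval_mul !eval_var vg1 vbg1 !expr2.
    have sq (y z : int) : (y ^+ 2 <= z ^+ 2) = (`|y| <= `|z|).
      by rewrite -(real_normK (num_real y)) -(real_normK (num_real z)) ler_sqr ?nnegrE.
    apply: wp_if => //.
    * by do ?[exact: ok_var|split].
    * rewrite e1 subr_gt0 ltNge sq -ltNge => gt.
      apply: (wp_seq (S1 := 1) (S2 := 1)); apply: wp_assign => //; rewrite ?eval_var ?vg1; first exact: ok_var.
        exact: small_grad.
      apply: wp_assign => //; rewrite ?eval_var; first exact: ok_var.
        by rewrite var_upd /= vj1; apply: nat_small; exact: ltnW.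
      rewrite !var_upd /= vj1; split=> //; split; first by do 3![apply: agree_upd => //].
      exists j, (grad i j); rewrite ?var_upd /=; split=> //; split=> // k'.
      rewrite ltnS leq_eqVlt => /orP[/eqP->//|k'j] k'i.
      by apply: le_trans (r3 _ k'j k'i) _; exact: ltW.
    * rewrite e1 subr_le0 sq => le.
      apply: (wp_weaken (S := 1)) => //; apply: wp_skip.
      split=> //; split; first by apply: agree_upd.
      exists bj, bg; rewrite ?var_upd /=; split=> //; split=> // k'.
      rewrite ltnS leq_eqVlt => /orP[/eqP->//|k'j] k'i.
      exact: r3.
  + rewrite e0 => ij.
    have {}ij : i = j.
      move: ij; rewrite real_exprn_even_le0 ?num_real //= subr_eq0 => /eqP; lia.
    apply: (wp_weaken (S := 1)); first by lia.
    apply: wp_skip; split=> //; split; first by apply: agree_upd.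
    exists bj, bg; rewrite ?var_upd /=; split=> //; split=> // k'.
    rewrite ltnS leq_eqVlt => /orP[/eqP->|k'j] k'i; last exact: r3.
    by rewrite ij eqxx in k'i.
- by move=> m' [a [bj [bg [vbj vbg r]]]] _; apply: (hQ _ bj bg).
Qed.

(** Row [i] of a steepest direction has at most one nonzero entry; slot [2i] holds its
column and slot [2i+1] its value times the weight [t+2] of the step. *)
Definition slot_ok (i bj : nat) (v : int) : Prop :=
  exists sgn : int, [/\ v = t.+2%:Z * sgn, (bj < n)%N, (sgn != 0 -> bj != i), `|sgn| <= 1 &
    sgn * grad i bj <= 0 /\ forall k, (k < n)%N -> k != i -> sgn * grad i bj <= - `|grad i k|].

Definition kept := [:: vT; vPw; vM; vTau; vD; vE].
Definition keeps m m' := (forall c, c \in kept -> var m' c = var m c) /\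
  (forall i j, (i < n)%N -> (j < n)%N -> out m' i j = out m i j).

Lemma keeps_trans m m1 m2 : keeps m m1 -> keeps m1 m2 -> keeps m m2.
Proof.
move=> [h1 h2] [k1 k2]; split=> [c hc|i j hi hj]; first by rewrite k1 ?h1.
by rewrite k2 ?h2.
Qed.

Lemma keeps_upd m m' c v : c \notin kept -> keeps m m' -> keeps m (upd c v m').
Proof.
move=> hc [h1 h2]; split=> [c' hc'|i j hi hj]; last by rewrite out_upd // h2.
by rewrite var_upd; case: eqP hc' hc => [->->//|_ hc' _]; rewrite h1.
Qed.

Lemma keeps_agree X m m' : all (fun c => c \notin kept) X -> agree X m m' -> keeps m m'.
Proof.
move=> hX a; split=> [c hc|i j hi hj]; last exact: (agree_out a).
by apply: (agree_var a); apply/negP => /(allP hX); rewrite hc.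
Qed.

Lemma keeps_grad_inputs m m' : keeps m m' -> grad_inputs m -> grad_inputs m'.
Proof.
move=> [k1 k2] [h1 h2 h3 h4]; split; rewrite ?k1 //.
by move=> i j hi hj; rewrite k2 // h4.
Qed.

Lemma le_pow2_step : le_pow2 t.+2%:Z (2 * l + 2).
Proof.
apply: le_pow2_nat; have : (l * l <= 2 ^ (2 * l))%N.
  by rewrite mul2n -addnn expnD; apply: leq_mul; exact: ltnW (ltn_expl _ _).
rewrite expnD; have : (0 < 2 ^ (2 * l))%N by rewrite expn_gt0.
move: t_le; set a := (2 ^ (2 * l))%N; set b := (l * l)%N; lia.
Qed.

Lemma small_step : small t.+2%:Z.
Proof. by apply: small_pow2 le_pow2_step _; lia. Qed.

Lemma arr_store m a v k : arr (update m (n * n + 25 + a)%N v) k = if k == a then v else arr m k.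
Proof. by rewrite /arr /update eqn_add2l. Qed.

Lemma var_arr_store m a v c : (c < 24)%N -> var (update m (n * n + 25 + a)%N v) c = var m c.
Proof. by move=> hc; rewrite /var /update /addr; case: eqP => //; lia. Qed.

Lemma out_arr_store m a v i j : (i < n)%N -> (j < n)%N ->
  out (update m (n * n + 25 + a)%N v) i j = out m i j.
Proof.
by move=> hi hj; rewrite /out /update; case: eqP => // ?; have := index_lt hi hj; lia.
Qed.

Lemma keeps_arr_store m m' a v : keeps m m' -> keeps m (update m' (n * n + 25 + a)%N v).
Proof.
move=> [h1 h2]; split=> [c hc|i j hi hj]; last by rewrite out_arr_store // h2.
rewrite var_arr_store ?h1 //.
by move: hc; rewrite !inE => /orP[/eqP->|/orP[/eqP->|/orP[/eqP->|/orP[/eqP->|/orP[/eqP->|/eqP->]]]]].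
Qed.

Lemma wp_choose i (Q : memory -> Prop) m : (i < n)%N -> grad_inputs m -> var m vI = i%:Z -> var m vT = t%:Z ->
  (forall m' (bj : nat) v, keeps m m' -> var m' vI = i%:Z ->
     (forall k, k != (2 * i)%N -> k != (2 * i + 1)%N -> arr m' k = arr m k) ->
     arr m' (2 * i) = bj%:Z -> arr m' (2 * i + 1) = v -> slot_ok i bj v -> Q m') ->
  wp choose_prog (n * (l * (n * 4 + l * 8 + 14) + 17) + 13) Q m.
Proof.
move=> hi g0 vi vt hQ; set Sr := (n * _)%N.
have -> : (Sr + 13 = (Sr + 7 + (1 + 3).+1).+1)%N by lia.
apply: wp_seq; apply: (wp_row hi g0 vi) => m1 bj bg a1 vbj vbg r1.
have vi1 : var m1 vI = i%:Z by rewrite (agree_var a1).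
have vt1 : var m1 vT = t%:Z by rewrite (agree_var a1).
have [b1 b2 b3] := r1.
have k1 : keeps m m1 by apply: keeps_agree a1.
have ea1 m' : var m' vI = i%:Z -> eval inp m' (Mul (Const 2) (Var vI)) = (2 * i)%N%:Z.
  by move=> h; rewrite eval_mul eval_var h eval_const; lia.
have ea2 m' : var m' vI = i%:Z -> eval inp m' (Add (Mul (Const 2) (Var vI)) (Const 1)) = (2 * i + 1)%N%:Z.
  by move=> h; rewrite eval_add ea1 // eval_const; lia.
have aa1 m' : var m' vI = i%:Z ->
   `|eval inp m' (arr_addr (Mul (Const 2) (Var vI)))|%N = (n * n + 25 + 2 * i)%N.
  by move=> h; apply: eval_arr; exact: ea1.
have aa2 m' : var m' vI = i%:Z ->
   `|eval inp m' (arr_addr (Add (Mul (Const 2) (Var vI)) (Const 1)))|%N = (n * n + 25 + (2 * i + 1))%N.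
  by move=> h; apply: eval_arr; exact: ea2.
have ka2 m' : ok m' (arr_addr (Add (Mul (Const 2) (Var vI)) (Const 1))).
  by apply: ok_arr; split; [split; [exact: (@small_le 2)|exact: ok_var]|exact: (@small_le 1)].
apply: wp_seq; apply: wp_store => //.
- by apply: ok_arr; split; [exact: (@small_le 2)|exact: ok_var].
- exact: ok_var.
- by rewrite eval_var vbj; apply: nat_small; exact: ltnW.
rewrite eval_var vbj (aa1 m1 vi1); set m2 := update m1 _ _.
have vi2 : var m2 vI = i%:Z by rewrite var_arr_store.
have vt2 : var m2 vT = t%:Z by rewrite var_arr_store.
have vbg2 : eval inp m2 (Var vBG) = bg by rewrite eval_var var_arr_store.
have fin v : slot_ok i bj v -> Q (update m2 (n * n + 25 + (2 * i + 1))%N v).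
  move=> sv; apply: (hQ _ bj v) => //.
  - by do 2![apply: keeps_arr_store].
  - by rewrite var_arr_store.
  - move=> k ka kb; rewrite !arr_store (negbTE ka) (negbTE kb).
    exact: (@agree_arr row_vars m m1 k isT a1).
  - rewrite !arr_store eqxx; case: eqP => //; lia.
  - by rewrite !arr_store eqxx.
have kbg : ok m2 (Var vBG) by exact: ok_var.
have kt : ok m2 (Add (Var vT) (Const 2)) by split; [exact: ok_var|exact: (@small_le 2)].
have et : eval inp m2 (Add (Var vT) (Const 2)) = t.+2%:Z.
  by rewrite eval_add eval_var vt2 eval_const; lia.
apply: wp_if => //; rewrite vbg2 => hbg.
  apply: (wp_weaken (S := 1)) => //.
  apply: wp_store => //.
  - by split=> //; exact: (@small_le 0).
  - by rewrite eval_sub eval_const et sub0r /small abszN; exact: small_step.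
  rewrite (aa2 m2 vi2) eval_sub eval_const et sub0r; apply: fin.
  have [|ji gE] := b2 _; first by rewrite gt_eqF.
  exists (-1); split=> //; first by rewrite mulrN1.
  split; first by rewrite mulN1r -gE oppr_le0 ltW.
  by move=> k hk ki; rewrite mulN1r -gE lerN2 -[leRHS](gtr0_norm hbg); exact: b3.
apply: wp_if => //.
- by split=> //; exact: (@small_le 0).
- rewrite eval_sub eval_const vbg2 sub0r oppr_gt0 => lbg.
  apply: wp_store => //; rewrite ?et; first exact: small_step.
  rewrite (aa2 m2 vi2); apply: fin.
  have [|ji gE] := b2 _; first by rewrite lt_eqF.
  exists 1; split=> //; first by rewrite mulr1.
  split; first by rewrite mul1r -gE ltW.
  by move=> k hk ki; rewrite mul1r -gE lerNr -[leRHS](ltr0_norm lbg); exact: b3.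
- rewrite eval_sub eval_const vbg2 sub0r oppr_le0 => gbg.
  have z : bg = 0 by apply/eqP; rewrite eq_le hbg gbg.
  apply: wp_store => //; try exact: (@small_le 0).
  rewrite (aa2 m2 vi2) eval_const; apply: fin.
  exists 0; split=> //; rewrite ?mulr0 ?eqxx //; split=> //; first by rewrite mul0r.
  by move=> k hk ki; rewrite mul0r; have := b3 k hk ki; rewrite z normr0 oppr_ge0.
Qed.

End Gradient.

Lemma out_store m i j i' j' v : (j < n)%N -> (j' < n)%N ->
  out (update m (i * n + j).+1 v) i' j' = if (i' == i) && (j' == j) then v else out m i' j'.
Proof.
move=> hj hj'; rewrite /out /update eqSS; congr (if _ then _ else _).
apply/eqP/andP => [e|[/eqP-> /eqP->]//].
have := congr1 (fun k => k %/ n)%N e; have := congr1 (fun k => k %% n)%N e.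
by rewrite /= !modnMDl !divnMDl // !modn_small // !divn_small // !addn0 => -> ->.
Qed.

Lemma var_store m i j v c : (i < n)%N -> (j < n)%N -> var (update m (i * n + j).+1 v) c = var m c.
Proof.
move=> hi hj; have h := index_lt hi hj.
by rewrite /var /update /addr; case: eqP => //; lia.
Qed.

Lemma arr_out_store m i j v k : (i < n)%N -> (j < n)%N -> arr (update m (i * n + j).+1 v) k = arr m k.
Proof.
move=> hi hj; have h := index_lt hi hj.
by rewrite /arr /update; case: eqP => //; lia.
Qed.

Lemma wp_update (B : nat -> nat -> int) (bj : nat -> nat) (v : nat -> int) (Q : memory -> Prop) m :
  (forall i, (i < n)%N -> [/\ (bj i < n)%N, arr m (2 * i) = (bj i)%:Z, arr m (2 * i + 1) = v i &
     small (B i (bj i) + v i)]) ->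
  (forall i j, (i < n)%N -> (j < n)%N -> out m i j = B i j) ->
  (forall m', (forall c, c != vI -> var m' c = var m c) ->
    (forall i j, (i < n)%N -> (j < n)%N -> out m' i j = B i j + (if j == bj i then v i else 0)) -> Q m') ->
  wp (for_ vI dim_ update_prog) (n * 4 + 3) Q m.
Proof.
move=> hb hB hQ; rewrite addn3.
apply: (wp_for (cnt := n) (I := fun k m' => [/\ forall c, c != vI -> var m' c = var m c,
   forall i, (i < n)%N -> arr m' (2 * i) = (bj i)%:Z /\ arr m' (2 * i + 1) = v i &
   forall i j, (i < n)%N -> (j < n)%N ->
     out m' i j = B i j + (if (i < k)%N && (j == bj i) then v i else 0)])) => //.
- by move=> k m' _; split; [exact: eval_dim|exact: ok_dim].
- split.
  + by move=> c /negbTE hc; rewrite var_upd hc.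
  + by move=> i hi; rewrite !arr_upd //; have [_ -> -> _] := hb i hi.
  + by move=> i j hi hj; rewrite out_upd // hB // addr0.
- move=> i m' hi [h1 h2 h3] vi.
  have [bi _ _ sm] := hb i hi; have [a1 a2] := h2 i hi.
  have e1 : eval inp m' (Mul (Const 2) (Var vI)) = (2 * i)%N%:Z.
    by rewrite eval_mul eval_var vi eval_const; lia.
  have e2 : eval inp m' (Add (Mul (Const 2) (Var vI)) (Const 1)) = (2 * i + 1)%N%:Z.
    by rewrite eval_add e1 eval_const; lia.
  have e3 : eval inp m' (Arr (Mul (Const 2) (Var vI))) = (bj i)%:Z by rewrite (eval_Arr e1).
  have e4 : eval inp m' (Var vI) = i%:Z by rewrite eval_var.
  have k1 : ok m' (Arr (Mul (Const 2) (Var vI))).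
    by apply: ok_Arr; split; [exact: (@small_le 2)|exact: ok_var].
  have e5 : eval inp m' (Add (Out (Var vI) (Arr (Mul (Const 2) (Var vI))))
      (Arr (Add (Mul (Const 2) (Var vI)) (Const 1)))) = B i (bj i) + v i.
    by rewrite eval_add (eval_Out e4 e3) (eval_Arr e2) a2 h3 // ltnn addr0.
  apply: wp_store => //.
  + by apply: ok_out => //; exact: ok_var.
  + split; first by apply: ok_Out => //; exact: ok_var.
    by apply: ok_Arr; split; [split; [exact: (@small_le 2)|exact: ok_var]|exact: (@small_le 1)].
  + by rewrite e5.
  rewrite (eval_out e4 e3) e5; split; first by rewrite var_store.
  split.
  + by move=> c hc; rewrite var_upd (negbTE hc) var_store // h1.
  + by move=> i' hi'; rewrite !arr_upd // !arr_out_store //; exact: h2.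
  + move=> i' j hi' hj; rewrite out_upd // out_store // h3 // ltnS.
    have [->|ii] := eqVneq i' i; rewrite /= ?leqnn ?ltnn /=.
      by case: eqP => [->|]; rewrite ?addr0.
    by rewrite [(i' <= i)%N]leq_eqVlt (negbTE ii).
- move=> m' [h1 _ h3] _; apply: hQ => // i j hi hj.
  by rewrite h3 // hi.
Qed.

Lemma slots_steepest t B mm (bj : nat -> nat) (v : nat -> int) :
  (forall i, (i < n)%N -> slot_ok t B mm i (bj i) (v i)) ->
  exists V, steepest n (int_gradient n l xs mm (int_scale l t) B) V /\
    forall i j, (i < n)%N -> (if j == bj i then v i else 0) = t.+2%:Z * V i j.
Proof.
move=> h; pose V i j := if j == bj i then (v i %/ t.+2%:Z)%Z else 0.
have VE i : (i < n)%N -> exists sgn : int, [/\ v i = t.+2%:Z * sgn, (v i %/ t.+2%:Z)%Z = sgn & 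
   [/\ (bj i < n)%N, (sgn != 0 -> bj i != i), `|sgn| <= 1 &
    sgn * int_gradient n l xs mm (int_scale l t) B i (bj i) <= 0 /\
    forall k, (k < n)%N -> k != i -> sgn * int_gradient n l xs mm (int_scale l t) B i (bj i) <=
       - `|int_gradient n l xs mm (int_scale l t) B i k|]].
  move=> hi; have [sgn [e h1 h2 h3 h4]] := h i hi.
  by exists sgn; split; rewrite ?e ?mulKz.
exists V; split; last first.
  move=> i j hi; rewrite /V; case: eqP => _; last by rewrite mulr0.
  by have [sgn [e1 e2 _]] := VE i hi; rewrite e2.
move=> i hi; have [sgn [e1 e2 [h1 h2 h3 [h4 h5]]]] := VE i hi.
have sV (F : nat -> int -> int) : (forall j, F j 0 = 0) ->
    \sum_(j < n) F j (V i j) = F (bj i) sgn.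
  move=> F0; rewrite (bigD1 (Ordinal h1)) //= {1}/V eqxx e2 big1 ?addr0 // => j ji.
  by rewrite /V ifN ?F0 //; apply: contra ji => /eqP jE; apply/eqP/val_inj.
split.
- rewrite /V e2; have [->|/h2/negbTE] := eqVneq sgn 0; first by case: ifP.
  by rewrite eq_sym => ->.
- by rewrite (sV (fun _ z => `|z|)) // normr0.
- by rewrite (sV (fun j z => int_gradient n l xs mm (int_scale l t) B i j * z)) 1?mulrC // => j; rewrite mulr0.
- move=> k hk ki.
  rewrite (sV (fun j z => int_gradient n l xs mm (int_scale l t) B i j * z)); last by move=> j; rewrite mulr0.
  by rewrite mulrC; exact: h5.
Qed.

(** Step counts of one row search, one Frank-Wolfe step and, below, the whole program;
the numbers come from adding up the rules. *)
Definition choose_steps := (n * (l * (n * 4 + l * 8 + 14) + 17) + 13)%N.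
Definition step_steps := (l * 8 + n * (choose_steps + 3) + n * 4 + 20)%N.

Section Loop.
Variable mm : int.
Hypothesis mm_ge0 : 0 <= mm.
Hypothesis mm_le : mm <= l%:Z * 2 ^+ l.

Lemma wp_step t B (Q : memory -> Prop) m : (t < l * l)%N -> fw_run n l xs mm t B ->
  var m vT = t%:Z -> var m vPw = 2 ^+ l -> var m vM = mm -> var m vTau = (fw_weight t)%:Z ->
  (forall i j, (i < n)%N -> (j < n)%N -> out m i j = B t i j) ->
  (forall m' V, var m' vT = t%:Z -> var m' vPw = 2 ^+ l -> var m' vM = mm ->
     var m' vTau = (fw_weight t.+1)%:Z ->
     steepest n (int_gradient n l xs mm (int_scale l t) (B t)) V ->
     (forall i j, (i < n)%N -> (j < n)%N -> out m' i j = B t i j + t.+2%:Z * V i j) -> Q m') ->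
  wp step_prog step_steps Q m.
Proof.
move=> tl run vt vp vm vtau hB hQ.
have tl' := ltnW tl.
have B_le i j : (i < n)%N -> (j < n)%N -> `|B t i j| <= (fw_weight t)%:Z.
  by move=> hi hj; exact: (fw_entry run (leqnn t) hi hj).
apply: (wp_weaken (S := (1 + (((2 * l).-2 * 4 + 5) + ((n * choose_steps.+3).+3 + ((n * 4 + 3) + 1).+1).+1).+1).+1)); first by rewrite /step_steps; set cs := choose_steps; lia.
have eD : eval inp m (Mul (Mul (Mul (Const 2) len_) (Var vPw)) (Var vTau)) = int_scale l t.
  by rewrite !eval_mul !eval_var vp vtau eval_len eval_const /int_scale PoszM.
have sD : small (int_scale l t) by apply: (@small_pow2 _ (6 * l + 3)); [exact: (le_pow2_scale tl' mm_ge0 mm_le)|lia].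
apply: wp_seq; apply: wp_assign => //; rewrite ?eD //.
  by do ?[exact: ok_len|exact: ok_var|exact: (@small_le 2)|split].
set m1 := upd vD _ m.
apply: wp_seq; apply: (@wp_pow _ _ _ _ (int_scale l t) (2 * l).-2) => //.
- by apply: leq_ltn_trans (_ : 2 * l < _)%N; [lia|apply: leq_trans (ltn_expl _ (isT : 1 < 2)%N) _; rewrite leq_exp2l //; lia].
- move=> m' a; split.
  + by rewrite eval_var (agree_var a) // /m1 var_upd.
  + exact: ok_var.
  + by rewrite eval_sub eval_mul eval_len !eval_const; lia.
  + by split; [split; [exact: (@small_le 2)|exact: ok_len]|exact: (@small_le 2)].
- move=> j hj; apply: (@small_pow2 _ ((6 * l + 3) * j)); first by apply: le_pow2X; exact: (le_pow2_scale tl' mm_ge0 mm_le).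
  apply: leq_ltn_trans (_ : (6 * l + 3) * (2 * l) < _)%N; first by rewrite leq_mul2l; lia.
  apply: leq_trans W_ge; rewrite [((6 * l + 3) * _)%N]mulnC.
  have : ((2 * l) * (6 * l + 3) <= 2 * l * q)%N by rewrite leq_mul2l /q; lia.
  lia.
move=> m2 a2 vE2.
have v2 c : c \notin [:: vE; vK; vD] -> var m2 c = var m c.
  rewrite !inE => hc; rewrite (agree_var a2); last by rewrite !inE; apply: contra hc => /orP[]->; rewrite ?orbT.
  by rewrite /m1 var_upd; case: eqP => // cD; rewrite cD in hc.
have g2 : grad_inputs t (B t) mm m2.
  split; first by rewrite v2.
  - by rewrite (agree_var a2) // /m1 var_upd.
  - exact: vE2.
  - by move=> i j hi hj; rewrite (agree_out a2) // /m1 out_upd // hB.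
apply: wp_seq; apply: (wp_for (cnt := n) (I := fun k m' => keeps m2 m' /\ forall i, (i < k)%N ->
   exists (bj : nat) v, [/\ arr m' (2 * i) = bj%:Z, arr m' (2 * i + 1) = v & slot_ok t (B t) mm i bj v])) => //.
- by move=> k m' _; split; [exact: eval_dim|exact: ok_dim].
- by split; first by apply: keeps_upd.
- move=> i m' hi [k2 h] vi.
  apply: (wp_choose tl' B_le mm_ge0 mm_le hi (keeps_grad_inputs k2 g2) vi).
    by case: k2 => -> //; rewrite v2.
  move=> m3 bj v k3 vi3 arr3 s1 s2 s3; split=> //; split.
    by apply: keeps_upd => //; exact: keeps_trans k2 k3.
  move=> i'; rewrite ltnS leq_eqVlt => /orP[/eqP->|ii].
    by exists bj, v; rewrite !arr_upd.
  have [bj' [v' [r1 r2 r3]]] := h i' ii.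
  by exists bj', v'; rewrite !arr_upd // !arr3 //; lia.
move=> m3 [k3 h3] _.
pose bj i := `|arr m3 (2 * i)|%N; pose v i := arr m3 (2 * i + 1)%N.
have sl i : (i < n)%N -> arr m3 (2 * i) = (bj i)%:Z /\ slot_ok t (B t) mm i (bj i) (v i).
  move=> hi; have [b [w [r1 r2 r3]]] := h3 i hi.
  by rewrite /bj /v r1 r2 absz_nat.
have [V [Vs VE]] := slots_steepest (fun i hi => (sl i hi).2).
have [kv ko] := k3.
apply: wp_seq; apply: (@wp_update (B t) bj v) => //.
- move=> i hi; have [s1 s2] := sl i hi; have [spin_at [e h1 _ h4 _]] := s2; split=> //.
  apply: (@small_pow2 _ (4 * l + 3)); last lia.
  rewrite (_ : (4 * l + 3 = (4 * l + 2).+1)%N); last lia.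
  apply: le_pow2D; first exact: (le_pow2_entry tl' B_le).
  have tv : `|v i| <= t.+2%:Z.
    by rewrite e normrM -[leRHS]mulr1; apply: ler_wpM2l.
  apply: le_trans tv _; apply: le_trans (ler_norm _) _.
  by apply: le_pow2W (le_pow2_step tl' mm_ge0 mm_le) _; lia.
- by move=> i j hi hj; rewrite ko //; case: g2 => _ _ _ ->.
move=> m4 v4 o4.
have kk c : c \in kept -> c \notin [:: vE; vK; vD] -> var m4 c = var m c.
  move=> hc1 hc2; rewrite v4; last by apply: contraTneq hc1 => ->.
  by rewrite kv // v2.
have eT : eval inp m4 (Add (Var vTau) (Add (Var vT) (Const 2))) = (fw_weight t.+1)%:Z.
  by rewrite !eval_add !eval_var !kk // vtau vt eval_const /=; lia.
apply: wp_assign => //.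
- by split; [exact: ok_var|split; [exact: ok_var|exact: (@small_le 2)]].
- rewrite eT; apply: (@small_pow2 _ (4 * l + 2)); last lia.
  by apply: le_pow2_nat; exact: fw_weight_le.
rewrite eT; apply: (hQ _ V); rewrite ?var_upd ?kk //.
by move=> i j hi hj; rewrite out_upd // o4 // VE.
Qed.

Lemma wp_swap i j (Q : memory -> Prop) m : (i < n)%N -> (j < n)%N ->
  var m vI = i%:Z -> var m vJ = j%:Z -> var m vM = mm ->
  small (mm * out m i j) -> small (mm * out m j i) ->
  (forall m' r, r = mm * min_abs (out m i j) (out m j i) ->
     (forall c, var m' c = var m c) ->
     (forall a b, (a < n)%N -> (b < n)%N -> out m' a b =
        if ((a == j) && (b == i)) || ((a == i) && (b == j)) then r else out m a b) -> Q m') ->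
  wp (Seq (If (Sub (Mul (Out (Var vI) (Var vJ)) (Out (Var vI) (Var vJ)))
                    (Mul (Out (Var vJ) (Var vI)) (Out (Var vJ) (Var vI))))
            (Store (out_addr (Var vI) (Var vJ)) (Mul (Var vM) (Out (Var vJ) (Var vI))))
            (Store (out_addr (Var vI) (Var vJ)) (Mul (Var vM) (Out (Var vI) (Var vJ)))))
       (Store (out_addr (Var vJ) (Var vI)) (Out (Var vI) (Var vJ)))) 4 Q m.
Proof.
move=> hi hj vi vj vm s1 s2 hQ.
have e1 : eval inp m (Var vI) = i%:Z by rewrite eval_var.
have e2 : eval inp m (Var vJ) = j%:Z by rewrite eval_var.
have k1 m' : ok m' (Out (Var vI) (Var vJ)) by apply: ok_Out; exact: ok_var.
have k2 m' : ok m' (Out (Var vJ) (Var vI)) by apply: ok_Out; exact: ok_var.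
have a1 m' : ok m' (out_addr (Var vI) (Var vJ)) by apply: ok_out; exact: ok_var.
have a2 m' : ok m' (out_addr (Var vJ) (Var vI)) by apply: ok_out; exact: ok_var.
set r := mm * min_abs (out m i j) (out m j i).
have sr : small r by rewrite /r /min_abs; case: ifP.
have fin : wp (Store (out_addr (Var vJ) (Var vI)) (Out (Var vI) (Var vJ))) 1 Q
    (update m (i * n + j).+1 r).
  set m1 := update _ _ _.
  have e3 : eval inp m1 (Var vI) = i%:Z by rewrite eval_var var_store.
  have e4 : eval inp m1 (Var vJ) = j%:Z by rewrite eval_var var_store.
  have e5 : eval inp m1 (Out (Var vI) (Var vJ)) = r by rewrite (eval_Out e3 e4) out_store // !eqxx.
  apply: wp_store => //; rewrite e5 // (eval_out e4 e3).
  apply: (hQ (update m1 (j * n + i).+1 r) r erefl).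
    by move=> c; rewrite !var_store.
  move=> a b ha hb; rewrite !out_store //; case: (_ && _) => //=.
apply: (wp_seq (S1 := 2) (S2 := 1)); apply: wp_if => //.
- rewrite eval_sub !eval_mul (eval_Out e1 e2) (eval_Out e2 e1) -!expr2 subr_gt0 => lt.
  apply: wp_store => //; first by split=> //; exact: ok_var.
    by rewrite eval_mul eval_var vm (eval_Out e2 e1).
  rewrite eval_mul eval_var vm (eval_Out e2 e1) (eval_out e1 e2).
  by move: fin; rewrite /r /min_abs lt.
- rewrite eval_sub !eval_mul (eval_Out e1 e2) (eval_Out e2 e1) -!expr2 subr_le0 leNgt => /negbTE lt.
  apply: wp_store => //; first by split=> //; exact: ok_var.
    by rewrite eval_mul eval_var vm (eval_Out e1 e2).
  rewrite eval_mul eval_var vm (eval_Out e1 e2) (eval_out e1 e2).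
  by move: fin; rewrite /r /min_abs lt.
Qed.

Lemma symmetrized_lt B i j : (j < i)%N -> symmetrized B i j = min_abs (B i j) (B j i).
Proof. by rewrite /symmetrized => ->. Qed.

Lemma symmetrized_gt B i j : (i < j)%N -> symmetrized B i j = min_abs (B j i) (B i j).
Proof. by rewrite /symmetrized => h; rewrite h ltnNge ltnW. Qed.

(** After [k] rows, the block of the first [k] rows and columns is final and all other
entries are untouched. *)
Lemma wp_symm (B : nat -> nat -> int) (Q : memory -> Prop) m :
  (forall i j, (i < n)%N -> (j < n)%N -> out m i j = B i j) ->
  (forall i, (i < n)%N -> B i i = 0) ->
  (forall i j, (i < n)%N -> (j < n)%N -> small (mm * B i j)) ->
  var m vM = mm ->
  (forall m', (forall c, c != vI -> c != vJ -> var m' c = var m c) ->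
     (forall i j, (i < n)%N -> (j < n)%N -> out m' i j = mm * symmetrized B i j) -> Q m') ->
  wp symm_prog (n * (n * 7 + 6) + 3) Q m.
Proof.
move=> hB hd hs vm hQ.
have -> : (n * (n * 7 + 6) + 3 = (n * (n * 7 + 3).+3).+3)%N by rewrite !addnS !addn0.
apply: (wp_for (cnt := n) (I := fun k m' => (forall c, c != vI -> c != vJ -> var m' c = var m c) /\
   forall i j, (i < n)%N -> (j < n)%N ->
     out m' i j = if (i < k)%N && (j < k)%N then mm * symmetrized B i j else B i j)) => //.
- by move=> k m' _; split; [exact: eval_dim|exact: ok_dim].
- split; first by move=> c /negbTE hc _; rewrite var_upd hc.
  by move=> i j hi hj; rewrite out_upd // hB.
- move=> i m' hi [h1 h2] vi.
  apply: (wp_weaken (S := (i * 7).+3)).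
    by rewrite addn3 !ltnS leq_mul2r (ltnW hi) orbT.
  apply: (wp_for (cnt := i) (I := fun k m2 => [/\ forall c, c != vI -> c != vJ -> var m2 c = var m c,
     var m2 vI = i%:Z &
     forall a b, (a < n)%N -> (b < n)%N ->
     out m2 a b = if [|| (a < i) && (b < i), (a == i) && (b < k) | (b == i) && (a < k)]%N
                  then mm * symmetrized B a b else B a b])) => //.
  + by apply: ltn_trans hi n_lt.
  + by move=> k m2 [_ v _]; split; [rewrite eval_var|exact: ok_var].
  + split.
    * by move=> c c1 c2; rewrite var_upd (negbTE c2) h1.
    * by rewrite var_upd.
    * by move=> a b ha hb; rewrite out_upd // h2 // !andbF !orbF.
  + move=> j m2 ji [v1 v2 o2] vj.
    have hj : (j < n)%N := ltn_trans ji hi.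
    have oij : out m2 i j = B i j by rewrite o2 // !ltnn eqxx /= (ltn_eqF ji).
    have oji : out m2 j i = B j i by rewrite o2 // !ltnn eqxx /= ?andbF (ltn_eqF ji).
    have s1 : small (mm * out m2 i j) by rewrite oij; apply: hs.
    have s2 : small (mm * out m2 j i) by rewrite oji; apply: hs.
    have vm2 : var m2 vM = mm by rewrite v1.
    apply: (wp_swap hi hj v2 vj vm2 s1 s2); rewrite oij oji.
    move=> m3 r rE vv oo; split; first by rewrite vv.
    split.
    * by move=> c c1 c2; rewrite var_upd (negbTE c2) vv v1.
    * by rewrite var_upd /= vv.
    * move=> a b ha hb; rewrite out_upd // oo // o2 //.
      have [/andP[/eqP-> /eqP->]|n1] := boolP ((a == j) && (b == i)).
        by rewrite eqxx ltnSn /= !orbT symmetrized_gt // rE.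
      have [/andP[/eqP-> /eqP->]|n2] := boolP ((a == i) && (b == j)).
        by rewrite eqxx ltnSn /= orbT symmetrized_lt // rE.
      congr (if _ then _ else _); congr [|| _, _ | _].
        rewrite ltnS [(b <= j)%N]leq_eqVlt; case: eqP n2 => //= _; by case: eqP.
      rewrite ltnS [(a <= j)%N]leq_eqVlt; case: (b == i) n1 => //=; by rewrite andbT => /negbTE->.
  + move=> m2 [v1 v2 o2] vj; split=> //; split.
      by move=> c c1 c2; rewrite var_upd (negbTE c1) v1.
    move=> a b ha hb; rewrite out_upd // o2 // !ltnS.
    rewrite (leq_eqVlt a i) (leq_eqVlt b i).
    case: (eqVneq a i) => [->|ai]; case: (eqVneq b i) => [->|bi] //=; rewrite ?ltnn ?andbF ?andbT ?orbF //=.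
    by rewrite hd // /symmetrized ltnn mulr0.
- move=> m' [h1 h2] _; apply: hQ => // i j hi hj.
  by rewrite h2 // hi hj.
Qed.

Hypothesis inp3 : inp 3 l = mm.

Definition main_steps := (l * 4 + l * l * (step_steps + 3) + n * (n * 7 + 6) + 30)%N.

Lemma small_scaled B i j t : (t <= l * l)%N -> fw_run n l xs mm (l * l) B ->
  (i < n)%N -> (j < n)%N -> small (mm * B t i j).
Proof.
move=> tl run hi hj; apply: (@small_pow2 _ (2 * l + (4 * l + 2))); last lia.
apply: le_pow2M; first exact: le_pow2_mm.
apply: le_trans (fw_entry run tl hi hj) _.
by rewrite pow2Z lez_nat; exact: fw_weight_le.
Qed.

Lemma wp_main (Q : memory -> Prop) m : (forall i j, (i < n)%N -> (j < n)%N -> out m i j = 0) ->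
  (forall m' B, fw_run n l xs mm (l * l) B -> m' 0%N = 2 ^+ l * (fw_weight (l * l))%:Z ->
     (forall i j, (i < n)%N -> (j < n)%N -> out m' i j = mm * symmetrized (B (l * l)%N) i j) -> Q m') ->
  wp main_prog main_steps Q m.
Proof.
move=> h0 hQ.
apply: (wp_weaken (S := ((l * 4 + 5) + (1 + (1 + ((l * l * step_steps.+3).+3 +
    ((n * (n * 7 + 6) + 3) + 1).+1).+1).+1).+1).+1)).
  by rewrite /main_steps; set ss := step_steps; lia.
apply: wp_seq; apply: (@wp_pow _ _ _ _ 2 l) => //.
- by move=> m' a; split; [|exact: (@small_le 2)|exact: eval_len|exact: ok_len].
- by move=> j jl; apply: (@small_pow2 _ j); [rewrite /le_pow2 ger0_norm // exprn_ge0|lia].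
move=> m1 a1 v1.
have e3 m' : eval inp m' (Input 3 len_) = mm by rewrite [LHS]/= inp1 absz_nat inp3.
have smm : small mm by apply: (@small_pow2 _ (2 * l)); [exact: le_pow2_mm|lia].
apply: wp_seq; apply: wp_assign => //.
- split; first exact: ok_len.
  + by rewrite eval_len absz_nat; apply: leq_trans P_ge; exact: leq_addl.
  + by rewrite eval_len absz_nat inp3.
- by rewrite e3.
rewrite e3; set m2 := upd vM mm m1.
apply: wp_seq; apply: wp_assign => //; try exact: (@small_le 1).
set m3 := upd vTau _ m2.
have o3 i j : (i < n)%N -> (j < n)%N -> out m3 i j = 0.
  by move=> hi hj; rewrite /m3 /m2 !out_upd // (agree_out a1) // h0.
have ll_lt : (l * l < 2 ^ W)%N.
  apply: leq_ltn_trans (_ : 2 ^ (2 * l) < _)%N; last by rewrite ltn_exp2l //; lia.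
  by rewrite mul2n -addnn expnD; apply: leq_mul; exact: ltnW (ltn_expl _ _).
apply: wp_seq; apply: (wp_for (cnt := (l * l)%N) (I := fun k m' => exists B, [/\ fw_run n l xs mm k B,
   (forall i j, (i < n)%N -> (j < n)%N -> out m' i j = B k i j),
   var m' vPw = 2 ^+ l, var m' vM = mm & var m' vTau = (fw_weight k)%:Z])) => //.
- move=> k m' _; split; first by rewrite eval_mul eval_len.
  by split; exact: ok_len.
- exists (fun _ _ _ => 0); split=> //.
  + by move=> i j hi hj; rewrite out_upd // o3.
  + by rewrite var_upd /= /m3 /m2 !var_upd /= v1.
  + by rewrite var_upd /= /m3 /m2 !var_upd.
  + by rewrite var_upd /= /m3 !var_upd.
- move=> t m' tl [B [run hB vp vm vtau]] vt.
  apply: (wp_step tl run vt vp vm vtau hB) => m4 V vt4 vp4 vm4 vtau4 Vs VE.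
  split=> //; exists (fun k => if (k <= t)%N then B k else fun i j => B t i j + t.+2%:Z * V i j).
  rewrite !var_upd; split=> //.
  + exact: (fw_run_snoc run Vs).
  + by move=> i j hi hj; rewrite out_upd // VE // ltnn.
move=> m4 [B [run hB vp vm vtau]] _.
apply: wp_seq; apply: (@wp_symm (B (l * l)%N)) => //.
- by move=> i hi; exact: (fw_diag run (leqnn _) hi).
- by move=> i j hi hj; apply: small_scaled run hi hj.
move=> m5 v5 o5.
have e5 : eval inp m5 (Mul (Var vPw) (Var vTau)) = 2 ^+ l * (fw_weight (l * l))%:Z.
  by rewrite eval_mul !eval_var !v5 // vp vtau.
apply: wp_store => //; first exact: (@small_le 0).
- by split; exact: ok_var.
- rewrite e5; apply: (@small_pow2 _ (l + (4 * l + 2))); last lia.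
  apply: le_pow2M; first by rewrite /le_pow2 ger0_norm // exprn_ge0.
  by apply: le_pow2_nat; exact: fw_weight_le.
by rewrite e5; apply: (hQ _ B).
Qed.

End Loop.

End Semantics.

(** * Polynomial running time *)

Section PolynomialTime.

(** Constants are absorbed by powers of [z >= 4]; [p k] stands for [z ^ k]. *)
Lemma total_steps_aux (n l b z W : nat) (p : nat -> nat) : (0 < n)%N -> (0 < l)%N ->
  (n + l + b <= z)%N -> W = (2 * l * (n + 6 * l + 4) + 9 * l + n + 50 + b)%N ->
  p 0%N = 1%N -> p 1%N = z -> (forall k, (4 * p k <= p k.+1)%N) ->
  (forall k k' a c, (a <= p k -> c <= p k' -> a * c <= p (k + k'))%N) ->
  ((main_steps n l).+1 * unit_cost W (n * l + l) <= p 33)%N.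
Proof.
move=> n0 l0 nlz WE p0 p1 S4 M.
have nz : (n <= p 1)%N by rewrite p1; lia.
have lz : (l <= p 1)%N by rewrite p1; lia.
have bz : (b <= p 1)%N by rewrite p1; lia.
have s1 := S4 1%N; have s2 := S4 2%N; have s3 := S4 3%N; have s4 := S4 4%N; have s5 := S4 5%N.
have s6 := S4 6%N; have s7 := S4 7%N; have s8 := S4 8%N; have s9 := S4 9%N; have s10 := S4 10%N.
have s11 := S4 11%N; have s12 := S4 12%N; have s13 := S4 13%N; have s14 := S4 14%N.
have s15 := S4 15%N; have s16 := S4 16%N; have s17 := S4 17%N; have s0 := S4 0%N.
rewrite p0 in s0.
have q3 : (n + 6 * l + 4 <= p 4)%N by lia.
have w1 : (2 * l * (n + 6 * l + 4) <= p 6)%N.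
  by apply: (M 2%N 4%N _ _ _ q3); lia.
have w2 : (W <= p 7)%N by rewrite WE; lia.
have nl2 : (n * l <= p 2)%N := M 1%N 1%N _ _ nz lz.
have u1 : (unit_cost W (n * l + l) <= p 16)%N.
  have h : (128 * W + (n * l + l) <= p 11)%N by lia.
  have h2 : (256 * (128 * W + (n * l + l)) <= p 15)%N by apply: (M 4%N 11%N _ _ _ h); lia.
  by rewrite /unit_cost; lia.
have c1 : (l * (n * 4 + l * 8 + 14) <= p 5)%N by apply: (M 1%N 4%N _ _ lz); lia.
have c2 : (choose_steps n l <= p 8)%N.
  have h : (n * (l * (n * 4 + l * 8 + 14) + 17) <= p 7)%N by apply: (M 1%N 6%N _ _ nz); lia.
  by rewrite /choose_steps; lia.
have c3 : (step_steps n l <= p 11)%N.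
  have h : (n * (choose_steps n l + 3) <= p 10)%N by apply: (M 1%N 9%N _ _ nz); lia.
  by rewrite /step_steps; lia.
have c4 : ((main_steps n l).+1 <= p 17)%N.
  have h : (l * l * (step_steps n l + 3) <= p 14)%N.
    by apply: (M 2%N 12%N); [exact: (M 1%N 1%N _ _ lz lz)|lia].
  have h2 : (n * (n * 7 + 6) <= p 4)%N by apply: (M 1%N 3%N _ _ nz); lia.
  by rewrite /main_steps; lia.
exact: (M _ _ _ _ c4 u1).
Qed.

Lemma total_steps_le (n l b z W : nat) : (0 < n)%N -> (0 < l)%N -> (4 <= z)%N -> (n + l + b <= z)%N ->
  W = (2 * l * (n + 6 * l + 4) + 9 * l + n + 50 + b)%N ->
  ((main_steps n l).+1 * unit_cost W (n * l + l) <= z ^ 40)%N.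
Proof.
move=> n0 l0 z4 nlz WE.
suff [p [p0 p1 pS pM pE]] : exists p : nat -> nat, [/\ p 0%N = 1%N, p 1%N = z,
    forall k, (4 * p k <= p k.+1)%N,
    forall k k' a c, (a <= p k -> c <= p k' -> a * c <= p (k + k'))%N & (p 33 <= z ^ 40)%N].
  apply: leq_trans pE; exact: (total_steps_aux n0 l0 nlz WE p0 p1 pS pM).
exists (expn z); split; first exact: expn0.
- exact: expn1.
- by move=> k; rewrite expnS leq_mul2r z4 orbT.
- by move=> k k' a c h1 h2; rewrite expnD; exact: leq_mul.
- by rewrite leq_pexp2l //; lia.
Qed.

End PolynomialTime.

(** * Execution on the learning input *)

Section Execution.
Variables (R : realType) (M delta : R) (n l : nat) (X : samples n l).
Hypothesis M_gt0 : 0 < M.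
Hypothesis n_gt0 : (0 < n)%N.
Hypothesis l_gt0 : (0 < l)%N.

Let inp := learning_input M delta X.
Let b := bitlen (Num.floor M).
Let W := (2 * l * (n + 6 * l + 4) + 9 * l + n + 50 + b)%N.
Let P := (n * l + l)%N.
Let xs (s i : nat) := inp 2 (s * n + i)%N.

Lemma input_spin (s : 'I_l) (i : 'I_n) : xs s i = spin int (X s i).
Proof.
rewrite /xs /inp /= divnMDl // modnMDl divn_small // modn_small // addn0.
by rewrite !insubT //= => h1 h2; congr (spin _ (X _ _)); apply: val_inj.
Qed.

Lemma input_spin_le s i : (s < l)%N -> (i < n)%N -> `|xs s i| <= 1.
Proof.
move=> hs hi; have := input_spin (Ordinal hs) (Ordinal hi); rewrite /= => ->.
by rewrite /spin; case: (X _ _).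
Qed.

Lemma floor_scaled : Num.floor M < l%:Z -> 0 <= Num.floor (2 ^+ l * M) <= l%:Z * 2 ^+ l.
Proof.
move=> hM; apply/andP; split.
  by rewrite floor_ge0 mulr_ge0 ?exprn_ge0 // ltW.
rewrite -(ler_int R); apply: le_trans (floor_le _) _.
rewrite rmorphM rmorphXn /= mulrC; apply: ler_wpM2r; first exact: exprn_ge0.
have /andP[_ h] := floor_itv M; apply: le_trans (ltW h) _.
by rewrite ler_int lezD1.
Qed.

Lemma learner_exec : exists m t,
  [/\ exec inp learner (fun=> 0) m t, (t <= (main_steps n l).+1 * unit_cost W P)%N &
    if Num.floor M < l%:Z then
      exists2 B, fw_run n l xs (Num.floor (2 ^+ l * M)) (l * l) B &
        output_matrix R n m = rounded n l B ((Num.floor (2 ^+ l * M))%:~R / 2 ^+ l)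
    else output_matrix R n m = 0].
Proof.
have i0 k : inp 0 k = n%:Z by [].
have i1 k : inp 1 k = l%:Z by [].
have Wge : (2 * l * (n + 6 * l + 4) + 9 * l + n + 50 <= W)%N by exact: leq_addr.
have W5 : (5 < W)%N by rewrite /W; lia.
have nW : (n < 2 ^ W)%N.
  by apply: leq_trans (ltn_expl n (isT : 1 < 2)%N) _; rewrite leq_exp2l // /W; lia.
have lW : (l < 2 ^ W)%N.
  by apply: leq_trans (ltn_expl l (isT : 1 < 2)%N) _; rewrite leq_exp2l // /W; lia.
have fE : Num.floor (2 ^+ 0 * M) = Num.floor M by rewrite expr0 mul1r.
have b0 : bounded W (fun=> 0) by move=> a; exact: (@small_le _ W5 0).
have okM : ok inp W P (fun=> 0) (Input 3 (Const 0)).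
  split=> //=; first exact: (@small_le _ W5 0).
  rewrite mul1r /small; apply: leq_trans (trunc_log_ltn _ (isT : 1 < 2)%N) _.
  by rewrite leq_exp2l //; exact: leq_addl.
have evM : Defs.eval inp (fun=> 0) (Sub len_ (Input 3 (Const 0))) = l%:Z - Num.floor M.
  by rewrite /= mul1r.
pose post m := if Num.floor M < l%:Z then
      exists2 B, fw_run n l xs (Num.floor (2 ^+ l * M)) (l * l) B &
        output_matrix R n m = rounded n l B ((Num.floor (2 ^+ l * M))%:~R / 2 ^+ l)
    else output_matrix R n m = 0.
suff : wp inp W P learner (main_steps n l).+1 post (fun=> 0).
  by move=> /(_ b0)[m [t [h1 h2 _ h3]]]; exists m, t; split.
apply: (wp_if nW lW W5) => //.
- by split=> //; exact: (ok_len P i1 lW W5).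
- rewrite evM subr_gt0 => hM; have /andP[m0 m1] := floor_scaled hM.
  apply: (@wp_main inp n l W P i0 i1 nW lW W5 Wge (leqnn _) n_gt0 l_gt0 input_spin_le
    (Num.floor (2 ^+ l * M)) m0 m1) => // m B run mz mo.
  rewrite /post hM; exists B => //; apply/matrixP => i j; rewrite !mxE.
  rewrite -[m (i * n + j).+1]/(out n m i j) mo // mz !rmorphM rmorphXn /=.
  set w : R := (fw_weight _)%:~R.
  have w0 : w != 0 by rewrite /w intr_eq0 eqz_nat -lt0n fw_weight_gt0.
  have p0 : 2 ^+ l != 0 :> R by rewrite expf_neq0.
  rewrite -[(fw_weight (l * l))%:R]/w; field; rewrite ?p0 ?w0 //.
- rewrite evM subr_le0 leNgt => /negbTE hM.
  apply: (wp_weaken (S := 1)); first by rewrite /main_steps; lia.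
  apply: wp_skip; rewrite /post hM; apply/matrixP => i j; rewrite !mxE.
  by rewrite mul0r.
Qed.

End Execution.

(** * The rate *)

Section Assembly.
Variable R : realType.
Implicit Types (M delta : R) (n l : nat).

Definition rate_constant M : R := 30 * 1000 * expR (12 * M).

Lemma rate_constantE M : rate_constant M = 30 * 1000 * expR M ^+ 12.
Proof. by rewrite /rate_constant expRM_natl. Qed.

Lemma rate_constant_ge0 M : 0 <= rate_constant M.
Proof. by apply: mulr_ge0; [apply: mulr_ge0; exact: ler0n|exact: expR_ge0]. Qed.

Lemma ln2_ge : 2^-1 <= ln 2 :> R.
Proof.
have h : expR (2^-1) <= 2 :> R.
  have := expR_ge1Dx (- 2^-1 : R); rewrite expRN => h.
  have e0 := expR_gt0 (2^-1 : R).
  have := ler_wpM2l (ltW e0) h; rewrite mulfV ?gt_eqF //; lra.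
by rewrite -(expRK (2^-1 : R)) ler_ln // posrE ?expR_gt0.
Qed.

(** [2 w + 1 <= 8 l^4 <= (n l)^7] as [n >= 2]. *)
Lemma ln_outputs_le n l : (0 < l)%N -> (2 <= n)%N ->
  ln (2 * fw_weight (l * l) + 1)%N%:R <= 7 * ln (n * l)%N%:R :> R.
Proof.
move=> l0 n2.
have nl0 : (0 < n * l)%N by rewrite muln_gt0 l0 andbT; lia.
rewrite [7 * _]mulr_natl -lnXn ?ltr0n // ler_ln ?posrE ?exprn_gt0 ?ltr0n ?addn1 //.
rewrite -natrX ler_nat.
have w := fw_weightE (l * l).
have h1 : ((l * l).+1 * (l * l).+2 <= (2 * (l * l)) * (3 * (l * l)))%N.
  by apply: leq_mul; have : (0 < l * l)%N by [rewrite muln_gt0 l0]; lia.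
have l1 : (0 < (l * l) * (l * l))%N by rewrite !muln_gt0 l0.
have h2 : ((2 * fw_weight (l * l)).+1 <= 8 * ((l * l) * (l * l)))%N.
  move: w h1 l1; set a := ((l * l) * (l * l))%N.
  rewrite (_ : (2 * (l * l) * (3 * (l * l)) = 6 * a)%N); last by rewrite /a; lia.
  lia.
apply: (leq_trans h2).
have -> : ((n * l) ^ 7 = n ^ 7 * l ^ 7)%N by rewrite expnMn.
apply: leq_mul.
  by apply: (@leq_trans (2 ^ 7)%N) => //; rewrite leq_exp2r.
have -> : (l * l * (l * l) = l ^ 4)%N by rewrite !expnS expn0; lia.
by rewrite leq_pexp2l.
Qed.

Lemma frobenius_trivial n M (J : 'M[R]_n) : 0 < M -> in_class M J ->
  frobenius_norm (0 - J) <= Num.sqrt (n%:R * M ^+ 2).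
Proof.
move=> M0 [_ /(infty_normP _ (ltW M0)) h]; rewrite /frobenius_norm; apply: ler_wsqrtr.
apply: (@le_trans _ _ (\sum_(i < n) M ^+ 2)); last by rewrite sumr_const card_ord mulr_natl.
apply: ler_sum => i _; apply: (@le_trans _ _ (\sum_j M * `|J i j|)).
  apply: ler_sum => j _; rewrite !mxE sub0r sqrrN -real_normK ?num_real // expr2.
  by apply: ler_wpM2r => //; exact: norm_entry (h i).
by rewrite -mulr_sumr expr2; apply: ler_wpM2l => //; exact: ltW.
Qed.

Lemma frobenius_dim1 n (A J : 'M[R]_n) M : n = 1%N -> in_class M A -> in_class M J ->
  frobenius_norm (A - J) = 0.
Proof.
move=> n1; move: A J; rewrite n1 => A J.
move=> [[_ dA] _] [[_ dJ] _]; rewrite /frobenius_norm !big_ord1 !mxE.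
by rewrite dA dJ subrr expr0n sqrtr0.
Qed.

Lemma zero_class n M : 0 < M -> in_class M (0 : 'M[R]_n).
Proof.
move=> M0; split; first by split=> [|i]; [rewrite trmx0|rewrite mxE].
apply/(infty_normP _ (ltW M0)) => i; rewrite big1 ?ltW // => j _.
by rewrite mxE normr0.
Qed.

Section Regimes.
Variables (M delta : R) (n l : nat).
Hypothesis M_gt0 : 0 < M.
Hypothesis delta_gt0 : 0 < delta.
Hypothesis delta_lt1 : delta < 1.
Hypothesis n_gt0 : (1 <= n)%N.
Hypothesis l_gt0 : (1 <= l)%N.

Let rate : R := rate_constant M *
  Num.sqrt ((n%:R ^+ 2 * ln (n * l)%:R + ln (1 / delta)) / l%:R).
Let E := expR M.

Let Ld : 0 <= ln (1 / delta).
Proof. by rewrite ln_ge0 // ler_pdivlMr // mul1r ltW. Qed.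
Let Lnl : 0 <= ln (n * l)%:R :> R.
Proof. by rewrite ln_ge0 // natrM -[leLHS]mulr1; apply: ler_pM; rewrite ?ler1n. Qed.
Let E_gt0 : 0 < E. Proof. exact: expR_gt0. Qed.
Let E_ge1 : 1 <= E. Proof. by have := expR_ge1Dx M; have := M_gt0; rewrite -/E; lra. Qed.
Let ME : M <= E. Proof. by have := expR_ge1Dx M; rewrite -/E; lra. Qed.
Let l0 : 0 < l%:R :> R. Proof. by rewrite ltr0n. Qed.

Lemma rate_ge0 : 0 <= rate.
Proof. by apply: mulr_ge0; [exact: rate_constant_ge0|exact: sqrtr_ge0]. Qed.

Lemma rate_sqr : rate = Num.sqrt
  (rate_constant M ^+ 2 * ((n%:R ^+ 2 * ln (n * l)%:R + ln (1 / delta)) / l%:R)).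
Proof.
rewrite sqrtrM ?sqr_ge0 // sqrtr_sqr ger0_norm //.
exact: rate_constant_ge0.
Qed.

Lemma ln_dim : (2 <= n)%N -> 2^-1 <= ln (n * l)%:R :> R.
Proof.
move=> n2; apply: le_trans ln2_ge _; rewrite ler_ln ?posrE ?natrM ?mulr_gt0 ?ltr0n //.
rewrite -[leLHS]mulr1; apply: ler_pM; rewrite ?ler1n //.
by rewrite (ler_nat R 2).
Qed.

Lemma certain_bound (Jhat : samples n l -> 'M[R]_n) (J : 'M[R]_n) :
  (forall X, frobenius_norm (Jhat X - J) <= rate) ->
  1 - delta <= iid_prob J [pred X : samples n l | frobenius_norm (Jhat X - J) <= rate].
Proof.
move=> h; rewrite /iid_prob (eq_bigl predT) ?sum_prod_pmf; last by move=> X; rewrite /= h.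
by rewrite gerBl ltW.
Qed.

(** Here [e^M >= l], so that the constant outweighs the loss of the trivial estimate
[|J|_F^2 <= n M^2]. *)
Lemma large_norm_regime (J : 'M[R]_n) : in_class M J -> l%:R <= M ->
  frobenius_norm (0 - J) <= rate.
Proof.
move=> hJ lM; have [n1|n2] := leqP n 1.
  have n1' : n = 1%N by apply/eqP; rewrite eqn_leq n1 n_gt0.
  by rewrite (frobenius_dim1 n1' (zero_class n M_gt0) hJ) rate_ge0.
apply: le_trans (frobenius_trivial M_gt0 hJ) _; rewrite rate_sqr; apply: ler_wsqrtr.
rewrite mulrA ler_pdivlMr //.
have h1 : n%:R * M ^+ 2 * l%:R <= n%:R * E ^+ 3.
  rewrite -mulrA; apply: ler_wpM2l => //; rewrite (exprSr E 2); apply: ler_pM => //.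
  - exact: sqr_ge0.
  - by rewrite ler_sqr ?nnegrE // ltW.
  - exact: le_trans lM ME.
apply: le_trans h1 _; rewrite rate_constantE -/E.
have h2 : n%:R <= n%:R ^+ 2 * (2 * ln (n * l)%:R) :> R.
  rewrite expr2 -mulrA -[leLHS]mulr1; apply: ler_wpM2l => //.
  rewrite -[leLHS]mul1r; apply: ler_pM; rewrite ?ler1n //.
  by have := ln_dim n2; lra.
have h3 : E ^+ 3 <= (E ^+ 12) ^+ 2 by rewrite -exprM ler_weXn2l.
have h4 : 0 <= n%:R ^+ 2 * ln (n * l)%:R :> R by rewrite mulr_ge0 // sqr_ge0.
have h5 : 0 <= (E ^+ 12) ^+ 2 by exact: sqr_ge0.
have h6 : n%:R * E ^+ 3 <= n%:R ^+ 2 * (2 * ln (n * l)%:R) * (E ^+ 12) ^+ 2.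
  by apply: ler_pM => //; rewrite exprn_ge0 // ltW.
have h7 : (E ^+ 12) ^+ 2 * (n%:R ^+ 2 * ln (n * l)%:R) <=
   (E ^+ 12) ^+ 2 * (n%:R ^+ 2 * ln (n * l)%:R + ln (1 / delta)).
  by apply: ler_wpM2l => //; rewrite lerDl.
have h8 := mulr_ge0 h5 h4.
apply: le_trans h6 _; move: h7 h8.
set u := (E ^+ 12) ^+ 2; set L := ln _; set D := ln _; set N := n%:R ^+ 2 => h7 h8.
have -> : (30 * 1000 * E ^+ 12) ^+ 2 = (30 * 1000) ^+ 2 * u by rewrite exprMn.
have -> : N * (2 * L) * u = 2 * (u * (N * L)) by ring.
apply: le_trans (ler_wpM2l (ler0n _ 2) h7) _; rewrite -[leRHS]mulrA.
apply: ler_wpM2r; first exact: le_trans h8 h7.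
by rewrite expr2; lra.
Qed.

Let m := Num.floor (2 ^+ l * M).
Let Mp : R := m%:~R / 2 ^+ l.

Lemma truncation : [/\ 0 <= Mp, Mp <= M & M - Mp <= l%:R^-1].
Proof.
have p0 : 0 < 2 ^+ l :> R by rewrite exprn_gt0.
have /andP[f1 f2] := floor_itv (2 ^+ l * M); rewrite -/m in f1 f2.
split.
- by rewrite divr_ge0 ?(ltW p0) // ler0z floor_ge0 mulr_ge0 ?ltW.
- by rewrite ler_pdivrMr // mulrC.
- apply: (@le_trans _ _ (2 ^+ l)^-1).
    rewrite lerBlDr -(ler_pM2r p0) mulrDl /Mp mulVf ?gt_eqF // divfK ?gt_eqF //.
    by move: f2; rewrite rmorphD /= mulrC addrC => /ltW.
  rewrite lef_pV2 ?posrE // -natrX ler_nat ltnW //; exact: ltn_expl.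
Qed.

(** Numerators shifted by the denominator to become natural numbers. *)
Definition output_code := {ffun 'I_n * 'I_n -> 'I_(2 * fw_weight (l * l) + 1)}.
Definition decode (c : output_code) : 'M[R]_n :=
  \matrix_(i, j) (Mp * ((c (i, j) : nat)%:Z - (fw_weight (l * l))%:Z)%:~R / (fw_weight (l * l))%:R).

Lemma rounded_code xs B : fw_run n l xs m (l * l) B -> exists c, rounded n l B Mp = decode c.
Proof.
move=> run; set w := fw_weight (l * l).
pose S i j := symmetrized (B (l * l)%N) i j.
have Sle (i j : 'I_n) : `|S i j| <= w%:Z.
  apply: le_trans (symmetrized_le _ _ _) _.
  exact: (fw_entry run (leqnn _) (ltn_ord i) (ltn_ord j)).
have lt (p : ('I_n * 'I_n)%type) : (absz (S p.1 p.2 + w%:Z)%R < 2 * w + 1)%N.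
  by have := Sle p.1 p.2; clear; lia.
exists [ffun p => Ordinal (lt p)]; apply/matrixP => i j; rewrite !mxE ffunE /=.
congr (_ * _%:~R / _); have := Sle i j; rewrite -/(S i j); clear; lia.
Qed.

Lemma card_output_code : #|{: output_code}| = ((2 * fw_weight (l * l) + 1) ^ (n * n))%N.
Proof. by rewrite card_ffun card_ord card_prod card_ord. Qed.

(** The union bound leaves [exp((7 + 2) n^2 log(n l) - (90/8) (n^2 log(n l) +
log(1/delta)))]: 7 from the number of outputs, 2 from the optimisation error, and
90/8 from the constant of the rate.  For [n = 1] there is nothing to learn, and the
logarithm may vanish. *)
Lemma estimation_regime (Jhat : samples n l -> 'M[R]_n) (J : 'M[R]_n) :
  in_class M J ->
  (forall X, exists c, Jhat X = decode c) ->
  (forall X, in_class M (Jhat X)) ->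
  (forall X, total_screening (Jhat X) X <= total_screening J X + 53 * E ^+ 3 * n%:R ^+ 2) ->
  1 - delta <= iid_prob J [pred X : samples n l | frobenius_norm (Jhat X - J) <= rate].
Proof.
move=> hJ hc hin hloss; have [n1|n2] := leqP n 1.
  apply: certain_bound => X; have n1' : n = 1%N by apply/eqP; rewrite eqn_leq n1 n_gt0.
  by rewrite (frobenius_dim1 n1' (hin X) hJ) rate_ge0.
rewrite rate_sqr.
pose th : R := (1000 * 1000)^-1 / E ^+ 16.
have E16 : 0 < E ^+ 16 by rewrite exprn_gt0.
have th0 : 0 < th.
  by apply: divr_gt0; [rewrite invr_gt0; apply: mulr_gt0; rewrite ltr0n|exact: E16].
have thE : th * E ^+ 16 = (1000 * 1000)^-1 by apply: divfK; rewrite gt_eqF.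
have ths : th * E ^+ 16 <= (1000 * 1000)^-1 by rewrite thE; exact: lexx.
apply: (screening_risk (ltW M_gt0) hJ th0 ths hc hin hloss).
set L := ln (n * l)%:R; set Y := n%:R ^+ 2 * L + ln (1 / delta).
have -> : l%:R * (th * ((80 * expR M ^+ 8)^-1 * (rate_constant M ^+ 2 * (Y / l%:R)))) =
   (90 / 8) * Y.
  rewrite rate_constantE /th -/E; field.
  by rewrite !gt_eqF.
have L2 : 2^-1 <= L := ln_dim n2.
have n2L : n%:R ^+ 2 <= 2 * (n%:R ^+ 2 * L) :> R.
  have := ler_wpM2l (sqr_ge0 n%:R) L2; lra.
have hth : th * (53 * E ^+ 3 * n%:R ^+ 2) <= n%:R ^+ 2.
  rewrite mulrA -[leRHS]mul1r; apply: ler_wpM2r; first exact: sqr_ge0.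
  have : th * E ^+ 3 <= th * E ^+ 16 by rewrite ler_wpM2l ?(ltW th0) // ler_weXn2l.
  lra.
rewrite card_output_code.
have wpos : 0 < (2 * fw_weight (l * l) + 1)%N%:R :> R by rewrite ltr0n addn1.
have -> : ((2 * fw_weight (l * l) + 1) ^ (n * n))%N%:R =
    expR (n%:R ^+ 2 * ln (2 * fw_weight (l * l) + 1)%N%:R) :> R.
  by rewrite expr2 -natrM expRM_natl lnK ?posrE // natrX.
rewrite -expRD -[leRHS](@lnK R delta) ?posrE // ler_expR.
have -> : ln delta = - ln (1 / delta) by rewrite div1r lnV ?posrE // opprK.
have hw := ler_wpM2l (sqr_ge0 n%:R) (ln_outputs_le l_gt0 n2).
rewrite -/L in hw.
have := Ld; have := Lnl; rewrite -/L /Y => L0 D0.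
have : 0 <= n%:R ^+ 2 * L by rewrite mulr_ge0 ?sqr_ge0.
lra.
Qed.

End Regimes.
End Assembly.

Theorem corollary6 (R : realType) :
  exists C : R -> R, singly_exponential C /\
  exists (alg : prog) (q : {poly nat}),
  forall (M delta : R) (n l : nat),
    0 < M -> 0 < delta -> delta < 1 -> (1 <= n)%N -> (1 <= l)%N ->
  exists Jhat : samples n l -> 'M[R]_n,
    (forall X : samples n l,
       outputs_within alg (learning_input M delta X)
         q.[input_size M delta n l] (Jhat X)
       /\ in_class M (Jhat X))
    /\
    forall Jstar : 'M[R]_n, in_class M Jstar ->
      1 - delta <=
      iid_prob Jstar
        [pred X : samples n l |
           frobenius_norm (Jhat X - Jstar) <=
           C M * Num.sqrt ((n%:R ^+ 2 * ln (n * l)%:R + ln (1 / delta)) / l%:R)].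
Proof.
exists (@rate_constant R); split.
  exists (30 * 1000), 12; split; last by move=> M _; exact: lexx.
    by apply: mulr_gt0; rewrite ltr0n.
  by rewrite ltr0n.
exists learner, 'X^40 => M delta n l M0 d0 d1 n1 l1.
pose xs (X : samples n l) (s i : nat) := learning_input M delta X 2 (s * n + i)%N.
pose m := Num.floor (2 ^+ l * M).
pose good (X : samples n l) (A : 'M[R]_n) :=
  outputs_within learner (learning_input M delta X) ('X^40).[input_size M delta n l] A /\
  if Num.floor M < l%:Z then
    exists2 B, fw_run n l (xs X) m (l * l) B & A = rounded n l B (m%:~R / 2 ^+ l)
  else A = 0.
have ex X : exists A, good X A.
  have [mem [t [h1 h2 h3]]] := learner_exec delta X M0 n1 l1.
  exists (output_matrix R n mem); split; last by case: ifP h3.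
  exists mem, t; split=> //; apply: (leq_trans h2).
  rewrite hornerXn; apply: (@total_steps_le n l (bitlen (Num.floor M))) => //.
    by rewrite /input_size /bitlen; lia.
  by rewrite /input_size; lia.
pose Jhat X := xget 0 [set A | good X A].
have hg X : good X (Jhat X) by have [A gA] := ex X; exact: (xgetPex 0 (ex X)).
have [t0 t1 t2] := truncation M0 l1.
have hclass X : in_class M (Jhat X).
  have [_] := hg X; case: ifP => _; last by move=> ->; exact: zero_class.
  by move=> [B run ->]; exact: (rounded_class M0 run t0 t1).
exists Jhat; split=> [X|Jstar hJ]; first by split; [exact: (hg X).1|exact: hclass].
have [fM|fM] := ltP (Num.floor M) l%:Z.
  have Ml : M <= l%:R.
    have /andP[_ h] := floor_itv M; apply: le_trans (ltW h) _.
    by rewrite (_ : l%:R = l%:Z%:~R) // ler_int lezD1.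
  apply: estimation_regime => // X; have [_] := hg X; rewrite fM => -[B run JE].
  - by rewrite JE; exact: rounded_code run.
  - rewrite JE; apply: (rounded_loss n1 l1 M0 Ml hJ _ run erefl t0 t1 t2).
    by move=> s i; exact: (input_spin M delta X n1).
apply: certain_bound => // X; have [_] := hg X; rewrite ltNge fM /= => ->.
apply: large_norm_regime => //.
by apply: le_trans (floor_le M); rewrite (_ : l%:R = l%:Z%:~R) // ler_int.
Qed.
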